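(* Let $F\in\mathrm{Diff}(\mathbb C^3,0)$ be a germ of biholomorphism. Suppose that either (1) there exists a formal codimension 1 foliation $\mathcal F_\omega$ in $(\mathbb C^3,0)$ with no formal integrating factor such that $F^*\omega\wedge\omega=0$, or (2) there exists $g\in\hat{\mathcal O}_3\setminus\mathbb C$ such that $g\circ F=g$. Then $F^m$ has a formal invariant curve, where $m$ is the index of embeddability of $F$.
   Context: Let $\hat{\mathcal O}_n=\mathbb C[[x_1,\dots,x_n]]$ with maximal ideal $\mathfrak m$, and let $\hat K_3$ be the field of fractions of $\hat{\mathcal O}_3$. A formal codimension 1 foliation $\mathcal F_\omega$ in $(\mathbb C^3,0)$ is determined by a non-zero formal 1-form $\omega=a_1dx_1+a_2dx_2+a_3dx_3$, $a_j\in\hat{\mathcal O}_3$, with $\omega\wedge d\omega=0$ (two such forms define the same foliation if they differ by a factor in $\hat K_3\setminus\{0\}$). It has a formal integrating factor if there is $f\in\hat K_3\setminus\{0\}$ with $d(\omega/f)=0$. A formal curve is a prime ideal $\Gamma\subset\hat{\mathcal O}_n$ with $\dim\hat{\mathcal O}_n/\Gamma=1$; it is invariant for a diffeomorphism $F$ if $h\circ F\in\Gamma$ for all $h\in\Gamma$. $\widehat{\mathrm{Diff}}(\mathbb C^n,0)$ is the group of formal diffeomorphisms ($n$-tuples in $\mathfrak m^n$ with invertible linear part). $\hat{\mathfrak X}(\mathbb C^n,0)$ is the Lie algebra of singular formal vector fields $X=\sum a_j\,\partial/\partial x_j$, $a_j\in\mathfrak m$. $\mathrm{Exp}(X)$ is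 defined by $g\circ\mathrm{Exp}(X)=\sum_{j\ge0}X^j(g)/j!$ for $g\in\hat{\mathcal O}_n$. For $k\ge1$, let $\pi_k(F)\in GL(\mathfrak m/\mathfrak m^{k+1})$ be $f+\mathfrak m^{k+1}\mapsto f\circ F+\mathfrak m^{k+1}$, and $D_k=\pi_k(\widehat{\mathrm{Diff}}(\mathbb C^n,0))$, an algebraic matrix group; let $d\pi_k(X)$ be the derivation of $\mathfrak m/\mathfrak m^{k+1}$ induced by $X$. For a subgroup $G$, let $G_k$ be the Zariski closure of $\pi_k(G)$ with Lie algebra $\mathfrak g_k$; $\overline G=\{F:\pi_k(F)\in G_k\ \forall k\}$ and its Lie algebra is $\{X:d\pi_k(X)\in\mathfrak g_k\ \forall k\}$. $X$ is an infinitesimal generator of $F$ if $F=\mathrm{Exp}(X)$ and $X$ belongs to the Lie algebra of $\overline{\langle F\rangle}$. The index of embeddability of $F$ is the minimum $m\ge1$ such that $F^m$ has an infinitesimal generator (such an $m$ always exists, by a theorem of Binyamini). *)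

(* Defs.v *)
From HB Require Import structures.
From mathcomp Require Import all_boot all_order all_algebra.
From mathcomp Require Import ring_quotient complex mpoly ring.
From mathcomp Require Import boolp classical_sets reals.
From mathcomp Require Import topology normedtype sequences.
Import Order.TTheory GRing.Theory Num.Theory numFieldNormedType.Exports.

Set Implicit Arguments.
Unset Strict Implicit.
Unset Printing Implicit Defensive.

Local Open Scope ring_scope.

Record fps (n : nat) (K : fieldType) := Fps { fcoef : 'X_{1..n} -> K }.

Section FpsRing.
Context {n : nat} {K : fieldType}.
Implicit Types (f g h : fps n K) (m : 'X_{1..n}).

Lemma fpsP f g : fcoef f =1 fcoef g <-> f = g.
Proof.
by split=> [|-> //]; case: f g => [f] [g] /= /funext ->.
Qed.

HB.instance Definition _ := gen_eqMixin (fps n K).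
HB.instance Definition _ := gen_choiceMixin (fps n K).

Definition fps0 : fps n K := Fps (fun=> 0).
Definition fps_opp f : fps n K := Fps (fun m => - fcoef f m).
Definition fps_add f g : fps n K := Fps (fun m => fcoef f m + fcoef g m).

Let addA : associative fps_add.
Proof. by move=> f g h; apply/fpsP => m /=; rewrite addrA. Qed.
Let addC : commutative fps_add.
Proof. by move=> f g; apply/fpsP => m /=; rewrite addrC. Qed.
Let add0 : left_id fps0 fps_add.
Proof. by move=> f; apply/fpsP => m /=; rewrite add0r. Qed.
Let addN : left_inverse fps0 fps_opp fps_add.
Proof. by move=> f; apply/fpsP => m /=; rewrite addNr. Qed.

HB.instance Definition _ := GRing.isZmodule.Build (fps n K) addA addC add0 addN.

(* The constant series c and the product of series; the bounds on the degrees *)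
(* of k.1 and k.2 only serve to make the set of pairs finite.                 *)
Definition fpsC (c : K) : fps n K := Fps (fun m => if m == 0%MM then c else 0).
Definition fps_mul f g : fps n K := Fps (fun m =>
  \sum_(k : 'X_{1..n < (mdeg m).+1, (mdeg m).+1} | m == (k.1 + k.2)%MM)
    fcoef f k.1 * fcoef g k.2).

Definition fps_trunc (d : nat) f : {mpoly K[n]} :=
  \sum_(m : 'X_{1..n < d}) fcoef f m *: 'X_[m].

Lemma mcoeff_trunc d f m :
  (fps_trunc d f)@_m = if (mdeg m < d)%N then fcoef f m else 0.
Proof.
rewrite /fps_trunc raddf_sum /=; case: ifP => [lt_md|ge_md].
  rewrite (bigD1 (BMultinom lt_md)) //= mcoeffZ mcoeffX eqxx mulr1 big1 ?addr0 //.
  move=> k ne_km; rewrite mcoeffZ mcoeffX.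
  have /negbTE -> : bmnm k != m by rewrite -(inj_eq val_inj) in ne_km.
  by rewrite mulr0.
rewrite big1 // => k _; rewrite mcoeffZ mcoeffX; case: eqP => [e|]; rewrite ?mulr0 //.
by move: (bmdeg k); rewrite e ge_md.
Qed.

Lemma eq_mcoeffM (p p' q q' : {mpoly K[n]}) m :
    (forall k, (mdeg k <= mdeg m)%N -> p@_k = p'@_k) ->
    (forall k, (mdeg k <= mdeg m)%N -> q@_k = q'@_k) ->
  (p * q)@_m = (p' * q')@_m.
Proof.
move=> ep eq; rewrite !mcoeffM; apply: eq_bigr => k _.
by rewrite ep ?eq // -ltnS bmdeg.
Qed.

Lemma fcoefM_trunc d f g m : (mdeg m < d)%N ->
  fcoef (fps_mul f g) m = (fps_trunc d f * fps_trunc d g)@_m.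
Proof.
move=> lt_md; rewrite mcoeffM /=; apply: eq_bigr => k _.
by rewrite !mcoeff_trunc !(leq_trans _ lt_md) // ltnS -ltnS bmdeg.
Qed.

Let mulA : associative fps_mul.
Proof.
move=> f g h; apply/fpsP => m; pose d := (mdeg m).+1.
rewrite !(@fcoefM_trunc d) //.
transitivity ((fps_trunc d f * (fps_trunc d g * fps_trunc d h))@_m).
  apply: eq_mcoeffM => // k le_km.
  by rewrite mcoeff_trunc ltnS le_km (@fcoefM_trunc d).
rewrite mulrA; apply: eq_mcoeffM => // k le_km.
by rewrite mcoeff_trunc ltnS le_km (@fcoefM_trunc d).
Qed.

Let mulC : commutative fps_mul.
Proof.
move=> f g; apply/fpsP => m.
by rewrite !(@fcoefM_trunc (mdeg m).+1) // mulrC.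
Qed.

Let mul1 : left_id (fpsC 1) fps_mul.
Proof.
move=> f; apply/fpsP => m; rewrite (@fcoefM_trunc (mdeg m).+1) //.
transitivity ((1 * fps_trunc (mdeg m).+1 f)@_m).
  apply: eq_mcoeffM => // k le_km.
  by rewrite mcoeff_trunc ltnS le_km mcoeff1 /=; case: eqP.
by rewrite mul1r mcoeff_trunc ltnSn.
Qed.

Let mulDl : left_distributive fps_mul fps_add.
Proof.
move=> f g h; apply/fpsP => m /=; rewrite -big_split /=.
by apply: eq_bigr => k _; rewrite mulrDl.
Qed.

Let one_neq0 : fpsC 1 != fps0.
Proof.
apply/eqP => /fpsP /(_ 0%MM) /=; rewrite eqxx; apply/eqP; exact: oner_neq0.
Qed.

HB.instance Definition _ :=
  GRing.Zmodule_isComNzRing.Build (fps n K) mulA mulC mul1 mulDl one_neq0.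

Lemma fcoef0 m : fcoef (0 : fps n K) m = 0. Proof. by []. Qed.
Lemma fcoefN f m : fcoef (- f) m = - fcoef f m. Proof. by []. Qed.
Lemma fcoefD f g m : fcoef (f + g) m = fcoef f m + fcoef g m. Proof. by []. Qed.
Lemma fcoefM d f g m : (mdeg m < d)%N ->
  fcoef (f * g) m = (fps_trunc d f * fps_trunc d g)@_m.
Proof. exact: fcoefM_trunc. Qed.

Definition fps_unit : pred (fps n K) := fun f => `[< exists g, g * f = 1 >].
Definition fps_inv f : fps n K :=
  if pselect (exists g, g * f = 1) is left e then projT1 (cid e) else f.

Let mulVf : {in fps_unit, left_inverse 1 fps_inv *%R}.
Proof.
move=> f; rewrite unfold_in => /asboolP e.
by rewrite /fps_inv; case: pselect => // e'; case: cid.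
Qed.
Let unitP f g : g * f = 1 -> fps_unit f.
Proof. by move=> e; apply/asboolP; exists g. Qed.
Let inv0id : {in [predC fps_unit], fps_inv =1 id}.
Proof.
move=> f; rewrite inE => /asboolP ne.
by rewrite /fps_inv; case: pselect.
Qed.

HB.instance Definition _ :=
  GRing.ComNzRing_hasMulInverse.Build (fps n K) mulVf unitP inv0id.

Lemma fps_lowest f : f != 0 ->
  exists2 m, fcoef f m != 0 & forall k, (k < m)%O -> fcoef f k = 0.
Proof.
move=> f0; apply: contrapT => no_m; case/eqP: f0; apply/fpsP => m /=.
elim/(ltmwf (n := n)): m => m IH; apply: contrapT => /eqP fm; apply: no_m.
by exists m => // k /IH.
Qed.

Let fps_idom f g : f * g = 0 -> (f == 0) || (g == 0).
Proof.
move=> fg0; apply: contrapT => /negP; rewrite negb_or => /andP[].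
move=> /fps_lowest[a fa lta] /fps_lowest[b gb ltb].
move/fpsP: fg0 => /(_ (a + b)%MM) /=; apply/eqP.
have la : (mdeg a < (mdeg (a + b)).+1)%N by rewrite mdegD ltnS leq_addr.
have lb : (mdeg b < (mdeg (a + b)).+1)%N by rewrite mdegD ltnS leq_addl.
rewrite (bigD1 (BMultinom la, BMultinom lb)) //= big1 ?addr0 ?mulf_neq0 //.
move=> [k1 k2] /= /andP[/eqP e ne].
have [lt1|le1] := boolP (bmnm k1 < a)%O; first by rewrite lta ?mul0r.
have [lt2|le2] := boolP (bmnm k2 < b)%O; first by rewrite ltb ?mulr0.
move: le1 le2; rewrite -!leNgt => le1 le2.
have e1 : bmnm k1 = a.
  apply/eqP; apply: contraT => ne1.
  have : ((a + b)%MM < (bmnm k1 + bmnm k2)%MM)%O.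
    by apply: ltmc_le_add; rewrite // lt_neqAle eq_sym ne1.
  by rewrite -e ltxx.
have e2 : bmnm k2 = b by apply: (@addmI _ a); rewrite -{1}e1 -e.
by case/eqP: ne; congr pair; apply: val_inj.
Qed.

HB.instance Definition _ :=
  GRing.ComUnitRing_isIntegral.Build (fps n K) fps_idom.

End FpsRing.

Local Notation "x %:F" := (@FracField.tofrac _ x) : ring_scope.

Section Calculus.
Context {n : nat} {K : fieldType}.
Implicit Types (f g h : fps n K) (m : 'X_{1..n}).

Definition fpsXm (a : 'X_{1..n}) : fps n K := Fps (fun m => (m == a)%:R).
Definition fpsX (i : 'I_n) : fps n K := fpsXm U_(i)%MM.

Definition in_maximal_ideal f : Prop := fcoef f 0%MM = 0.

Definition pder (i : 'I_n) f : fps n K :=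
  Fps (fun m => fcoef f (m + U_(i))%MM *+ (m i).+1).

(* The series h(F_1, ..., F_n), where each F_i has no constant term. Then F^b *)
(* has no term of degree less than |b|, so that only the b with |b| <= |m|    *)
(* contribute to the coefficient of x^m.                                      *)
Definition fsubst h (F : 'I_n -> fps n K) : fps n K := Fps (fun m =>
  \sum_(b : 'X_{1..n < (mdeg m).+1})
    fcoef h b * fcoef (\prod_i F i ^+ (b : 'X_{1..n}) i) m).

Lemma pderM i f g : pder i (f * g) = pder i f * g + f * pder i g.
Proof.
apply/fpsP => m; pose d := (mdeg m).+2.
have dU : (mdeg (m + U_(i)) < d)%N by rewrite mdegD mdeg1 addn1.
have -> : fcoef (pder i (f * g)) m = fcoef (f * g) (m + U_(i))%MM *+ (m i).+1 by [].
rewrite fcoefD (fcoefM _ _ dU) -mcoeff_deriv mderivM.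
have dm : (mdeg m < d)%N by rewrite /d.
have ltd k : (mdeg k <= mdeg m)%N -> (mdeg k < d)%N.
  by move=> le_km; rewrite /d ltnS leqW.
have dtrunc h k : (mdeg k <= mdeg m)%N ->
    (fps_trunc d (pder i h))@_k = (fps_trunc d h)^`M(i)@_k.
  move=> le_km; rewrite mcoeff_deriv !mcoeff_trunc ltd //.
  by rewrite mdegD mdeg1 addn1 /d !ltnS le_km.
rewrite mcoeffD (fcoefM (pder i f) g dm) (fcoefM f (pder i g) dm).
by congr (_ + _); apply: eq_mcoeffM => // k le_km; rewrite dtrunc.
Qed.

(* Extension of pder to the field of fractions by the quotient rule; it does  *)
(* not depend on the chosen representative, see fracder_frac.                 *)
Definition fracder (i : 'I_n) (x : {fraction fps n K}) : {fraction fps n K} :=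
  let a := \n_(repr x) in let b := \d_(repr x) in
  (pder i a * b - a * pder i b)%:F / (b ^+ 2)%:F.

Lemma frac_reprE (x : {fraction fps n K}) :
  x * (\d_(repr x))%:F = (\n_(repr x))%:F.
Proof.
apply/eqP; rewrite -[x in x * _]reprK.
have -> : forall y z : {fraction fps n K}, y * z = FracField.mul y z by [].
rewrite !piE /= /FracField.equivf /FracField.mulf.
by rewrite !numden_Ratio ?mulf_neq0 ?oner_neq0 ?denom_ratioP // !mulr1 mulrC.
Qed.

Lemma fracder_frac i f g : g != 0 ->
  fracder i (f%:F / g%:F) = (pder i f * g - f * pder i g)%:F / (g ^+ 2)%:F.
Proof.
move=> g0; rewrite /fracder; move: (frac_reprE (f%:F / g%:F)).
have := denom_ratioP (repr (f%:F / g%:F)).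
move: (\n_(repr _)) (\d_(repr _)) => a b b0 ex.
have ab : f * b = a * g.
  apply/eqP; rewrite -tofrac_eq !tofracM -ex mulrAC divfK //.
  by rewrite tofrac_eq0.
have := congr1 (pder i) ab; rewrite !pderM => pab.
apply/eqP; rewrite eqr_div ?tofrac_eq0 ?expf_neq0 // -!tofracM tofrac_eq.
apply/eqP; move: (pder i f) (pder i g) (pder i a) (pder i b) pab.
move=> f' g' a' b' pab.
have -> : (a' * b - a * b') * g ^+ 2 = (a' * g) * (b * g) - (a * g) * (b' * g).
  by ring.
have -> : a' * g = f' * b + f * b' - a * g' by rewrite pab addrK.
have -> : (f' * b + f * b' - a * g') * (b * g) =
  (f' * b + f * b') * (b * g) - (a * g) * (g' * b) by ring.
by rewrite -ab; ring.
Qed.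

End Calculus.

(* Differential forms sum_i a_i dx_i, with coefficients in a ring A with      *)
(* partial derivatives D_i; 2-forms and 3-forms are given by their            *)
(* coefficients on dx_i /\ dx_j and dx_i /\ dx_j /\ dx_k, for all indices.    *)

Section Forms.
Context {n : nat} {A : comNzRingType} (D : 'I_n -> A -> A).

Definition wedge11 (a b : 'I_n -> A) : 'I_n -> 'I_n -> A :=
  fun i j => a i * b j - a j * b i.

Definition wedge12 (a : 'I_n -> A) (t : 'I_n -> 'I_n -> A) :
    'I_n -> 'I_n -> 'I_n -> A :=
  fun i j k => a i * t j k - a j * t i k + a k * t i j.

Definition dform1 (a : 'I_n -> A) : 'I_n -> 'I_n -> A :=
  fun i j => D i (a j) - D j (a i).

End Forms.

Section Foliations.
Context {n : nat} {K : fieldType}.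
Implicit Types (w : 'I_n -> fps n K) (F : 'I_n -> fps n K).

Definition defines_foliation w : Prop :=
  (exists i, w i != 0) /\
  (forall i j k, wedge12 w (dform1 pder w) i j k = 0).

Definition has_formal_integrating_factor w : Prop :=
  exists f : {fraction fps n K}, f != 0 /\
    forall i j, dform1 fracder (fun l => (w l)%:F / f) i j = 0.

Definition pullback F w : 'I_n -> fps n K :=
  fun i => \sum_j fsubst (w j) F * pder i (F j).

Definition preserves_foliation F w : Prop :=
  forall i j, wedge11 (pullback F w) w i j = 0.

End Foliations.

Definition krull_dim_eq (A : comNzRingType) (d : nat) : Prop :=
  let chain e := exists P : 'I_e.+1 -> prime_idealr A,
    forall i j : 'I_e.+1, (i < j)%N ->
      {subset P i <= P j} /\ ~ {subset P j <= P i} in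
  chain d /\ forall e, chain e -> (e <= d)%N.

Section Diffeomorphisms.
Context {n : nat} {K : fieldType}.
Implicit Types (F G : 'I_n -> fps n K) (X : 'I_n -> fps n K).

Definition is_formal_diffeo F : Prop :=
  (forall i, in_maximal_ideal (F i)) /\
  \matrix_(i, j) fcoef (F i) U_(j)%MM \in unitmx.

Definition fdiff_id : 'I_n -> fps n K := fpsX.
Definition fdiff_comp F G : 'I_n -> fps n K := fun i => fsubst (F i) G.
Definition fdiff_exp F (m : nat) : 'I_n -> fps n K :=
  iter m (fdiff_comp F) fdiff_id.

(* The cyclic group generated by a formal diffeomorphism F: a left inverse of *)
(* F^m is F^(-m).                                                             *)
Definition fdiff_cycle F : set ('I_n -> fps n K) := [set G |
  is_formal_diffeo G /\
  exists m, G = fdiff_exp F m \/ fdiff_comp G (fdiff_exp F m) = fdiff_id]%classic.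

Definition formal_curve (I : prime_idealr (fps n K)) : Prop :=
  krull_dim_eq {ideal_quot I} 1.

Definition curve_invariant (I : prime_idealr (fps n K)) F : Prop :=
  forall h, h \in I -> fsubst h F \in I.

Definition is_singular_vfield X : Prop := forall i, in_maximal_ideal (X i).

Definition vf_act X (g : fps n K) : fps n K := \sum_j X j * pder j g.

(* m^(k+1) consists of the series without terms of degree <= k, so that the   *)
(* monomials of degree 1, ..., k form a basis of m / m^(k+1).                 *)
Definition jet_index (k : nat) : finType :=
  {b : 'X_{1..n < k.+1} | (0 < mdeg b)%N}.
Definition jet_dim (k : nat) : nat := #|jet_index k|.

Definition jet_monom k (i : 'I_(jet_dim k)) : 'X_{1..n} :=
  val (enum_val i : jet_index k).

(* The matrix of the endomorphism of m / m^(k+1) induced by an endomorphism L *)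
(* of m; the j-th column is the image of the j-th monomial.                   *)
Definition jet_mx k (L : fps n K -> fps n K) : 'M[K]_(jet_dim k) :=
  \matrix_(i, j) fcoef (L (fpsXm (jet_monom j))) (jet_monom i).

Definition jet_diffeo k F : 'M[K]_(jet_dim k) := jet_mx k (fsubst^~ F).
Definition jet_vfield k X : 'M[K]_(jet_dim k) := jet_mx k (vf_act X).

End Diffeomorphisms.

Section LinearAlgebraicGroups.
Context {K : fieldType} {N : nat}.
Local Open Scope classical_set_scope.
Implicit Types (S : set 'M[K]_N) (A : 'M[K]_N) (P : {mpoly K[N * N]}).

Definition eval_mx P A : K := P.@[fun l => mxvec A 0 l].

Definition vanishes_on P S : Prop := forall A, S A -> eval_mx P A = 0.

Definition zariski_closure S : set 'M[K]_N :=
  [set A | A \in unitmx /\ forall P, vanishes_on P S -> eval_mx P A = 0].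

(* The tangent space at the identity of a Zariski closed subgroup S of GL_N.  *)
Definition lie_algebra S : set 'M[K]_N :=
  [set A | forall P, vanishes_on P S ->
     \sum_(l < N * N) eval_mx P^`M(l) 1%:M * mxvec A 0 l = 0].

End LinearAlgebraicGroups.

Section Embeddability.
Context {n : nat} {R : realType}.
Local Notation C := R[i].
Local Open Scope classical_set_scope.
Implicit Types (F : 'I_n -> fps n C) (X : 'I_n -> fps n C).

Definition zariski_jets (G : set ('I_n -> fps n C)) k : set 'M[C]_(jet_dim k) :=
  zariski_closure (jet_diffeo k @` G).
Arguments zariski_jets G k : clear implicits.

(* The Lie algebra of the pro-algebraic closure of a group G.                 *)
Definition lie_algebra_closure (G : set ('I_n -> fps n C)) :
    set ('I_n -> fps n C) :=
  [set X | is_singular_vfield X /\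
     forall k, (1 <= k)%N -> lie_algebra (zariski_jets G k) (jet_vfield k X)].

(* F = Exp(X). When the linear part of X is not nilpotent, the exponential    *)
(* series does not converge in the Krull topology; it does coefficientwise.   *)
Definition is_Exp X F : Prop :=
  forall (g : fps n C) (m : 'X_{1..n}),
    series (fun j : nat =>
      (fcoef (iter j (vf_act X) g) m / j`!%:R : C^o)) @ \oo
    --> (fcoef (fsubst g F) m : C^o).

Definition infinitesimal_generator X F : Prop :=
  is_Exp X F /\ lie_algebra_closure (fdiff_cycle F) X.

Definition embeddability_index F (m : nat) : Prop :=
  let embeds j := exists X, infinitesimal_generator X (fdiff_exp F j) in
  [/\ (1 <= m)%N, embeds m & forall j, (1 <= j)%N -> embeds j -> (m <= j)%N].

(* Absolute convergence on a closed polydisc centered at 0.                   *)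
Definition fps_convergent (f : fps n C) : Prop :=
  exists r M : R, 0 < r /\ forall d : nat,
    \sum_(m : 'X_{1..n < d}) `|fcoef f m| * r%:C%C ^+ mdeg m <= M%:C%C.

Definition is_biholomorphism_germ F : Prop :=
  is_formal_diffeo F /\ forall i, fps_convergent (F i).

End Embeddability.

(* Main.v *)
(** Let X be the infinitesimal generator of F^m. Since X lies in the Lie algebra
    of the closure of the group generated by F^m, differentiating at the identity
    the polynomial conditions satisfied by that group gives X(g) = 0 in case (2)
    and L_X w parallel to w in case (1); in case (1), w(X) <> 0 would make
    w / w(X) closed, against the absence of an integrating factor. So X is always
    tangent to a 1-form w (w = dg in case (2)) with L_X w parallel to w, and since
    C[[x, y, z]] is factorial the coefficients of w may be taken without common
    factor; then L_X w is a multiple of w and the ideal I(w) of the coefficients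
    of w is invariant by X.

    If the zeros of X are not isolated, any curve of zeros is invariant.
    Otherwise the coefficients of X form a regular sequence, so w(X) = 0 gives
    w = X x Z for some Z, and by Hilbert-Burch the 2 x 2 minors I(w) of (X, Z)
    do not contain a power of the maximal ideal. A prime G of dimension one above
    I(w) is invariant: the largest X-invariant ideal inside G is a prime
    containing I(w), hence of height at least two because I(w) has no common
    factor, hence equal to G. Finally Exp(X) preserves G because G is closed. *)

Require Import Defs.
From HB Require Import structures.
From mathcomp Require Import all_boot all_order all_algebra.
From mathcomp Require Import generic_quotient ring_quotient complex mpoly.
From mathcomp Require Import boolp classical_sets reals.
From mathcomp Require Import topology normedtype sequences.
From mathcomp Require Import ring.
Import Order.TTheory GRing.Theory Num.Theory numFieldNormedType.Exports.

Set Implicit Arguments.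
Unset Strict Implicit.
Unset Printing Implicit Defensive.

Local Open Scope ring_scope.

(** * Power series and substitution *)

(** A prime of dimension one arises from Zorn's lemma, as an ideal maximal among those that contain
    no power of the maximal ideal m; this maximality yields at once primality, m-adic closedness and
    the length of the chains above it. The height bound takes the form of a statement on chains of
    primes Q < P < m in three variables: an irreducible element of Q divides every element of Q.
    Weierstrass preparation proves it, by eliminating one variable at a time while integrality keeps
    the inclusions strict. Regularity enters through monomials: when the zero of X is isolated, the
    ideal of its coefficients contains x^k, y^k, z^k, and this regular sequence drives the Koszul
    argument. In the same way, if I(w) contained such powers, the Hilbert-Burch argument would
    produce 1 in the ideal of minors, whereas X vanishes at the origin. Since the linear part of X
    need not be nilpotent, the exponential series may fail to converge m-adically; invariance of the
    prime is therefore obtained in each finite-dimensional space of jets, where linear subspaces are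
    closed. *)

Lemma mnm_eq_add n (m a b : 'X_{1..n}) : (a <= m)%MM -> (m == a + b)%MM = (b == m - a)%MM.
Proof.
by move=> am; apply/eqP/eqP => ->; [rewrite addmC addmK | rewrite addmC submK].
Qed.

Section Coefficients.
Context {n : nat} {K : fieldType}.
Implicit Types (f g h : fps n K) (a b m : 'X_{1..n}).

Lemma fcoefB f g m : fcoef (f - g) m = fcoef f m - fcoef g m.
Proof. by []. Qed.

Lemma fcoef_sum (I : Type) (r : seq I) (P : pred I) (E : I -> fps n K) m :
  fcoef (\sum_(i <- r | P i) E i) m = \sum_(i <- r | P i) fcoef (E i) m.
Proof. exact: (big_morph (fun f => fcoef f m)). Qed.

Lemma fcoef1 m : fcoef (1 : fps n K) m = (m == 0%MM)%:R.
Proof. by rewrite /=; case: eqP. Qed.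

Lemma fcoefM_sub f g m : fcoef (f * g) m =
  \sum_(b : 'X_{1..n < (mdeg m).+1} | (b <= m)%MM) fcoef f b * fcoef g (m - b)%MM.
Proof.
transitivity (\sum_(a : 'X_{1..n < (mdeg m).+1})
   \sum_(b : 'X_{1..n < (mdeg m).+1} | m == (a + b)%MM) fcoef f a * fcoef g b).
  by rewrite pair_big_dep.
rewrite [RHS]big_mkcond /=; apply: eq_bigr => a _; case: ifP => am.
  have lt : (mdeg (m - a) < (mdeg m).+1)%N by rewrite ltnS mdegB.
  by rewrite (big_pred1 (BMultinom lt)) // => b /=; rewrite bmeqP mnm_eq_add.
rewrite big_pred0 // => b; apply: contraFF am => /eqP e.
by have := lem_addr a b; rewrite -e.
Qed.

Lemma fcoefM0 f g : fcoef (f * g) 0%MM = fcoef f 0%MM * fcoef g 0%MM.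
Proof.
have lt0 : (mdeg (0%MM : 'X_{1..n}) < (mdeg (0%MM : 'X_{1..n})).+1)%N by [].
rewrite fcoefM_sub (big_pred1 (BMultinom lt0)) /= ?subm0 // => b /=.
rewrite bmeqP /=; apply/idP/eqP => [/mnm_lepP le|->]; last exact: lepm_refl.
by apply/mnmP => i; apply/eqP; move: (le i); rewrite mnm0E leqn0.
Qed.

Lemma fcoefCM c f m : fcoef (fpsC c * f) m = c * fcoef f m.
Proof.
have lt0 : (mdeg (0%MM : 'X_{1..n}) < (mdeg m).+1)%N by rewrite mdeg0.
rewrite fcoefM_sub (bigD1 (BMultinom lt0)) /=; last first.
  by apply/mnm_lepP => i; rewrite mnm0E.
rewrite eqxx subm0 big1 ?addr0 // => b /andP[_].
by rewrite bmeqP /= => /negbTE ->; rewrite mul0r.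
Qed.

Lemma fpsC_is_zmod_morphism : zmod_morphism (@fpsC n K).
Proof.
by move=> c d; apply/fpsP => m; rewrite fcoefB /=; case: ifP; rewrite ?subrr.
Qed.
HB.instance Definition _ :=
  GRing.isZmodMorphism.Build K (fps n K) (@fpsC n K) fpsC_is_zmod_morphism.

Lemma fpsC_is_monoid_morphism : monoid_morphism (@fpsC n K).
Proof.
split=> [|c d]; first by [].
by apply/fpsP => m; rewrite fcoefCM /=; case: ifP; rewrite ?mulr0.
Qed.
HB.instance Definition _ :=
  GRing.isMonoidMorphism.Build K (fps n K) (@fpsC n K) fpsC_is_monoid_morphism.

Lemma fcoefMXm f a m :
  fcoef (f * fpsXm a) m = if (a <= m)%MM then fcoef f (m - a)%MM else 0.
Proof.
rewrite mulrC fcoefM_sub; case: ifP => am.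
  have lt : (mdeg a < (mdeg m).+1)%N by rewrite ltnS -(submK am) mdegD leq_addl.
  rewrite (bigD1 (BMultinom lt)) //= eqxx mul1r big1 ?addr0 // => b /andP[_].
  by rewrite bmeqP /= => /negbTE ->; rewrite mul0r.
rewrite big1 // => b bm; rewrite /=; case: eqP => [e|]; rewrite ?mul0r //.
by rewrite e am in bm.
Qed.

Lemma fpsXmD a b : fpsXm (a + b) = fpsXm a * fpsXm b :> fps n K.
Proof.
apply/fpsP => m; rewrite fcoefMXm /=; case: ifP => [bm|/negP nbm].
  by rewrite addmC mnm_eq_add // eq_sym.
by case: eqP => // e; case: nbm; rewrite e lem_addl.
Qed.

Lemma fpsXm0 : fpsXm 0%MM = 1 :> fps n K.
Proof. by apply/fpsP => m; rewrite fcoef1. Qed.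

Lemma fpsXmMn a k : fpsXm (a *+ k)%MM = fpsXm a ^+ k :> fps n K.
Proof.
elim: k => [|k IH]; first by rewrite mulm0n fpsXm0.
by rewrite mulmS fpsXmD IH exprS.
Qed.

Lemma fpsXm_prod a : fpsXm a = \prod_i fpsX i ^+ a i :> fps n K.
Proof.
rewrite [a in LHS]multinomUE_id.
rewrite (big_morph (@fpsXm n K) fpsXmD fpsXm0); apply: eq_bigr => i _.
exact: fpsXmMn.
Qed.

(** Membership in the [d]-th power of the maximal ideal, read on coefficients; it carries the m-adic
    topology throughout. *)
Definition ordge (d : nat) f : Prop := forall m, (mdeg m < d)%N -> fcoef f m = 0.

Lemma ordgeW d e f : (e <= d)%N -> ordge d f -> ordge e f.
Proof. by move=> le H m lt; apply: H; apply: leq_trans lt le. Qed.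

Lemma ordgeD d f g : ordge d f -> ordge d g -> ordge d (f + g).
Proof. by move=> Hf Hg m lt; rewrite fcoefD Hf ?Hg ?addr0. Qed.

Lemma ordgeN d f : ordge d f -> ordge d (- f).
Proof. by move=> Hf m lt; rewrite fcoefN Hf ?oppr0. Qed.

Lemma ordge_sum d (I : Type) (r : seq I) (P : pred I) (E : I -> fps n K) :
  (forall i, P i -> ordge d (E i)) -> ordge d (\sum_(i <- r | P i) E i).
Proof. by move=> H; elim/big_ind: _ => //; exact: ordgeD. Qed.

Lemma ordgeM d e f g : ordge d f -> ordge e g -> ordge (d + e) (f * g).
Proof.
move=> Hf Hg m lt; rewrite fcoefM_sub big1 // => b bm.
have em : mdeg m = (mdeg (m - b) + mdeg b)%N by rewrite -mdegD submK.
have [ltb|leb] := ltnP (mdeg b) d; first by rewrite Hf ?mul0r.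
rewrite Hg ?mulr0 // -(ltn_add2r (mdeg b)) -em (leq_trans lt) //.
by rewrite addnC leq_add2l.
Qed.

Lemma ordgeMl d f g : ordge d f -> ordge d (g * f).
Proof. by move=> H; rewrite -[d]add0n; apply: ordgeM. Qed.

Lemma ordge_exp d f k : ordge d f -> ordge (d * k) (f ^+ k).
Proof.
move=> H; elim: k => [|k IH]; first by rewrite muln0 => m.
by rewrite exprS mulnS; apply: ordgeM.
Qed.

Lemma ordge1P f : ordge 1 f <-> in_maximal_ideal f.
Proof.
split=> [H|H m]; first by apply: H; rewrite mdeg0.
by rewrite ltnS leqn0 mdeg_eq0 => /eqP ->.
Qed.

Lemma ordge_eq0 f : (forall d, ordge d f) -> f = 0.
Proof. by move=> H; apply/fpsP => m; apply: (H (mdeg m).+1). Qed.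

Definition fps_low d f : fps n K := Fps (fun m => if (mdeg m < d)%N then fcoef f m else 0).

Lemma fps_lowE d f : fps_low d f = \sum_(b : 'X_{1..n < d}) fpsC (fcoef f b) * fpsXm b.
Proof.
apply/fpsP => m; rewrite fcoef_sum.
under eq_bigr do rewrite fcoefCM [fcoef (fpsXm _) _]/=.
rewrite [LHS]/=; case: ifP => lt.
  rewrite (bigD1 (BMultinom lt)) // eqxx mulr1 big1 /= ?addr0 // => b.
  by rewrite bmeqP eq_sym => /negbTE ->; rewrite mulr0.
rewrite big1 // => b _; case: eqP => [e|]; rewrite ?mulr0 //.
by move: (bmdeg b); rewrite -e lt.
Qed.

Lemma ordge_sub_low d f : ordge d (f - fps_low d f).
Proof. by move=> m lt; rewrite fcoefB /= lt subrr. Qed.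

End Coefficients.

Lemma ordge_prod_exp n p (K : fieldType) (F : 'I_n -> fps p K) (a : 'X_{1..n}) :
  (forall i, in_maximal_ideal (F i)) -> ordge (mdeg a) (\prod_i F i ^+ a i).
Proof.
move=> HF; rewrite mdegE; elim/big_rec2: _ => // i d f _ H.
apply: ordgeM H; have := @ordge_exp _ _ 1 (F i) (a i).
by rewrite mul1n; apply; apply/ordge1P.
Qed.

Section Extensionality.
Context {n p : nat} {K : fieldType}.

(* An additive map that is continuous for the m-adic topology is determined by *)
(* its values on monomials.                                                    *)
Lemma continuous_eq0 (phi : fps n K -> fps p K) (c : nat) :
    (forall f g, phi (f + g) = phi f + phi g) ->
    (forall d f, ordge (d + c) f -> ordge d (phi f)) ->
    (forall x a, phi (fpsC x * fpsXm a) = 0) ->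
  forall f, phi f = 0.
Proof.
move=> phiD phi_cont phiX f; apply: ordge_eq0 => d.
have phi0 : phi 0 = 0 by apply: (addrI (phi 0)); rewrite -phiD !addr0.
rewrite -(subrK (fps_low (d + c) f) f) phiD fps_lowE.
rewrite (big_morph phi phiD phi0) [X in _ + X]big1 // addr0.
by apply: phi_cont; rewrite -fps_lowE; apply: ordge_sub_low.
Qed.

End Extensionality.

Section Substitution.
Context {n p : nat} {K : fieldType}.
Implicit Types (h g : fps n K) (F : 'I_n -> fps p K).

(** The formula of [fsubst], with source and target in possibly different numbers of variables, as
    the passage from [n] to [n.+1] variables demands; for equal numbers the two are convertible. *)
Definition fps_subst h F : fps p K := Fps (fun m =>
  \sum_(b : 'X_{1..n < (mdeg m).+1})
    fcoef h b * fcoef (\prod_i F i ^+ (b : 'X_{1..n}) i) m).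

Lemma fcoef_subst h F m : fcoef (fps_subst h F) m =
  \sum_(b : 'X_{1..n < (mdeg m).+1})
    fcoef h b * fcoef (\prod_i F i ^+ (b : 'X_{1..n}) i) m.
Proof. by []. Qed.

Lemma fps_substD h g F : fps_subst (h + g) F = fps_subst h F + fps_subst g F.
Proof.
apply/fpsP => m; rewrite fcoefD /= -big_split; apply: eq_bigr => b _ /=.
by rewrite mulrDl.
Qed.

Lemma fps_substCXm x a F : (forall i, in_maximal_ideal (F i)) ->
  fps_subst (fpsC x * fpsXm a) F = fpsC x * \prod_i F i ^+ a i.
Proof.
move=> HF; apply/fpsP => m; rewrite fcoefCM fcoef_subst.
under [LHS]eq_bigr do rewrite fcoefCM [fcoef (fpsXm a) _]/=.
have [lt|ge] := ltnP (mdeg a) (mdeg m).+1.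
  rewrite (bigD1 (BMultinom lt)) //= eqxx mulr1 [X in _ + X]big1 ?addr0 // => b.
  by rewrite bmeqP => /negbTE ->; rewrite mulr0 mul0r.
rewrite [LHS]big1 => [|b _].
  by rewrite (ordge_prod_exp HF) ?mulr0.
case: eqP => [e|]; rewrite ?mulr0 ?mul0r //.
by move: (bmdeg b); rewrite e ltnNge ge.
Qed.

Lemma fps_subst_ordge d h F : (forall i, in_maximal_ideal (F i)) ->
  ordge d h -> ordge d (fps_subst h F).
Proof.
move=> HF Hh m lt /=; rewrite big1 // => b _; rewrite Hh ?mul0r //.
by apply: leq_ltn_trans lt; rewrite -ltnS bmdeg.
Qed.

Lemma fps_substC x F : (forall i, in_maximal_ideal (F i)) ->
  fps_subst (fpsC x) F = fpsC x.
Proof.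
move=> HF; rewrite -[in LHS](mulr1 (fpsC x)) -fpsXm0 fps_substCXm //.
by rewrite big1 ?mulr1 // => i _; rewrite mnm0E.
Qed.

Lemma fps_subst0 F : fps_subst 0 F = 0.
Proof. by apply/fpsP => m /=; rewrite big1 // => b _; rewrite mul0r. Qed.

Lemma fps_substXm a F : (forall i, in_maximal_ideal (F i)) ->
  fps_subst (fpsXm a) F = \prod_i F i ^+ a i.
Proof.
by move=> HF; rewrite -[fpsXm a]mul1r -(rmorph1 (@fpsC n K)) fps_substCXm // rmorph1 mul1r.
Qed.

Lemma fps_substX i F : (forall i, in_maximal_ideal (F i)) ->
  fps_subst (fpsX i) F = F i.
Proof.
move=> HF; rewrite fps_substXm // (bigD1 i) //= mnm1E eqxx expr1.
by rewrite big1 ?mulr1 // => j ne; rewrite mnm1E eq_sym (negbTE ne).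
Qed.

(** Both sides are additive and continuous in each factor, so it suffices to compare them on
    monomials, first in [h], then in [g]. *)
Lemma fps_substM h g F : (forall i, in_maximal_ideal (F i)) ->
  fps_subst (h * g) F = fps_subst h F * fps_subst g F.
Proof.
move=> HF; apply/eqP; rewrite -subr_eq0; apply/eqP; move: h.
have ordM f d : ordge d f -> ordge d (fps_subst (f * g) F - fps_subst f F * fps_subst g F).
  move=> Hf; apply: ordgeD; last apply: ordgeN.
    by apply: fps_subst_ordge => //; rewrite mulrC; apply: ordgeMl.
  by rewrite mulrC; apply: ordgeMl; apply: fps_subst_ordge.
apply: (@continuous_eq0 n p K _ 0).
- by move=> f f'; rewrite mulrDl !fps_substD mulrDl opprD addrACA.
- by move=> d f; rewrite addn0; exact: ordM.
move=> x a; move: g {ordM}; apply: (@continuous_eq0 n p K _ 0).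
- by move=> f f'; rewrite mulrDr !fps_substD mulrDr opprD addrACA.
- move=> d f; rewrite addn0 => Hf; apply: ordgeD; last apply: ordgeN.
    by apply: fps_subst_ordge => //; apply: ordgeMl.
  by apply: ordgeMl; apply: fps_subst_ordge.
move=> y b; rewrite mulrACA -rmorphM -fpsXmD !fps_substCXm // rmorphM mulrACA.
rewrite -big_split (eq_bigr (fun i => F i ^+ a i * F i ^+ b i)) ?subrr // => i _.
by rewrite mnmDE exprD.
Qed.

End Substitution.

Lemma fps_subst_eqC n p (K : fieldType) (h : fps n K) (F : 'I_n -> fps p K) :
  (forall i, in_maximal_ideal (F i)) -> fcoef (fps_subst h F) 0%MM = fcoef h 0%MM.
Proof.
move=> HF.
have H1 : ordge 1 (h - fpsC (fcoef h 0%MM)).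
  by apply/ordge1P; rewrite /in_maximal_ideal fcoefB /= eqxx subrr.
rewrite -[in LHS](subrK (fpsC (fcoef h 0%MM)) h) fps_substD fcoefD fps_substC //=.
rewrite eqxx -[RHS]add0r; congr (_ + _).
by apply: (fps_subst_ordge HF H1); rewrite mdeg0.
Qed.

Lemma fps_substB n p (K : fieldType) (h g : fps n K) (F : 'I_n -> fps p K) :
  fps_subst (h - g) F = fps_subst h F - fps_subst g F.
Proof. by apply: (addIr (fps_subst g F)); rewrite -fps_substD !subrK. Qed.

Lemma fps_subst_comp n p q (K : fieldType) (h : fps n K) (F : 'I_n -> fps p K)
    (G : 'I_p -> fps q K) :
    (forall i, in_maximal_ideal (F i)) -> (forall i, in_maximal_ideal (G i)) ->
  fps_subst (fps_subst h F) G = fps_subst h (fun i => fps_subst (F i) G).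
Proof.
move=> HF HG; have HFG i : in_maximal_ideal (fps_subst (F i) G).
  by rewrite /in_maximal_ideal fps_subst_eqC //; apply: HF.
apply/eqP; rewrite -subr_eq0; apply/eqP; move: h.
apply: (@continuous_eq0 n q K _ 0).
- by move=> f f'; rewrite !fps_substD opprD addrACA.
- move=> d f; rewrite addn0 => Hf; apply: ordgeD; last apply: ordgeN.
    by apply: fps_subst_ordge => //; apply: fps_subst_ordge.
  by apply: fps_subst_ordge.
move=> x a; rewrite !fps_substCXm // fps_substM // fps_substC //.
apply/eqP; rewrite subr_eq0; apply/eqP; congr (_ * _).
have sub1 : fps_subst 1 G = 1 by rewrite -(rmorph1 fpsC) fps_substC // rmorph1.
rewrite (big_morph (fps_subst^~ G) (fun f g => fps_substM f g HG) sub1).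
apply: eq_bigr => i _; elim: (a i) => [|k IH] //=.
by rewrite !exprS fps_substM // IH.
Qed.

Lemma fps_subst_id n (K : fieldType) (h : fps n K) : fps_subst h fpsX = h.
Proof.
have HX i : in_maximal_ideal (fpsX i : fps n K).
  by rewrite /in_maximal_ideal /= eq_sym mnm1_eq0.
apply/eqP; rewrite -subr_eq0; apply/eqP; move: h.
apply: (@continuous_eq0 n n K _ 0).
- by move=> f f'; rewrite !fps_substD opprD addrACA.
- move=> d f; rewrite addn0 => Hf; apply: ordgeD => //; last exact: ordgeN.
  exact: fps_subst_ordge.
by move=> x a; rewrite fps_substCXm // -fpsXm_prod subrr.
Qed.

(** * Weierstrass division *)

Section Division.
Context {n : nat} {K : fieldType}.
Variables (w : 'X_{1..n} -> nat) (f : fps n K) (M : 'X_{1..n}).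
Hypothesis wD : forall a b, w (a + b)%MM = (w a + w b)%N.
Hypothesis fM : fcoef f M != 0.
Hypothesis f_dom : forall a, a != M -> fcoef f a != 0 -> (w M < w a)%N.

(** Every monomial of [f] other than [M] is heavier than [M], so besides [q] at [k] only
    coefficients of [q] of smaller weight contribute: the equations for [q] are triangular. *)
Lemma fcoef_dominantM q k : fcoef (f * q) (M + k)%MM = fcoef f M * fcoef q k +
  \sum_(b : 'X_{1..n < (mdeg (M + k)).+1} | (b <= M + k)%MM && (w b < w k)%N)
     fcoef f (M + k - b)%MM * fcoef q b.
Proof.
have lt : (mdeg k < (mdeg (M + k)).+1)%N by rewrite ltnS mdegD leq_addl.
rewrite mulrC fcoefM_sub (bigD1 (BMultinom lt)) /=; last exact: lem_addl.
rewrite addmK mulrC; congr (_ + _).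
rewrite [LHS]big_mkcond [RHS]big_mkcond; apply: eq_bigr => b _ /=.
rewrite bmeqP /=; case: (boolP (b <= M + k)%MM) => //= le.
have wE : (w (M + k - b) + w b = w M + w k)%N by rewrite -!wD submK.
have [e|ne] := eqVneq (bmnm b) k; first by rewrite e ltnn.
case: ltnP => // wkb; first by rewrite mulrC.
have [->|f0] := eqVneq (fcoef f (M + k - b)%MM) 0; first by rewrite mulr0.
have neM : (M + k - b)%MM != M.
  apply: contraNneq ne => e; apply/eqP/(@addmI _ M).
  by rewrite -{1}e submK.
have := f_dom neM f0; rewrite -(ltn_add2r (w b)) wE ltn_add2l.
by rewrite ltnNge wkb.
Qed.

(** Solution of the triangular system by recursion on the weight; [N] is fuel, sufficient as soon as
    it exceeds the weight of [k]. *)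
Fixpoint quotient_coef (h : fps n K) (N : nat) (k : 'X_{1..n}) : K :=
  if N is N'.+1 then
    (fcoef h (M + k)%MM -
     \sum_(b : 'X_{1..n < (mdeg (M + k)).+1} | (b <= M + k)%MM && (w b < w k)%N)
       fcoef f (M + k - b)%MM * quotient_coef h N' b) / fcoef f M
  else 0.

Lemma quotient_coef_stable h N N' k : (w k < N)%N -> (w k < N')%N ->
  quotient_coef h N k = quotient_coef h N' k.
Proof.
elim: N N' k => [|N IH] [|N'] k //= lt lt'; congr ((_ - _) / _).
apply: eq_bigr => b /andP[_ ltb]; congr (_ * _).
by apply: IH; apply: leq_trans ltb _.
Qed.

(** This division serves twice: [M = 0] weighted by the degree inverts series with nonzero constant
    term, and [M = z^d] weighted by [zweight] gives Weierstrass division. *)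
Lemma dominant_division h :
  exists q r, h = f * q + r /\ forall k, fcoef r (M + k)%MM = 0.
Proof.
pose q := Fps (fun k => quotient_coef h (w k).+1 k).
exists q, (h - f * q); split=> [|k]; first by rewrite addrC subrK.
rewrite fcoefB fcoef_dominantM [fcoef q k]/= mulrC divfK //.
under [X in _ - (_ + X)]eq_bigr => b /andP[_ ltb].
  have -> : fcoef q b = quotient_coef h (w k) b by exact: quotient_coef_stable.
  over.
by rewrite /= subrK subrr.
Qed.

Lemma dominant_division_unique q :
  (forall k, fcoef (f * q) (M + k)%MM = 0) -> q = 0.
Proof.
move=> H; apply/fpsP => k.
have [N] := ubnP (w k); elim: N k => // N IH k lt.
move: (H k); rewrite fcoef_dominantM big1 => [|b /andP[_ ltb]]; last first.
  by rewrite IH ?mulr0 //; apply: leq_trans ltb _.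
by rewrite addr0 => /eqP; rewrite mulf_eq0 (negbTE fM) => /eqP.
Qed.

End Division.

(** * Units and order in the local ring of power series *)

Section LocalRing.
Context {n : nat} {K : fieldType}.
Implicit Types (f g : fps n K).

Lemma fps_unitE f : (f \is a GRing.unit) = (fcoef f 0%MM != 0).
Proof.
apply/idP/idP => [fu|f0].
  apply/eqP => f0; have := congr1 (fun g => fcoef g 0%MM) (mulVr fu).
  by rewrite fcoefM0 f0 mulr0 fcoef1 eqxx => /esym/eqP; rewrite oner_eq0.
have dom a : a != 0%MM -> fcoef f a != 0 -> (mdeg (0%MM : 'X_{1..n}) < mdeg a)%N.
  by move=> ne _; rewrite mdeg0 lt0n mdeg_eq0.
have [q [r [e r0]]] := @dominant_division _ _ _ _ _ (@mdegD n) f0 dom 1.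
have r00 : r = 0 by apply/fpsP => m; have := r0 m; rewrite add0m.
by apply/unitrP; exists q; rewrite mulrC e r00 addr0.
Qed.

Lemma nonunitP f : f \isn't a GRing.unit <-> in_maximal_ideal f.
Proof. by rewrite fps_unitE negbK; split=> [/eqP|] // ->. Qed.

Lemma ordge_nonunitM d f g : f \isn't a GRing.unit -> ordge d g -> ordge d.+1 (f * g).
Proof. by move=> /nonunitP/ordge1P; apply: ordgeM. Qed.

Lemma fps_order_exists f : f != 0 -> exists d, ordge d f /\ ~ ordge d.+1 f.
Proof.
move=> /fps_lowest[m fm min].
have lt k : (mdeg k < mdeg m)%N -> fcoef f k = 0.
  by move=> lt; apply: min; apply: lt_mdeg_ltmc.
by exists (mdeg m); split=> [//|H]; move/eqP: fm; apply; apply: H.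
Qed.

Lemma ordge_nonzero f : f != 0 -> exists d, ~ ordge d f.
Proof. by move=> /fps_order_exists[d [_ H]]; exists d.+1. Qed.

End LocalRing.

Section LastVariable.
Context {n : nat} {K : fieldType}.
Implicit Types (f g h : fps n.+1 K) (b : fps n K) (m : 'X_{1..n.+1}) (a : 'X_{1..n}).
Implicit Types (p q : {poly fps n K}).

Local Notation z := (@ord_max n).

Definition mtail m : 'X_{1..n} := [multinom m (lift ord_max i) | i < n].
Definition mext a (j : nat) : 'X_{1..n.+1} :=
  [multinom if unlift ord_max i is Some i' then a i' else j | i < n.+1].

Lemma mext_max a j : mext a j z = j.
Proof. by rewrite mnmE unlift_none. Qed.
Lemma mext_lift a j i : mext a j (lift z i) = a i.
Proof. by rewrite mnmE liftK. Qed.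
Lemma mtailK m : mext (mtail m) (m z) = m.
Proof.
apply/mnmP => i; case: (unliftP z i) => [i' ->|->]; last by rewrite mext_max.
by rewrite mext_lift mnmE.
Qed.
Lemma mextK a j : mtail (mext a j) = a.
Proof. by apply/mnmP => i; rewrite mnmE mext_lift. Qed.

Lemma mdeg_mext a j : mdeg (mext a j) = (mdeg a + j)%N.
Proof.
rewrite !mdegE (bigD1_ord z) //= mext_max addnC; congr (_ + _)%N.
by apply: eq_bigr => i _; rewrite mext_lift.
Qed.

Lemma mextD a a' j k : (mext a j + mext a' k)%MM = mext (a + a') (j + k).
Proof.
apply/mnmP => i; rewrite mnmDE; case: (unliftP z i) => [i' ->|->].
  by rewrite !mext_lift mnmDE.
by rewrite !mext_max.
Qed.

Lemma mext0X j : (U_(z) *+ j)%MM = mext 0%MM j.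
Proof.
apply/mnmP => i; rewrite mulmnE mnm1E; case: (unliftP z i) => [i' ->|->].
  by rewrite mext_lift mnm0E (negbTE (neq_lift _ _)) mul0n.
by rewrite mext_max eqxx mul1n.
Qed.

Definition fps_widen b : fps n.+1 K := fps_subst b (fun i => fpsX (lift z i)).

Let Xmax i : in_maximal_ideal (fpsX (lift z i) : fps n.+1 K).
Proof. by rewrite /in_maximal_ideal /= eq_sym mnm1_eq0. Qed.

Lemma fps_widen_is_zmod_morphism : zmod_morphism fps_widen.
Proof. by move=> b c; rewrite /fps_widen fps_substB. Qed.
HB.instance Definition _ :=
  GRing.isZmodMorphism.Build (fps n K) (fps n.+1 K) fps_widen fps_widen_is_zmod_morphism.
Lemma fps_widen_is_monoid_morphism : monoid_morphism fps_widen.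
Proof.
split=> [|b c]; last exact: fps_substM.
by rewrite /fps_widen -(rmorph1 (@fpsC n K)) fps_substC // rmorph1.
Qed.
HB.instance Definition _ :=
  GRing.isMonoidMorphism.Build (fps n K) (fps n.+1 K) fps_widen fps_widen_is_monoid_morphism.

Lemma fps_widenX i : fps_widen (fpsX i) = fpsX (lift z i).
Proof. exact: fps_substX. Qed.

Lemma fcoef_widen b m : fcoef (fps_widen b) m = if m z == 0%N then fcoef b (mtail m) else 0.
Proof.
have prodE a : \prod_i fpsX (lift z i) ^+ a i = fpsXm (mext a 0) :> fps n.+1 K.
  rewrite fpsXm_prod (bigD1_ord z) //= mext_max expr0 mul1r.
  by apply: eq_bigr => i _; rewrite mext_lift.
rewrite fcoef_subst; under [LHS]eq_bigr do rewrite prodE [fcoef (fpsXm _) _]/=.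
case: eqP => [m0|mN0]; last first.
  rewrite big1 // => a _; case: eqP => [e|]; rewrite ?mulr0 //.
  by case: mN0; rewrite -(mext_max a 0) -e.
have lt : (mdeg (mtail m) < (mdeg m).+1)%N.
  by rewrite -{2}(mtailK m) mdeg_mext ltnS leq_addr.
rewrite (bigD1 (BMultinom lt)) //= -{1}m0 mtailK eqxx mulr1 big1 ?addr0 // => a.
rewrite bmeqP /= => ne; case: eqP => [e|]; rewrite ?mulr0 //.
by case/eqP: ne; rewrite -(mextK a 0) -e.
Qed.

Definition fps_eval p : fps n.+1 K := (map_poly fps_widen p).[fpsX z].

Lemma fps_evalD p q : fps_eval (p + q) = fps_eval p + fps_eval q.
Proof. by rewrite /fps_eval rmorphD hornerD. Qed.
Lemma fps_evalM p q : fps_eval (p * q) = fps_eval p * fps_eval q.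
Proof. by rewrite /fps_eval rmorphM hornerM. Qed.
Lemma fps_evalB p q : fps_eval (p - q) = fps_eval p - fps_eval q.
Proof. by rewrite /fps_eval rmorphB hornerD hornerN. Qed.
Lemma fps_eval0 : fps_eval 0 = 0.
Proof. by rewrite /fps_eval rmorph0 horner0. Qed.
Lemma fps_evalC b : fps_eval b%:P = fps_widen b.
Proof. by rewrite /fps_eval map_polyC hornerC. Qed.
Lemma fps_evalXn j : fps_eval 'X^j = fpsX z ^+ j.
Proof. by rewrite /fps_eval map_polyXn hornerXn. Qed.

Lemma fcoef_eval p m : fcoef (fps_eval p) m = fcoef p`_(m z) (mtail m).
Proof.
have E j b : fcoef (fps_widen b * fpsX z ^+ j) m =
    if m z == j then fcoef b (mtail m) else 0.
  rewrite -fpsXmMn fcoefMXm mext0X; case: ifP => [/mnm_lepP/(_ z)|/negP nle].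
    rewrite mext_max => le; rewrite fcoef_widen mnmBE mext_max.
    rewrite subn_eq0 eqn_leq le andbT; case: ifP => // _; congr (fcoef b _).
    by apply/mnmP => i; rewrite [LHS]mnmE mnmBE mext_lift mnm0E subn0 [RHS]mnmE.
  case: eqP => // e; case: nle; apply/mnm_lepP => i.
  by rewrite -[m]mtailK e; case: (unliftP z i) => [i' ->|->]; rewrite ?mext_lift ?mext_max ?mnm0E.
rewrite /fps_eval /map_poly horner_poly fcoef_sum; under eq_bigr do rewrite E.
have [lt|ge] := ltnP (m z) (size p).
  rewrite (bigD1 (Ordinal lt)) //= eqxx big1 ?addr0 // => j.
  by rewrite eq_sym -val_eqE /= => /negbTE ->.
rewrite nth_default // big1 // => j _; case: eqP => // e.
by move: (ltn_ord j); rewrite -e ltnNge ge.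
Qed.

Lemma fps_eval_inj p : fps_eval p = 0 -> p = 0.
Proof.
move=> e; apply/polyP => j; rewrite coef0; apply/fpsP => a.
have := congr1 (fun f => fcoef f (mext a j)) e.
by rewrite fcoef_eval mext_max mextK.
Qed.

(** The restriction of [f] to the last axis has order exactly [d]. *)
Definition zregular (d : nat) f : Prop :=
  fcoef f (mext 0 d) != 0 /\ forall j, (j < d)%N -> fcoef f (mext 0 j) = 0.

(* With the last variable of weight 1 and the others of weight d + 1, the     *)
(* monomial z^d is the only one of minimal weight in f.                       *)
Definition zweight (d : nat) m : nat := (mdeg (mtail m) * d.+1 + m z)%N.

Lemma zweightD d m m' : zweight d (m + m')%MM = (zweight d m + zweight d m')%N.
Proof.
rewrite /zweight; have -> : mtail (m + m')%MM = (mtail m + mtail m')%MM.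
  by apply/mnmP => i; rewrite !(mnmE, mnmDE).
by rewrite mdegD mnmDE mulnDl addnACA.
Qed.

Lemma zregular_dominant d f : zregular d f ->
  forall m, m != mext 0 d -> fcoef f m != 0 -> (zweight d (mext 0 d) < zweight d m)%N.
Proof.
move=> [_ f0] m ne fm; rewrite /zweight mextK mdeg0 mul0n add0n mext_max.
have [e|ne0] := eqVneq (mtail m) 0%MM; last first.
  by apply: leq_trans (leq_addr _ _); apply: leq_pmull; rewrite lt0n mdeg_eq0.
rewrite e mdeg0 mul0n add0n ltnNge; apply/negP; rewrite leq_eqVlt => /orP[/eqP e'|lt].
  by case/eqP: ne; rewrite -[m]mtailK e e'.
by case/eqP: fm; rewrite -[m]mtailK e f0.
Qed.

(** The remainder of the dominant division has no monomial divisible by z^d, so it is a polynomial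
    in [z] of degree less than [d]. *)
Lemma weierstrass_division d f : zregular d f ->
  forall h, exists g p, (size p <= d)%N /\ h = f * g + fps_eval p.
Proof.
move=> reg h.
have [q [r [e r0]]] := dominant_division (zweightD d) reg.1 (zregular_dominant reg) h.
exists q, (\poly_(j < d) Fps (fun a => fcoef r (mext a j))).
split; first exact: size_poly.
rewrite e; congr (_ + _); apply/fpsP => m.
rewrite fcoef_eval coef_poly; case: ltnP => [lt|ge]; first by rewrite /= mtailK.
have -> : m = (mext 0 d + mext (mtail m) (m z - d))%MM.
  by rewrite mextD add0m subnKC // mtailK.
exact: r0.
Qed.

Lemma weierstrass_unique d f p h : zregular d f -> (size p <= d)%N ->
  fps_eval p = f * h -> p = 0.
Proof.
move=> reg szp e; apply: fps_eval_inj; rewrite e.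
suff -> : h = 0 by rewrite mulr0.
apply: (dominant_division_unique (zweightD d) reg.1 (zregular_dominant reg)) => k.
 rewrite -e fcoef_eval nth_default //.
by apply: leq_trans szp _; rewrite mnmDE mext_max leq_addr.
Qed.

Lemma weierstrass_preparation d f : zregular d f ->
  exists W u, [/\ W \is monic, size W = d.+1, u \is a GRing.unit & fps_eval W = f * u].
Proof.
move=> reg; have [q [r [szr e]]] := weierstrass_division reg (fpsX z ^+ d).
have eW : fps_eval ('X^d - r) = f * q by rewrite fps_evalB fps_evalXn e addrK.
have szW : size ('X^d - r) = d.+1.
  by rewrite size_polyDl ?size_polyXn // size_polyN ltnS.
exists ('X^d - r), q; split=> //.
  by rewrite monicE lead_coefE szW /= coefB coefXn eqxx nth_default ?subr0.
(* No weight is below that of 0, so the coefficient of [f * q] at z^d is that of [f] times the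
   constant term of [q]; on the polynomial side it is 1. *)
rewrite fps_unitE; apply/eqP => q0.
have := congr1 (fun h => fcoef h (mext 0 d + 0)%MM) eW.
rewrite (fcoef_dominantM (zweightD d) (zregular_dominant reg)).
rewrite q0 mulr0 add0r big1; last first.
  by move=> b /andP[_]; rewrite {2}/zweight !mnm0E (_ : mtail 0 = 0%MM) ?mdeg0 // ;
    apply/mnmP => i; rewrite !mnmE.
rewrite addm0 fcoef_eval mext_max mextK coefB coefXn eqxx nth_default // subr0.
by move/eqP; rewrite fcoef1 eqxx oner_eq0.
Qed.

Lemma zregular0_unit f : zregular 0 f -> f \is a GRing.unit.
Proof.
by case=> f0 _; rewrite fps_unitE; have <- : mext 0 0 = 0%MM by rewrite -mext0X mulm0n.
Qed.

End LastVariable.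

(** * Regularity in the last variable after a shear *)

Definition weight n (N : 'I_n -> nat) (m : 'X_{1..n}) : nat := (\sum_i m i * N i)%N.

(* The weights grow so fast from the last variable to the first that the      *)
(* lexicographically smallest element of S is its only lightest one.          *)
Lemma separating_weight n (S : 'X_{1..n.+1} -> Prop) : (exists m, S m) ->
  exists N : 'I_n.+1 -> nat, [/\ N ord_max = 1%N, forall i, (0 < N i)%N &
    exists2 m, S m & forall b, S b -> b != m -> (weight N m < weight N b)%N].
Proof.
have min_at p (T : 'X_{1..p.+1} -> Prop) : (exists m, T m) ->
    exists2 m, T m & forall b, T b -> (m ord0 <= b ord0)%N.
  move=> [m]; have [k] := ubnP (m ord0); elim: k m => // k IH m lt Tm.
  have [[b Tb ltb]|no] := pselect (exists2 b, T b & (b ord0 < m ord0)%N).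
    by apply: (IH b) => //; apply: leq_trans ltb _.
  by exists m => // b Tb; rewrite leqNgt; apply/negP => ltb; apply: no; exists b.
elim: n S => [|n IH] S neS.
  have [m Sm min] := min_at _ _ neS; exists (fun=> 1%N); split=> //.
  exists m => // b Sb ne; rewrite /weight !big_ord1 !muln1 ltn_neqAle min // andbT.
  by apply: contraNneq ne => e; apply/eqP/mnmP => i; rewrite (ord1 i).
have [m1 Sm1 min] := min_at _ _ neS.
pose tl (m : 'X_{1..n.+2}) : 'X_{1..n.+1} := [multinom m (lift ord0 i) | i < n.+1].
have tl_inj (m b : 'X_{1..n.+2}) : m ord0 = b ord0 -> tl m = tl b -> m = b.
  move=> e0 e; apply/mnmP => i; case: (unliftP ord0 i) => [j|] -> //.
  by have := congr1 (fun t => fun_of_multinom t j) e; rewrite !mnmE.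
pose S' m' := exists2 m, S m & m ord0 = m1 ord0 /\ tl m = m'.
have [|N' [N'max N'pos [_ [m Sm [em <-]] lightest]]] := IH S'.
  by exists (tl m1), m1.
(* One more unit in the first exponent must outweigh the whole tail of [m], hence the successor. *)
pose N i := if unlift ord0 i is Some j then N' j else (weight N' (tl m)).+1.
have NE b : weight N b = (b ord0 * (weight N' (tl m)).+1 + weight N' (tl b))%N.
  rewrite /weight big_ord_recl /N unlift_none; congr (_ + _)%N.
  by apply: eq_bigr => j _; rewrite liftK mnmE.
exists N; split.
- by have -> : ord_max = lift ord0 ord_max :> 'I_n.+2; [apply: val_inj | rewrite /N liftK].
- by move=> i; rewrite /N; case: unliftP.
exists m => // b Sb ne; rewrite !NE em.
have [e|ne0] := eqVneq (b ord0) (m1 ord0).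
  rewrite e ltn_add2l; apply: lightest; first by exists b.
  by apply: contraNneq ne => e'; apply/eqP/tl_inj; rewrite ?e ?em.
have lt : (m1 ord0 < b ord0)%N by rewrite ltn_neqAle eq_sym ne0 min.
apply: leq_trans (leq_addr _ _); rewrite -addnS -mulSnr.
by rewrite leq_mul2r lt orbT.
Qed.

Section SubstMorphism.
Context {n p : nat} {K : fieldType} (F : 'I_n -> fps p K).
Hypothesis HF : forall i, in_maximal_ideal (F i).

(* The hypothesis is an argument, so that the morphism structure can be keyed *)
(* on the function.                                                           *)
Definition fps_substm (_ : forall i, in_maximal_ideal (F i)) (h : fps n K) : fps p K :=
  fps_subst h F.
HB.instance Definition _ := GRing.isZmodMorphism.Build (fps n K) (fps p K)
  (fps_substm HF) (fun h g => fps_substB h g F).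
Lemma fps_substm_is_monoid_morphism : monoid_morphism (fps_substm HF).
Proof.
split=> [|h g]; last exact: fps_substM.
by rewrite /fps_substm -(rmorph1 (@fpsC n K)) fps_substC // rmorph1.
Qed.
HB.instance Definition _ := GRing.isMonoidMorphism.Build (fps n K) (fps p K)
  (fps_substm HF) fps_substm_is_monoid_morphism.

Lemma fps_substmX i : fps_substm HF (fpsX i) = F i.
Proof. exact: fps_substX. Qed.

End SubstMorphism.

Section Shear.
Context {n : nat} {K : fieldType}.
Local Notation A := (fps n.+1 K).
Local Notation z := (@ord_max n).

Lemma fpsX_max i : in_maximal_ideal (fpsX i : A).
Proof. by rewrite /in_maximal_ideal /= eq_sym mnm1_eq0. Qed.

(** The substitution [s] kills all variables but the last. After it, the shear x_i -> x_i + z^(N i)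
    sends the monomial x^b to the power of [z] of exponent [weight N b]. *)
Lemma fcoef_subst_axis (N : 'I_n.+1 -> nat) (F : 'I_n.+1 -> A) (h : A) k :
    N z = 1%N -> (forall i, in_maximal_ideal (F i)) ->
    (forall i, F i = (if i == z then 0 else fpsX i) + fpsX z ^+ N i) ->
  fcoef (fps_subst h F) (mext 0 k) =
  \sum_(b : 'X_{1..n.+1 < k.+1}) fcoef h b * (k == weight N b)%:R.
Proof.
move=> Nz HF FE; pose s i : A := if i == z then fpsX z else 0.
have Hs i : in_maximal_ideal (s i).
  by rewrite /s; case: ifP => _ //; apply: fpsX_max.
have sE (g : A) : fcoef (fps_subst g s) (mext 0 k) = fcoef g (mext 0 k).
  have prodE (b : 'X_{1..n.+1}) : \prod_i s i ^+ b i =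
      if mtail b == 0%MM then fpsXm (mext 0 (b z)) else 0.
    rewrite (bigD1_ord z) //= {1}/s eqxx; case: eqP => [e|ne].
      rewrite big1 => [|j _]; first by rewrite mulr1 -mext0X fpsXmMn.
      have := congr1 (fun t => fun_of_multinom t j) e.
      by rewrite /mtail !mnmE => ->.
    have [j bj] : exists j, b (lift z j) != 0%N.
      apply: contrapT => no; apply: ne; apply/mnmP => j; rewrite /mtail !mnmE.
      by apply: contrapT => /eqP bj; apply: no; exists j.
    rewrite (bigD1 j) //= /s -[lift z j == z]negbK eq_sym neq_lift /=.
    by rewrite expr0n (negbTE bj) mul0r mulr0.
  rewrite fcoef_subst mdeg_mext mdeg0 add0n.
  have lt : (mdeg (mext (0%MM : 'X_{1..n}) k) < k.+1)%N by rewrite mdeg_mext mdeg0.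
  rewrite (bigD1 (BMultinom lt)) //= prodE mextK eqxx mext_max /= eqxx mulr1.
  rewrite big1 ?addr0 // => b; rewrite bmeqP /= prodE => ne.
  case: eqP => [e|_]; rewrite ?mulr0 //=; case: eqP => [e'|]; rewrite ?mulr0 //.
  by case/eqP: ne; rewrite -[bmnm b]mtailK e -e'.
rewrite -sE fps_subst_comp // fcoef_subst mdeg_mext mdeg0 add0n.
apply: eq_bigr => b _; congr (_ * _).
have -> : \prod_i fps_subst (F i) s ^+ (b : 'X_{1..n.+1}) i = fpsXm (mext 0 (weight N b)).
  rewrite -mext0X fpsXmMn /weight expr_sum; apply: eq_bigr => i _.
  have -> : fps_subst (F i) s = fpsX z ^+ N i.
    rewrite FE -[LHS]/(fps_substm Hs _) rmorphD rmorphXn /=.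
    rewrite fps_substmX {2}/s eqxx.
    have [e|ne] := eqVneq i z; first by rewrite rmorph0 add0r.
    by rewrite fps_substmX /s (negbTE ne) add0r.
  by rewrite -exprM mulnC.
have mext_inj : injective (mext (0%MM : 'X_{1..n})).
  by move=> j j' /(congr1 (fun m => fun_of_multinom m z)); rewrite !mext_max.
by rewrite /= (inj_eq mext_inj).
Qed.

(** Since exactly one monomial of [f] has least weight, nothing cancels it on the last axis after
    the shear; the order of regularity is that least weight. *)
Lemma shear_exists (f : A) : f != 0 ->
  exists (phi psi : {rmorphism A -> A}) d,
    [/\ cancel phi psi, cancel psi phi & zregular d (phi f)].
Proof.
move=> f0; have [|N [Nz Npos [M fM dom]]] := @separating_weight n (fun m => fcoef f m != 0).
  by have [m fm _] := fps_lowest f0; exists m.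
pose g i : A := if i == z then 0 else fpsX z ^+ N i.
have Hg i : in_maximal_ideal (g i).
  rewrite /g; case: ifP => // _; apply/ordge1P.
  have := @ordge_exp _ _ 1 _ (N i) ((ordge1P _).2 (fpsX_max z)).
  by apply: ordgeW; rewrite mul1n.
have HD (e : A) i : in_maximal_ideal (fpsX i + e * g i).
  by rewrite /in_maximal_ideal fcoefD fcoefM0 Hg mulr0 addr0; apply: fpsX_max.
(* [e] and [e'] are opposite signs: as [z] is fixed, adding and subtracting z^(N i) are mutually
   inverse. *)
have comp e e' : e + e' = 0 :> A -> (e = 1 \/ e = -1) -> (e' = 1 \/ e' = -1) ->
    cancel (fps_substm (HD e)) (fps_substm (HD e')).
  move=> ee e1 e1' h; rewrite /fps_substm fps_subst_comp // -[RHS]fps_subst_id.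
  congr fps_subst; apply/funext => i.
  rewrite -[LHS]/(fps_substm (HD e') _) rmorphD rmorphM /=.
  have -> : fps_substm (HD e') e = e.
    by case: e1 => ->; rewrite ?rmorphN rmorph1.
  rewrite fps_substmX -addrA.
  have -> : fps_substm (HD e') (g i) = g i.
    rewrite /g; case: ifP => _; first by rewrite rmorph0.
    by rewrite rmorphXn /= fps_substmX /g eqxx mulr0 addr0.
  by rewrite -mulrDl addrC addrC [e' + e]addrC ee mul0r addr0.
exists (fps_substm (HD 1)), (fps_substm (HD (-1))), (weight N M); split.
- by apply: comp; rewrite ?subrr; [|left|right].
- by apply: comp; rewrite ?addNr; [|right|left].
have FE i : fpsX i + 1 * g i = (if i == z then 0 else fpsX i) + fpsX z ^+ N i.
  by rewrite /g mul1r; case: eqP => [->|_] //; rewrite Nz addrC expr1.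
have E := fcoef_subst_axis f _ Nz (HD 1) FE.
(* All weights being positive, the degree is bounded by the weight, so [M] lies in the range of the
   sum given by [E]. *)
have leW m : (mdeg m <= weight N m)%N.
  by rewrite mdegE /weight; apply: leq_sum => i _; apply: leq_pmulr.
split=> [|j lt].
  have lt : (mdeg M < (weight N M).+1)%N by rewrite ltnS.
  rewrite [fcoef _ _]E (bigD1 (BMultinom lt)) //= eqxx mulr1 big1 ?addr0 // => b.
  rewrite bmeqP /= => ne; have [->|fb] := eqVneq (fcoef f b) 0; first by rewrite mul0r.
  by rewrite ltn_eqF ?mulr0 // dom.
rewrite [LHS]E big1 // => b _; have [->|fb] := eqVneq (fcoef f b) 0; first by rewrite mul0r.
rewrite ltn_eqF ?mulr0 //; apply: leq_trans lt _.
by have [->//|ne] := eqVneq (bmnm b) M; rewrite ltnW // dom.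
Qed.

End Shear.

(** * Factoriality of power series rings *)

Definition fdvd (A : comNzRingType) (f g : A) : Prop := exists h, g = f * h.

Definition prime_elt (A : comUnitRingType) (p : A) : Prop :=
  [/\ p != 0, p \isn't a GRing.unit &
      forall f g, fdvd p (f * g) -> fdvd p f \/ fdvd p g].

Definition irreducible_elt (A : comUnitRingType) (p : A) : Prop :=
  [/\ p != 0, p \isn't a GRing.unit &
      forall f g, p = f * g -> f \is a GRing.unit \/ g \is a GRing.unit].

(** The uniqueness half of factoriality; existence of irreducible factors comes from the finite
    order of a nonzero series, in [irreducible_factor]. *)
Definition factorial (A : comUnitRingType) : Prop :=
  forall p : A, irreducible_elt p -> prime_elt p.

Section Divisibility.
Context {A : comUnitRingType}.
Implicit Types (f g h : A).

Lemma fdvd0 f : fdvd f 0. Proof. by exists 0; rewrite mulr0. Qed.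
Lemma fdvdD f g h : fdvd f g -> fdvd f h -> fdvd f (g + h).
Proof. by move=> [a ->] [b ->]; exists (a + b); rewrite mulrDr. Qed.
Lemma fdvdB f g h : fdvd f g -> fdvd f h -> fdvd f (g - h).
Proof. by move=> [a ->] [b ->]; exists (a - b); rewrite mulrBr. Qed.
Lemma fdvd_mulr f g h : fdvd f g -> fdvd f (g * h).
Proof. by move=> [a ->]; exists (a * h); rewrite mulrA. Qed.
Lemma fdvd_mull f g h : fdvd f g -> fdvd f (h * g).
Proof. by move=> H; rewrite mulrC; apply: fdvd_mulr. Qed.
Lemma fdvd_sum f (I : Type) (r : seq I) (P : pred I) (E : I -> A) :
  (forall i, P i -> fdvd f (E i)) -> fdvd f (\sum_(i <- r | P i) E i).
Proof.
by move=> H; elim/big_ind: _ => //; [exact: fdvd0 | move=> *; exact: fdvdD].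
Qed.

(** Take the first indices [i], [j] at which [p] fails to divide: in the coefficient of index
    [i + j] of the product, every term but one is divisible by [p]. *)
Lemma gauss_lemma (p : A) (P Q : {poly A}) : prime_elt p ->
    (forall i, fdvd p (P * Q)`_i) ->
  (forall i, fdvd p P`_i) \/ (forall i, fdvd p Q`_i).
Proof.
move=> [p0 _ prim] pPQ; apply: contrapT => /not_orP[/existsNP nP /existsNP nQ].
have first_ndvd (T : {poly A}) : (exists i, ~ fdvd p T`_i) ->
    exists2 i, ~ fdvd p T`_i & forall j, (j < i)%N -> fdvd p T`_j.
  move=> [i ndiv]; have [k] := ubnP i; elim: k i ndiv => // k IH i ndiv lt.
  have [[j ltj nj]|no] := pselect (exists2 j, (j < i)%N & ~ fdvd p T`_j).
    by apply: (IH j) => //; apply: leq_trans ltj _.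
  by exists i => // j ltj; apply: contrapT => nj; apply: no; exists j.
have [i ni mi] := first_ndvd _ nP; have [j nj mj] := first_ndvd _ nQ.
have lt : (i < (i + j).+1)%N by rewrite ltnS leq_addr.
have := pPQ (i + j)%N; rewrite coefM (bigD1 (Ordinal lt)) //= addKn => dv.
have : fdvd p (P`_i * Q`_j).
  rewrite -[X in fdvd p X](addrK (\sum_(k < (i + j).+1 | k != Ordinal lt) P`_k * Q`_(i + j - k))).
  apply: fdvdB => //; apply: fdvd_sum => k ne.
  have [ltk|gek] := ltnP k i; first exact/fdvd_mulr/mi.
  apply/fdvd_mull/mj; have ltik : (i < k)%N.
    by rewrite ltn_neqAle gek andbT eq_sym -val_eqE in ne *.
  by rewrite ltn_subLR ?ltn_add2r // -ltnS ltn_ord.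
by case/prim.
Qed.

Lemma all_fdvd_scale (p : A) (P : {poly A}) : (forall i, fdvd p P`_i) ->
  exists Q, P = p *: Q.
Proof.
move=> /choice[q qE]; exists (\poly_(i < size P) q i); apply/polyP => i.
rewrite coefZ coef_poly; case: ltnP => [_|ge]; first exact: qE.
by rewrite mulr0 nth_default.
Qed.

End Divisibility.

Section Factorization.
Context {n : nat} {K : fieldType}.
Implicit Types (f g h p c : fps n K).

(** [P] is meant for non-units and for membership in a prime ideal. The descent ends because
    splitting off a non-unit lowers the order of the cofactor. *)
Lemma irreducible_factor (P : fps n K -> Prop) f :
    (forall g h, P (g * h) -> P g \/ P h) ->
    (forall g, P g -> g \isn't a GRing.unit) ->
  f != 0 -> P f -> exists p q, [/\ f = p * q, irreducible_elt p & P p].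
Proof.
move=> Pmul Pnu f0 Pf; have [d] := ordge_nonzero f0.
elim: d f f0 Pf => [|d IH] f f0 Pf nd; first by case: nd.
have [irr|red] := pselect (irreducible_elt f).
  by exists f, 1; rewrite mulr1.
have [g [h [e gnu hnu]]] : exists g h, [/\ f = g * h, g \isn't a GRing.unit & h \isn't a GRing.unit].
  apply: contrapT => no; apply: red; split=> //; first exact: Pnu.
  move=> g h e; apply: contrapT => /not_orP[/negP gnu /negP hnu].
  by apply: no; exists g, h.
have [g0 h0] : g != 0 /\ h != 0.
  by apply/andP; rewrite -negb_or -mulf_eq0 -e.
have P1 : P g \/ P h by apply: Pmul; rewrite -e.
case: P1 => [Pg|Ph].
  have [|p [q [eg irr Pp]]] := IH g g0 Pg.
    by move=> H; apply: nd; rewrite e mulrC; apply: ordge_nonunitM.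
  by exists p, (q * h); rewrite e eg mulrA.
have [|p [q [eg irr Pp]]] := IH h h0 Ph.
  by move=> H; apply: nd; rewrite e; apply: ordge_nonunitM.
by exists p, (q * g); rewrite e eg mulrA [g * _]mulrC mulrA mulrAC.
Qed.

Lemma prime_factor f : factorial (fps n K) -> f != 0 -> f \isn't a GRing.unit ->
  exists p q, f = p * q /\ prime_elt p.
Proof.
move=> fact f0 fnu.
have [||p [q [e irr _]]] := @irreducible_factor (fun g => g \isn't a GRing.unit) f _ _ f0 fnu.
- by move=> g h; rewrite unitrM negb_and => /orP.
- by [].
by exists p, q; split=> //; apply: fact.
Qed.

(** Divisibility over the fraction field only factors a multiple [c *: W]. By Gauss's lemma each
    prime factor of [c] divides [P] or [Q] and can be cancelled there, until [c] is a unit. *)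
Lemma monic_cofactor c (W P Q : {poly fps n K}) : factorial (fps n K) -> c != 0 ->
    c *: W = P * Q ->
  exists P' Q', [/\ W = P' * Q', size P' = size P & size Q' = size Q].
Proof.
move=> fact c0; have [d] := ordge_nonzero c0.
elim: d c c0 P Q => [|d IH] c c0 P Q nd e; first by case: nd.
have [cu|cnu] := boolP (c \is a GRing.unit).
  exists (c^-1 *: P), Q; split=> //; last by rewrite size_scale // invr_eq0.
  by rewrite -scalerAl -e scalerA mulVr // scale1r.
have [p [c' [ec pprime]]] := prime_factor fact c0 cnu.
have [p0 pnu _] := pprime.
have c'0 : c' != 0 by apply: contraNneq c0 => e'; rewrite ec e' mulr0.
have nd' : ~ ordge d c' by move=> H; apply: nd; rewrite ec; apply: ordge_nonunitM.
have polyp0 : p%:P != 0 by rewrite polyC_eq0.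
have [||] := @gauss_lemma _ p P Q pprime.
- by move=> i; rewrite -e coefZ ec -mulrA; exists (c' * W`_i).
- move=> /all_fdvd_scale[P' eP].
  have [|P2 [Q2 [eW s1 s2]]] := IH c' c'0 P' Q nd'.
    apply: (@mulfI _ p%:P) => //; rewrite !mul_polyC scalerA -ec e eP.
    by rewrite scalerAl.
  by exists P2, Q2; rewrite eW s1 s2 eP size_scale.
- move=> /all_fdvd_scale[Q' eQ].
  have [|P2 [Q2 [eW s1 s2]]] := IH c' c'0 P Q' nd'.
    apply: (@mulfI _ p%:P) => //; rewrite !mul_polyC scalerA -ec e eQ.
    by rewrite scalerAr.
  by exists P2, Q2; rewrite eW s1 s2 eQ size_scale.
Qed.

End Factorization.

Section FactorialStep.
Context {n : nat} {K : fieldType}.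
Hypothesis factB : factorial (fps n K).

(** A nontrivial gcd would split [W] into two polynomials of size at most [d]. As [f] is
    irreducible, one of them is a unit as a series, so the other is a multiple of [f] of size at
    most [d], which uniqueness in Weierstrass division forces to be zero. *)
Lemma irreducible_coprimep d (f u : fps n.+1 K) (W r : {poly fps n K}) :
    irreducible_elt f -> zregular d f -> W \is monic -> size W = d.+1 ->
    u \is a GRing.unit -> fps_eval W = f * u -> r != 0 -> (size r <= d)%N ->
  coprimep W r.
Proof.
move=> [f0 fnu irr] reg mW szW uu eW r0 szr; apply: contraT.
have W0 : W != 0 by rewrite monic_neq0.
have e0 : gcdp W r != 0 by rewrite gcdp_eq0 negb_and W0.
rewrite coprimep_def => ne1.
have sz1 : (1 < size (gcdp W r))%N by rewrite ltn_neqAle eq_sym ne1 size_poly_gt0.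
have szd : (size (gcdp W r) <= d)%N.
  by apply: leq_trans szr; apply: dvdp_leq => //; apply: dvdp_gcdr.
have /Pdiv.WeakIdomain.dvdpP[[c q] /= c0 e] := dvdp_gcdl W r.
have [P [Q [ePQ szP szQ]]] := monic_cofactor factB c0 e.
have q0 : q != 0.
  apply/eqP => q0; move: e; rewrite q0 mul0r => /eqP.
  by rewrite -size_poly_eq0 size_scale // size_poly_eq0 (negbTE W0).
have P0 : P != 0 by rewrite -size_poly_eq0 szP size_poly_eq0.
have Q0 : Q != 0 by rewrite -size_poly_eq0 szQ size_poly_eq0.
have szPd : (size P <= d)%N.
  have : (size W).+1 = (size P + size Q)%N.
    by rewrite ePQ size_mul // prednK // addn_gt0 size_poly_gt0 P0.
  rewrite szW szQ => es; by rewrite -(leq_add2r 2) [X in (_ <= X)%N]addn2 es leq_add2l.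
have fE : f = (fps_eval P * u^-1) * fps_eval Q.
  by rewrite mulrAC -fps_evalM -ePQ eW mulrK.
have unit_case (S T : {poly fps n K}) : S != 0 -> (size S <= d)%N ->
    fps_eval T \is a GRing.unit -> W = S * T -> False.
  move=> S0 szS Tu eST; case/eqP: S0.
  apply: (@weierstrass_unique n K d f S (u * (fps_eval T)^-1) reg szS).
  by rewrite mulrA -eW eST fps_evalM mulrK.
case: (irr _ _ fE) => [|Qu]; last by case: (unit_case P Q).
rewrite unitrM => /andP[Pu _]; case: (unit_case Q P) => //.
- by rewrite szQ.
- by rewrite mulrC.
Qed.

(* The Weierstrass remainders of g and h modulo f multiply to a multiple of   *)
(* the Weierstrass polynomial W of f, which is prime to nonzero remainders.   *)
Lemma zregular_irreducible_prime d (f : fps n.+1 K) :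
  zregular d f -> irreducible_elt f -> prime_elt f.
Proof.
move=> reg irrf; have [f0 fnu _] := irrf; split=> // g h [k gh].
have [W [u [mW szW uu eW]]] := weierstrass_preparation reg.
have [qg [r [szr eg]]] := weierstrass_division reg g.
have [qh [s [szs eh]]] := weierstrass_division reg h.
have [r0|r0] := eqVneq r 0.
  by left; exists qg; rewrite eg r0 fps_eval0 addr0.
have [s0|s0] := eqVneq s 0.
  by right; exists qh; rewrite eh s0 fps_eval0 addr0.
have cop := irreducible_coprimep irrf reg mW szW uu eW r0 szr.
have ers := Pdiv.IdomainMonic.divp_eq mW (r * s).
have szt : (size (modp (r * s) W) <= d)%N by rewrite -ltnS -szW ltn_modp monic_neq0.
(* As a series this remainder is a multiple of [f]; the explicit cofactor comes from expanding
   [g * h = f * k] with the two divisions. Its size is at most [d], so it vanishes. *)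
have t0 : (r * s) %% W = 0.
  apply: (@weierstrass_unique n K d f _
    (k - f * qg * qh - qg * fps_eval s - fps_eval r * qh - fps_eval ((r * s) %/ W) * u) reg szt).
  have -> : (r * s) %% W = r * s - (r * s) %/ W * W by rewrite {2}ers addrC addKr.
  rewrite fps_evalB !fps_evalM eW.
  have -> : fps_eval r * fps_eval s = f * k - f * qg * h - fps_eval r * f * qh.
    by rewrite -gh eg eh; ring.
  by rewrite eh; ring.
have : W %| r * s by rewrite /dvdp t0.
rewrite mulrC Gauss_dvdpl // => /(dvdp_leq s0); rewrite szW => le.
by move: (leq_trans le szs); rewrite ltnn.
Qed.

End FactorialStep.

Section Transport.
Context {A : comUnitRingType} (phi psi : {rmorphism A -> A}).
Hypotheses (phiK : cancel phi psi) (psiK : cancel psi phi).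

Lemma automorphism_unit f : (phi f \is a GRing.unit) = (f \is a GRing.unit).
Proof.
apply/idP/idP; last exact: rmorph_unit.
by move=> /(rmorph_unit psi); rewrite phiK.
Qed.

Lemma automorphism_fdvd f g : fdvd (phi f) (phi g) <-> fdvd f g.
Proof.
split=> [[h e]|[h ->]]; last by exists (phi h); rewrite rmorphM.
by exists (psi h); rewrite -[g]phiK e rmorphM phiK.
Qed.

Lemma automorphism_irreducible f : irreducible_elt f -> irreducible_elt (phi f).
Proof.
move=> [f0 fnu irr]; split.
- by apply: contraNneq f0 => e; rewrite -[f]phiK e rmorph0.
- by rewrite automorphism_unit.
move=> g h e; rewrite -[g]psiK -[h]psiK !automorphism_unit.
by apply: irr; rewrite -rmorphM -e phiK.
Qed.

Lemma automorphism_prime f : prime_elt (phi f) -> prime_elt f.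
Proof.
move=> [f0 fnu prim]; split.
- by apply: contraNneq f0 => ->; rewrite rmorph0.
- by rewrite -automorphism_unit.
move=> g h /automorphism_fdvd; rewrite rmorphM => /prim.
by rewrite !automorphism_fdvd.
Qed.

End Transport.

(** Induction on the number of variables: a shear makes the element regular in the last variable,
    the Weierstrass argument applies over the smaller ring, and the automorphism carries primality
    back. *)
Theorem fps_factorial n (K : fieldType) : factorial (fps n K).
Proof.
elim: n => [|n IH] f irrf; have [f0 fnu _] := irrf.
  case/negP: fnu; rewrite fps_unitE; have [m fm _] := fps_lowest f0.
  by have <- : m = 0%MM by apply/mnmP => -[].
have [phi [psi [d [phiK psiK reg]]]] := shear_exists f0.
apply: (@automorphism_prime (fps n.+1 K) phi psi phiK).
apply: (zregular_irreducible_prime IH reg).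
exact: (@automorphism_irreducible (fps n.+1 K) phi psi phiK psiK).
Qed.

(** * Chains of prime ideals *)

(** Ideals are predicates in [Prop], which suits those obtained by Zorn's lemma, contraction or
    infinite intersection; [prime_idealr_of] passes to the bundled structure at the end. *)
Definition ideal (A : comNzRingType) (I : A -> Prop) : Prop :=
  [/\ I 0, forall f g, I f -> I g -> I (f + g) & forall f g, I g -> I (f * g)].

Definition prime_ideal (A : comNzRingType) (P : A -> Prop) : Prop :=
  [/\ ideal P, ~ P 1 & forall f g, P (f * g) -> P f \/ P g].

Section Ideals.
Context {A : comNzRingType}.
Implicit Types (I P : A -> Prop) (f g h : A).

Lemma ideal_sum I (T : Type) (r : seq T) (Q : pred T) (E : T -> A) : ideal I ->
  (forall i, Q i -> I (E i)) -> I (\sum_(i <- r | Q i) E i).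
Proof. by case=> I0 ID _ H; elim/big_ind: _. Qed.

Lemma idealN I f : ideal I -> I f -> I (- f).
Proof. by case=> _ _ IM If; rewrite -mulN1r; apply: IM. Qed.

Lemma idealB I f g : ideal I -> I f -> I g -> I (f - g).
Proof. by move=> idI If Ig; case: (idI) => _ ID _; apply: ID => //; apply: idealN. Qed.

Lemma ideal_mulr I f g : ideal I -> I f -> I (f * g).
Proof. by case=> _ _ IM If; rewrite mulrC; apply: IM. Qed.

Lemma prime_ideal_exp P f k : prime_ideal P -> P (f ^+ k) -> P f.
Proof.
by case=> _ P1 prim; elim: k => [|k IH]; rewrite ?expr0 // exprS => /prim[].
Qed.

Lemma ideal_preim (B : comNzRingType) (phi : {rmorphism B -> A}) I :
  ideal I -> ideal (I \o phi).
Proof.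
case=> I0 ID IM; split=> [|f g|f g] /=; rewrite ?rmorph0 ?rmorphD ?rmorphM //.
- exact: ID.
- exact: IM.
Qed.

Lemma prime_ideal_preim (B : comNzRingType) (phi : {rmorphism B -> A}) P :
  prime_ideal P -> prime_ideal (P \o phi).
Proof.
case=> idP P1 prim; split; [exact: ideal_preim | by rewrite /= rmorph1 |].
by move=> f g /=; rewrite rmorphM => /prim.
Qed.

(* Among the coefficients of an integral equation for h over B modulo P, the  *)
(* first one outside P is a multiple of h modulo P.                           *)
Lemma integral_contraction (B : comNzRingType) (phi : {rmorphism B -> A})
    (P Q : A -> Prop) h (p : {poly B}) :
    prime_ideal P -> ideal Q -> (forall f, P f -> Q f) -> Q h -> ~ P h ->
    P (map_poly phi p).[h] -> (exists i, ~ P (phi p`_i)) ->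
  exists b, Q (phi b) /\ ~ P (phi b).
Proof.
move=> primeP idQ PQ Qh nPh; have [idP _ prim] := primeP.
elim/poly_ind: p => [|p c IH].
  by move=> _; case=> i; rewrite coef0 rmorph0; case: idP => P0 _ _ /(_ P0).
rewrite rmorphD rmorphM /= map_polyX map_polyC /= hornerD hornerMX hornerC => Ppc.
have [Pc [i nPi]|nPc _] := pselect (P (phi c)); last first.
  exists c; split=> //; rewrite -[phi c](addKr ((map_poly phi p).[h] * h)).
  rewrite addrC; apply: idealB => //; first exact: PQ.
  by case: idQ => _ _ QM; apply: QM.
have /prim[Pp|//] : P ((map_poly phi p).[h] * h).
  by rewrite -[X in P X](addrK (phi c)); apply: idealB.
apply: IH => //; move: i nPi => [|i]; rewrite coefD coefMX coefC /=.
  by rewrite add0r.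
by rewrite addr0 => nPi; exists i.
Qed.

End Ideals.

Section MonomialIdeals.
Context {n : nat} {K : fieldType}.
Implicit Types (f g h : fps n K).

(** The choice [sel] hands each monomial of [h] to exactly one of the [a i] that divide it, so no
    coefficient is counted twice. *)
Lemma monomial_split (T : finType) (a : T -> 'X_{1..n}) h :
    (forall m, fcoef h m != 0 -> exists i, (a i <= m)%MM) ->
  exists g : T -> fps n K, h = \sum_i g i * fpsXm (a i).
Proof.
move=> H; pose sel m := [pick i | (a i <= m)%MM].
exists (fun i => Fps (fun k => if sel (k + a i)%MM == Some i then fcoef h (k + a i)%MM else 0)).
apply/fpsP => m; rewrite fcoef_sum.
have E i : fcoef (Fps (fun k => if sel (k + a i)%MM == Some i
      then fcoef h (k + a i)%MM else 0) * fpsXm (a i)) m =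
    if sel m == Some i then fcoef h m else 0.
  rewrite fcoefMXm /=; case: ifP => le; first by rewrite submK.
  by rewrite /sel; case: pickP => // j le' /=; case: eqP => // -[e]; rewrite e le in le'.
under eq_bigr do rewrite E.
have [->|hm] := eqVneq (fcoef h m) 0; first by rewrite big1 // => i _; case: ifP.
rewrite /sel; case: pickP => [i le|no]; last first.
  by have [i le] := H m hm; rewrite no in le.
rewrite (bigD1 i) //= eqxx big1 ?addr0 // => j ne.
by case: eqP => // -[e]; rewrite e eqxx in ne.
Qed.

Lemma ideal_variables (I : fps n K -> Prop) : ideal I ->
  (forall i, I (fpsX i)) -> forall h, in_maximal_ideal h -> I h.
Proof.
move=> idI IX h h0; have [m hm|g ->] := @monomial_split _ (fun i => U_(i)%MM) h.
  apply: contrapT => no; case/eqP: hm; suff -> : m = 0%MM by [].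
  apply/mnmP => i; rewrite mnm0E; apply: contrapT => /eqP mi.
  by apply: no; exists i; rewrite lep1mP.
by apply: ideal_sum => // i _; case: idI => _ _ IM; apply: IM; apply: IX.
Qed.

Lemma prime_ideal_nonunit (P : fps n K -> Prop) f : prime_ideal P -> P f ->
  f \isn't a GRing.unit.
Proof.
case=> [[_ _ PM] P1 _] Pf; apply/negP => fu; apply: P1.
by rewrite -(mulVr fu); apply: PM.
Qed.

End MonomialIdeals.

(** * Contraction of primes to one variable less *)

Section Contraction.
Context {n : nat} {K : fieldType}.
Local Notation A := (fps n.+1 K).
Local Notation z := (@ord_max n).

Lemma zregular_axis d (f : A) : zregular d f -> exists u r,
  [/\ u \is a GRing.unit, f = u * fpsX z ^+ d + r &
      forall m, fcoef r m != 0 -> exists i, (U_(lift z i) <= m)%MM].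
Proof.
move=> [fd f0]; pose u : A := Fps (fun k =>
  if mtail k == 0%MM then fcoef f (mext 0 (d + k z)) else 0).
exists u, (f - u * fpsX z ^+ d); split.
- rewrite fps_unitE /=; have -> : mtail (0%MM : 'X_{1..n.+1}) = 0%MM.
    by apply/mnmP => i; rewrite !mnmE.
  by rewrite eqxx mnm0E addn0.
- by rewrite addrC subrK.
move=> m; have [e|ne _] := eqVneq (mtail m) 0%MM; last first.
  apply: contrapT => no; case/eqP: ne; apply/mnmP => i; rewrite mnm0E mnmE.
  apply: contrapT => /eqP mi; apply: no; exists i; by rewrite lep1mP.
case/eqP; rewrite fcoefB -fpsXmMn fcoefMXm mext0X -[m]mtailK e.
case: ifP => [/mnm_lepP/(_ z)|/negP nle].
  rewrite !mext_max => le; have -> : (mext 0 (m z) - mext 0 d)%MM = mext 0%MM (m z - d) :> 'X_{1..n.+1}.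
    by apply/mnmP => i; rewrite mnmBE; case: (unliftP z i) => [j|] ->; rewrite ?mext_lift ?mext_max ?mnm0E.
  by rewrite /= mextK eqxx mext_max subnKC // subrr.
rewrite subr0; apply: f0; rewrite ltnNge; apply/negP => le; apply: nle.
by apply/mnm_lepP => i; case: (unliftP z i) => [j|] ->; rewrite ?mext_lift ?mext_max ?mnm0E.
Qed.

Lemma zregular_prime_variables (P : A -> Prop) d f : prime_ideal P -> P f ->
  zregular d f -> (forall i, P (fpsX (lift z i))) -> forall i, P (fpsX i).
Proof.
move=> primeP Pf reg PX; have [idP P1 prim] := primeP.
have [u [r [uu ef rm]]] := zregular_axis reg.
have [g er] := monomial_split rm.
have Pr : P r.
  by rewrite er; apply: ideal_sum => // i _; case: idP => _ _ PM; apply: PM; apply: PX.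
have : P (u * fpsX z ^+ d).
  by rewrite -[X in P X](addrK r) -ef; apply: idealB.
case/prim => [Pu|Pz]; first by have := prime_ideal_nonunit primeP Pu; rewrite uu.
have {}Pz := prime_ideal_exp primeP Pz.
by move=> i; case: (unliftP z i) => [j|] ->.
Qed.

(** [M] represents multiplication by [h] modulo [f], on the generators z^0, ..., z^(d-1) over the
    series in the first [n] variables. *)
Lemma weierstrass_matrix d (f h : A) : zregular d f ->
  exists (M : 'M[fps n K]_d) (q : 'I_d -> A),
    forall j : 'I_d, h * fpsX z ^+ j = f * q j + \sum_l fps_widen (M j l) * fpsX z ^+ l.
Proof.
move=> reg.
have /choice[qp H] : forall j : 'I_d, exists qp : A * {poly fps n K},
    (size qp.2 <= d)%N /\ h * fpsX z ^+ j = f * qp.1 + fps_eval qp.2.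
  by move=> j; have [q [p H]] := weierstrass_division reg (h * fpsX z ^+ j); exists (q, p).
exists (\matrix_(j, l) (qp j).2`_l), (fun j => (qp j).1) => j.
have [sz ->] := H j; congr (_ + _); rewrite /fps_eval (@horner_coef_wide _ d).
  by apply: eq_bigr => l _; rewrite mxE coef_map.
exact: leq_trans (size_poly _ _) sz.
Qed.

(** Incomparability in an integral extension: modulo [f] the characteristic polynomial of [M] is an
    integral equation for [h], from which [integral_contraction] extracts [b]. *)
Lemma contraction_strict (P Q : A -> Prop) d f h : prime_ideal P -> ideal Q ->
    (forall f, P f -> Q f) -> Q h -> ~ P h -> P f -> zregular d f ->
  exists b, Q (fps_widen b) /\ ~ P (fps_widen b).
Proof.
move=> primeP idQ PQ Qh nPh Pf reg; have [[P0 PD PM] P1 _] := primeP.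
case: d reg => [|d] reg.
  by have := prime_ideal_nonunit primeP Pf; rewrite (zregular0_unit reg).
have [M [q Mh]] := weierstrass_matrix h reg.
apply: (@integral_contraction _ _ fps_widen P Q h (char_poly M)) => //; last first.
  exists d.+1; have := char_poly_monic M; rewrite monicE lead_coefE size_char_poly /=.
  by move=> /eqP ->; rewrite rmorph1.
pose phi : {rmorphism {poly fps n K} -> A} := horner_eval h \o map_poly (@fps_widen n K).
rewrite -[(map_poly _ _).[h]]/(phi (char_poly M)) /char_poly -det_map_mx.
set N := map_mx _ _.
pose v : 'cV[A]_d.+1 := \col_j fpsX z ^+ j.
have Nv : N *m v = f *: (\col_j q j).
  apply/matrixP => j k; rewrite !mxE.
  rewrite (eq_bigr (fun l : 'I_d.+1 => h * fpsX z ^+ l *+ (j == l) - fps_widen (M j l) * fpsX z ^+ l)).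
    rewrite sumrB (bigD1 j) //= eqxx mulr1n big1 ?addr0 => [|l ne]; last first.
      by rewrite eq_sym (negbTE ne).
    by rewrite Mh addrK.
  move=> l _; rewrite !mxE /phi /= /horner_eval rmorphB /= map_polyC hornerD hornerN hornerC /=.
  by rewrite mulrBl rmorphMn /= map_polyX hornerMn hornerX mulrnAl.
(* The entry of [v] of index 0 is z^0 = 1, so the adjugate exhibits the determinant as a multiple of
   [f]. *)
have : (\adj N *m (N *m v)) 0 0 = \det N.
  by rewrite mulmxA mul_adj_mx mul_scalar_mx !mxE expr0 mulr1.
rewrite Nv -scalemxAr mxE => <-.
by apply: ideal_mulr.
Qed.

(** The Weierstrass polynomial of [f] and the remainder of [g] are coprime over the fraction field;
    clearing denominators in their Bezout identity leaves a nonzero [c] free of the last variable,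
    in the role of a resultant. *)
Lemma coprime_contraction (P : A -> Prop) d f g : prime_ideal P -> irreducible_elt f ->
    zregular d f -> P f -> P g -> ~ fdvd f g ->
  exists c, c != 0 /\ P (fps_widen c).
Proof.
move=> primeP irrf reg Pf Pg ndvd; have [idP P1 _] := primeP.
have [W [u [mW szW uu eW]]] := weierstrass_preparation reg.
have [q [r [szr eg]]] := weierstrass_division reg g.
have r0 : r != 0.
  by apply/eqP => r0; apply: ndvd; exists q; rewrite eg r0 fps_eval0 addr0.
have /Bezout_coprimepP[[s t] /= st] :=
  irreducible_coprimep (@fps_factorial n K) irrf reg mW szW uu eW r0 szr.
have : size (s * W + t * r) == 1 by rewrite size_poly_eq1.
case/size_poly1P => c c0 ec; exists c; split=> //.
rewrite -fps_evalC -ec fps_evalD !fps_evalM eW.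
have [_ ID IM] := idP; apply: ID; apply: IM; first exact: ideal_mulr.
by rewrite -[fps_eval r](addKr (f * q)) -eg addrC; apply: idealB => //; apply: ideal_mulr.
Qed.

End Contraction.

Section Chains.

(** Strict inclusions of [P] in [Q] and of [Q] in the maximal ideal: the last clause says that some
    variable is missing from [Q]. *)
Definition prime_chain n (K : fieldType) (P Q : fps n K -> Prop) : Prop :=
  [/\ prime_ideal P, prime_ideal Q, forall f, P f -> Q f,
      exists h, Q h /\ ~ P h & exists i, ~ Q (fpsX i)].

(** Strictness of [P] in [Q] survives by integrality modulo [f]. If [Q] contained all the other
    variables, regularity of [f] would put the last one in [Q] too, so the contraction of [Q] still
    misses a variable. *)
Lemma prime_chain_widen n (K : fieldType) (P Q : fps n.+1 K -> Prop) d f :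
    prime_chain P Q -> P f -> zregular d f ->
  prime_chain (P \o fps_widen) (Q \o fps_widen).
Proof.
move=> [primeP primeQ PQ [h [Qh nPh]] [i nQi]] Pf reg; split.
- exact: prime_ideal_preim.
- exact: prime_ideal_preim.
- by move=> b; apply: PQ.
- by have [idQ _ _] := primeQ; apply: (contraction_strict primeP idQ PQ Qh nPh Pf reg).
apply: contrapT => no; apply: nQi; apply: (zregular_prime_variables primeQ (PQ _ Pf) reg) => j.
by apply: contrapT => nQj; apply: no; exists j; rewrite /= fps_widenX.
Qed.

Lemma prime_chain_transport n (K : fieldType) (P Q : fps n K -> Prop)
    (phi psi : {rmorphism fps n K -> fps n K}) :
    cancel phi psi -> cancel psi phi -> prime_chain P Q ->
  prime_chain (P \o psi) (Q \o psi).
Proof.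
move=> phiK psiK [primeP primeQ PQ [h [Qh nPh]] [i nQi]]; split.
- exact: prime_ideal_preim.
- exact: prime_ideal_preim.
- by move=> b; apply: PQ.
- by exists (phi h); rewrite /= phiK.
apply: contrapT => no; apply: nQi; rewrite -[fpsX i]phiK.
have [idQ _ _] := prime_ideal_preim psi primeQ.
apply: (ideal_variables idQ) => [j|].
  by apply: contrapT => nQj; apply: no; exists j.
apply/nonunitP; rewrite (@automorphism_unit (fps n K) phi psi phiK).
by apply/nonunitP; rewrite /in_maximal_ideal /= eq_sym mnm1_eq0.
Qed.

(** After a shear, a nonzero element of [Q] is a unit times a power of the only variable, which then
    belongs to [Q]. *)
Lemma no_prime_chain1 (K : fieldType) (P Q : fps 1 K -> Prop) : ~ prime_chain P Q.
Proof.
move=> ch; have [[[P0 _ _] _ _] _ _ [h [Qh nPh]] _] := ch.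
have h0 : h != 0 by apply/eqP => h0; apply: nPh; rewrite h0.
have [phi [psi [d [phiK psiK reg]]]] := shear_exists h0.
have [_ primeQ _ _ [i nQi]] := prime_chain_transport phiK psiK ch.
apply: nQi; apply: (zregular_prime_variables primeQ _ reg); first by rewrite /= phiK.
by case.
Qed.

Lemma no_prime_chain2 (K : fieldType) (P Q : fps 2 K -> Prop) f :
  prime_chain P Q -> f != 0 -> ~ P f.
Proof.
move=> ch f0 Pf; have [phi [psi [d [phiK psiK reg]]]] := shear_exists f0.
apply: (no_prime_chain1 (prime_chain_widen (prime_chain_transport phiK psiK ch) _ reg)).
by rewrite /= phiK.
Qed.

(** This says that [P] has height at most one. Otherwise [f] and [g] would give a nonzero element of
    the contraction of [P] to two variables, and contracting once more would give a forbidden chain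
    in one variable. *)
Lemma no_prime_chain3 (K : fieldType) (P Q : fps 3 K -> Prop) f g :
  prime_chain P Q -> irreducible_elt f -> P f -> P g -> fdvd f g.
Proof.
move=> ch irrf Pf Pg; apply: contrapT => ndvd; have [f0 _ _] := irrf.
have [phi [psi [d [phiK psiK reg]]]] := shear_exists f0.
have ch' := prime_chain_transport phiK psiK ch; have [primeP' _ _ _ _] := ch'.
have irrf' : irreducible_elt (phi f).
  exact: (@automorphism_irreducible (fps 3 K) phi psi phiK psiK).
have [|||c [c0 Pc]] := coprime_contraction primeP' irrf' reg (g := phi g).
- by rewrite /= phiK.
- by rewrite /= phiK.
- by rewrite (@automorphism_fdvd (fps 3 K) phi psi phiK).
apply: (no_prime_chain2 (prime_chain_widen ch' _ reg) c0 Pc).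
by rewrite /= phiK.
Qed.

End Chains.

(** * Formal curves *)

Local Open Scope quotient_scope.

(** For an ideal this amounts to containing a power of the maximal ideal; the unit ideal qualifies,
    with [k = 0]. *)
Definition cofinite_ideal n (K : fieldType) (I : fps n K -> Prop) : Prop :=
  exists k, forall i, I (fpsX i ^+ k).

Definition add_principal (A : comNzRingType) (I : A -> Prop) (h : A) : A -> Prop :=
  fun f => exists g c, I g /\ f = g + c * h.

(* Equivalently, the prime ideals P such that the quotient by P has dimension one. *)
Definition maximal_noncofinite n (K : fieldType) (P : fps n K -> Prop) : Prop :=
  [/\ prime_ideal P, ~ cofinite_ideal P &
      forall h, ~ P h -> cofinite_ideal (add_principal P h)].

Section MaximalNoncofinite.
Context {n : nat} {K : fieldType}.
Local Notation A := (fps n K).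
Implicit Types (I P : A -> Prop) (f g h : A).

Lemma ideal_add_principal I h : ideal I -> ideal (add_principal I h).
Proof.
case=> I0 ID IM; split=> [|f g|f g].
- by exists 0, 0; rewrite mul0r addr0.
- move=> [a [c [Ia ->]]] [b [d [Ib ->]]]; exists (a + b), (c + d).
  by rewrite mulrDl addrACA; split=> //; apply: ID.
- move=> [a [c [Ia ->]]]; exists (f * a), (f * c).
  by rewrite mulrDr mulrA; split=> //; apply: IM.
Qed.

Lemma add_principal_sub I h f : I f -> add_principal I h f.
Proof. by exists f, 0; rewrite mul0r addr0. Qed.

Lemma add_principal_gen I h : ideal I -> add_principal I h h.
Proof. by case=> I0 _ _; exists 0, 1; rewrite mul1r add0r. Qed.

(** Unions of chains stay non-cofinite because only finitely many elements, the powers of the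
    variables, are involved. The maximal ideal is prime: if powers of the variables lie in P + (f)
    and in P + (g), their products lie in P + (fg). *)
Lemma maximal_noncofinite_exists I : ideal I -> ~ cofinite_ideal I ->
  exists P, maximal_noncofinite P /\ forall f, I f -> P f.
Proof.
move=> idI nI; have [I0 _ _] := idI.
pose good (S : set A) := [/\ ideal (S : A -> Prop), forall f, I f -> S f & ~ cofinite_ideal (S : A -> Prop)].
have [|P [goodP maxP]] := @Zorn_bigcup A (fun S => S = set0 \/ good S).
  move=> F FP tot; have [[S0 [FS0 goodS0]]|no] := pselect (exists S, F S /\ good S); last first.
    left; rewrite -subset0 => f [S FS Sf]; case: (FP S FS) => [S0|gS].
      by rewrite S0 in Sf.
    by case: no; exists S.
  right.
  have goodF S f : F S -> S f -> good S.
    by move=> FS Sf; case: (FP S FS) => // S0'; rewrite S0' in Sf.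
  have IS0 f : I f -> S0 f by case: goodS0 => _ H _; apply: H.
  split.
  - split; first by exists S0 => //; apply: IS0.
      move=> f g [S FS Sf] [T FT Tg].
      have [[_ SD _] _ _] := goodF _ _ FS Sf; have [[_ TD _] _ _] := goodF _ _ FT Tg.
      by case: (tot S T FS FT) => le; [exists T|exists S] => //; [apply: TD|apply: SD] => //; apply: le.
    move=> f g [S FS Sg]; exists S => //.
    by have [[_ _ SM] _ _] := goodF _ _ FS Sg; apply: SM.
  - by move=> f If; exists S0 => //; apply: IS0.
  move=> [k Xk].
  have [S [FS gS Sk]] : exists S, [/\ F S, good S & forall i, i \in enum 'I_n -> S (fpsX i ^+ k)].
    elim: (enum 'I_n) => [|i s [S [FS gS Sk]]]; first by exists S0.
    have [T FT Ti] := Xk i; have gT := goodF _ _ FT Ti.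
    case: (tot S T FS FT) => le.
      exists T; split=> // j; rewrite inE => /orP[/eqP -> //|js]; apply: le; exact: Sk.
    by exists S; split=> // j; rewrite inE => /orP[/eqP ->|js]; [apply: le|apply: Sk].
  by case: gS => _ _; apply; exists k => i; apply: Sk; rewrite mem_enum.
have {goodP}gP : good P.
  case: goodP => // P0; case: (maxP I); last by right; split.
  by rewrite P0; split=> // /(_ 0 I0).
have [idP IP nP] := gP; have [P0 PD PM] := idP.
have maxh h : ~ P h -> cofinite_ideal (add_principal P h).
  move=> nPh; apply: contrapT => nco; apply: (maxP (add_principal P h)).
    split; first by move=> f; apply: add_principal_sub.
    by move=> le; apply: nPh; apply: le; apply: add_principal_gen.
  right; split=> //; first exact: ideal_add_principal.
  by move=> f /IP; apply: add_principal_sub.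
exists P; split=> //; split=> //; split=> //.
  by move=> P1; apply: nP; exists 0%N => i; rewrite expr0.
move=> f g Pfg; apply: contrapT => /not_orP[/maxh[k kf] /maxh[l lg]].
apply: nP; exists (k + l)%N => i; rewrite exprD.
have [a [c [Pa ->]]] := kf i; have [b [d [Pb ->]]] := lg i.
have -> : (a + c * f) * (b + d * g) = (b + d * g) * a + (c * f * b + c * d * (f * g)) by ring.
by apply: (PD); [apply: PM|apply: (PD); apply: PM].
Qed.

Lemma prime_noncofinite P : prime_ideal P ->
  (exists i, ~ P (fpsX i)) <-> ~ cofinite_ideal P.
Proof.
move=> primeP; split=> [[i nPi] [k Pk]|nP].
  by apply: nPi; apply: prime_ideal_exp (Pk i).
apply: contrapT => no; apply: nP; exists 1%N => i; rewrite expr1.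
by apply: contrapT => nPi; apply: no; exists i.
Qed.

(* Krull intersection theorem: if h is in the closure of P but not in P, then *)
(* a power of m lies in P + m h, whence h (1 - mu) is in P for some mu in m.  *)
Lemma maximal_noncofinite_closed P h : maximal_noncofinite P ->
  (forall d, exists2 g, P g & ordge d (h - g)) -> P h.
Proof.
move=> [primeP _ maxP] clos; have [idP P1 prim] := primeP; have [P0 PD PM] := idP.
apply: contrapT => nPh; have [k Xk] := maxP h nPh.
have /choice[gc Xk'] : forall i, exists gc : A * A, P gc.1 /\ fpsX i ^+ k = gc.1 + gc.2 * h.
  by move=> i; have [g [c H]] := Xk i; exists (g, c).
(* A monomial of degree above n k has some exponent above k; the spare factor x_i is what puts [mu]
   in the maximal ideal. *)
have [g Pg hg] := clos (n * k).+1.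
have [m mne|q eq] := @monomial_split n K _ (fun i => U_(i) *+ k.+1)%MM (h - g).
  apply: contrapT => no; case/eqP: mne; apply: hg; rewrite ltnS mdegE.
  apply: (@leq_trans (\sum_(i < n) k)%N); last by rewrite sum_nat_const card_ord.
  apply: leq_sum => i _; rewrite leqNgt; apply/negP => lt; apply: no; exists i.
  apply/mnm_lepP => j; rewrite mulmnE mnm1E; case: eqP => [<-|_]; rewrite ?mul1n //.
pose mu := \sum_i q i * fpsX i * (gc i).2.
have mu0 : in_maximal_ideal mu.
  rewrite /in_maximal_ideal fcoef_sum big1 // => i _.
  rewrite !fcoefM0 [fcoef (fpsX i) _]/= [0%MM == _]eq_sym mnm1_eq0 mulr0 mul0r //.
have Ph : P ((1 - mu) * h).
  have -> : (1 - mu) * h = g + \sum_i q i * fpsX i * (gc i).1.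
    apply/eqP; rewrite mulrBl mul1r subr_eq -addrA; apply/eqP.
    rewrite /mu mulr_suml -big_split /= -{1}(subrK g h) addrC eq; congr (_ + _).
    apply: eq_bigr => i _; rewrite fpsXmMn exprS -/(fpsX i) (Xk' i).2; ring.
  apply: (PD) => //; apply: ideal_sum => // i _; apply: PM; exact: (Xk' i).1.
case/prim: Ph => // /(prime_ideal_nonunit primeP).
by rewrite fps_unitE fcoefB mu0 subr0 fcoef1 eqxx oner_eq0.
Qed.

End MaximalNoncofinite.

Lemma prime_idealr_of (A : comNzRingType) (P : A -> Prop) : prime_ideal P ->
  exists Q : prime_idealr A, forall f, f \in Q <-> P f.
Proof.
move=> [[P0 PD PM] P1 prim]; pose S : A -> bool := fun f => `[< P f >].
have H1 : idealr_closed S.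
  split; first exact/asboolP.
    by apply/asboolP.
  move=> a u v /asboolP Pu /asboolP Pv; apply/asboolP; apply: (PD) => //; exact: PM.
have H2 : prime_idealr_closed S.
  by move=> u v /asboolP/prim[Pu|Pv]; apply/orP; [left|right]; apply/asboolP.
exists (HB.pack_for (prime_idealr A) S (isIdealr.Build A S H1)
  (isPrimeIdealrClosed.Build A S H2)).
by move=> f; split=> [/asboolP|Pf]; last exact/asboolP.
Qed.

Lemma prime_idealr_prime (A : comNzRingType) (Q : prime_idealr A) :
  prime_ideal (fun f => f \in Q).
Proof.
split; first by split; [exact: idealr0 | exact: rpredD | exact: idealMr].
  by rewrite idealr1.
by move=> f g; rewrite prime_idealrM => /orP.
Qed.

Section Quotient.
Context {A : comNzRingType} (I : prime_idealr A).
Local Notation Q := {ideal_quot I}.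
Local Notation pi := (\pi_Q : A -> Q).

Lemma quot_pi_eq0 f : pi f = 0 <-> f \in I.
Proof.
rewrite -[f in f \in I]subr0 Quotient.idealrBE; split=> [e|/eqP ->].
  by apply/eqP; rewrite e; apply/esym; exact: rmorph0.
exact: rmorph0.
Qed.

Lemma quot_repr_sub f : repr (pi f) - f \in I.
Proof. by rewrite Quotient.idealrBE reprK. Qed.

Lemma quot_preim_prime (q : prime_idealr Q) : prime_ideal (fun f => pi f \in q).
Proof.
have [[q0 qD qM] q1 prim] := prime_idealr_prime q.
split; first split; rewrite ?rmorph0 ?rmorph1 //.
- by move=> f g; rewrite rmorphD; apply: qD.
- by move=> f g; rewrite rmorphM; apply: qM.
- by move=> f g; rewrite rmorphM; apply: prim.
Qed.

Variable P : A -> Prop.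
Hypotheses (primeP : prime_ideal P) (IP : forall f, f \in I -> P f).

Lemma quot_repr_prime f : P (repr (pi f)) <-> P f.
Proof.
have [[_ PD _] _ _] := primeP; have [idP _ _] := primeP; have Pd := IP (quot_repr_sub f).
split=> Pf; last by rewrite -(subrK f (repr _)); apply: PD.
by rewrite -[f](subKr (repr (pi f))); apply: idealB.
Qed.

Lemma quot_prime_ideal : prime_ideal (fun x : Q => P (repr x)).
Proof.
have [[P0 PD PM] P1 prim] := primeP.
split; first split.
- by rewrite -[0](rmorph0 pi); apply/quot_repr_prime.
- move=> x y Px Py; rewrite -[x]reprK -[y]reprK -rmorphD; apply/quot_repr_prime.
  exact: PD.
- move=> x y Py; rewrite -[x]reprK -[y]reprK -rmorphM; apply/quot_repr_prime.
  exact: PM.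
- by rewrite -[1](rmorph1 pi) => /quot_repr_prime.
- move=> x y; rewrite -{1}[x]reprK -{1}[y]reprK -rmorphM => /quot_repr_prime.
  exact: prim.
Qed.

End Quotient.

(** The chain from P to the maximal ideal has length one. In a longer chain the second prime
    contains some [h] outside P, hence by maximality all the variables, and the third prime would
    contain a unit. *)
Lemma maximal_noncofinite_curve n (K : fieldType) (P : fps n K -> Prop)
    (I : prime_idealr (fps n K)) :
  maximal_noncofinite P -> (forall f, f \in I <-> P f) -> formal_curve I.
Proof.
move=> [primeP nP maxP] IP; have [idP P1 prim] := primeP; have [P0 PD PM] := idP.
have [i nPi] := (prime_noncofinite primeP).2 nP.
pose M := @in_maximal_ideal n K.
have primeM : prime_ideal M.
  split; first split=> [|f g|f g].
  - by [].
  - by rewrite /M /in_maximal_ideal => f0 g0; rewrite fcoefD f0 g0 addr0.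
  - by rewrite /M /in_maximal_ideal fcoefM0 => ->; rewrite mulr0.
  - by rewrite /M /in_maximal_ideal fcoef1 eqxx => /eqP; rewrite oner_eq0.
  - move=> f g; rewrite /M /in_maximal_ideal fcoefM0 => /eqP.
    by rewrite mulf_eq0 => /orP[]/eqP; [left|right].
have PM' f : P f -> M f.
  by move=> /(prime_ideal_nonunit primeP)/nonunitP.
have IM f : f \in I -> M f by move=> /IP/PM'.
have II f : f \in I -> P f by move=> /IP.
have [Q0 Q0E] := prime_idealr_of (quot_prime_ideal primeP II).
have [Q1 Q1E] := prime_idealr_of (quot_prime_ideal primeM IM).
split.
  exists (fun j : 'I_2 => if (j == 0 :> nat) then Q0 else Q1).
  move=> [[|[|j]] lj] [[|[|k]] lk] //= _; split=> [x /Q0E Px|sub].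
    by apply/Q1E; apply: PM'.
  pose pi := (\pi_({ideal_quot I}) : fps n K -> {ideal_quot I}).
  have : pi (fpsX i) \in Q0.
    apply/sub/Q1E/(quot_repr_prime primeM IM).
    by rewrite /M /in_maximal_ideal /= eq_sym mnm1_eq0.
  by move=> /Q0E/(quot_repr_prime primeP II).
case=> [|[|e]] // [Q QE]; exfalso.
have l0 : (0 < e.+3)%N by []. have l1 : (1 < e.+3)%N by []. have l2 : (2 < e.+3)%N by [].
have [|_ n01] := QE (Ordinal l0) (Ordinal l1); first by [].
have [|_ n12] := QE (Ordinal l1) (Ordinal l2); first by [].
set q0 := Q (Ordinal l0) in n01; set q1 := Q (Ordinal l1) in n01 n12.
set q2 := Q (Ordinal l2) in n12.
have strict (S T : prime_idealr {ideal_quot I}) : ~ {subset T <= S} ->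
    exists f, [/\ \pi_({ideal_quot I}) f \in T & \pi_({ideal_quot I}) f \notin S].
  move=> ns; apply: contrapT => no; apply: ns => x xT; apply: contrapT => /negP xS.
  by apply: no; exists (repr x); rewrite reprK.
have [h [hT hS]] := strict _ _ n01; have [g [gT gS]] := strict _ _ n12.
have nPh : ~ P h.
  by move=> /IP/quot_pi_eq0 e0; rewrite e0 idealr0 in hS.
have [k Xk] := maxP h nPh.
have prime1 := quot_preim_prime q1; have prime2 := quot_preim_prime q2.
have X1 j : \pi_({ideal_quot I}) (fpsX j) \in q1.
  apply: (prime_ideal_exp (k := k) prime1).
  have [a [c [Pa ->]]] := Xk j; have [[_ D1 M1] _ _] := prime1; apply: D1; last exact: M1.
  by move/IP/quot_pi_eq0: Pa => ->; apply: idealr0.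
case/negP: gS; apply: contrapT => gS.
have gu : g \is a GRing.unit.
  apply: contrapT => /negP/nonunitP gm; apply: gS.
  have [id1 _ _] := prime1; exact (ideal_variables id1 X1 gm).
by have := prime_ideal_nonunit prime2 gT; rewrite gu.
Qed.

(** * Koszul and Hilbert-Burch complexes in dimension three *)

Section Cross.
Context {A : comNzRingType}.
Implicit Types (a b c : 'I_3 -> A).

(** Cyclic successor on indices: the cross product gets one formula valid at every index, so that
    [ring] proves its identities after reduction by [nxt3]. *)
Definition nxt (i : 'I_3) : 'I_3 := inord (i.+1 %% 3).

Lemma nxt3 i : nxt (nxt (nxt i)) = i.
Proof. by apply: val_inj; case: i => [[|[|[|]]]] //= lt; rewrite /nxt !inordK. Qed.

Definition dot a b : A := a ord0 * b ord0 + a (nxt ord0) * b (nxt ord0)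
  + a (nxt (nxt ord0)) * b (nxt (nxt ord0)).

Lemma sum_nxt (E : 'I_3 -> A) i : \sum_j E j = E i + E (nxt i) + E (nxt (nxt i)).
Proof.
have E0 : \sum_j E j = E ord0 + E (nxt ord0) + E (nxt (nxt ord0)).
  rewrite !big_ord_recl big_ord0 addr0 addrA.
  by congr (_ + E _ + E _); apply: val_inj; rewrite /= /nxt /= !inordK.
have : [\/ i = ord0, i = nxt ord0 | i = nxt (nxt ord0)].
  case: i => [[|[|[|]]]] //= lt.
  - by apply: Or31; apply: val_inj.
  - by apply: Or32; apply: val_inj; rewrite /= /nxt inordK.
  - by apply: Or33; apply: val_inj; rewrite /= /nxt !inordK.
by case=> ->; rewrite E0 ?nxt3; ring.
Qed.

Lemma dotE a b i : dot a b =
  a i * b i + a (nxt i) * b (nxt i) + a (nxt (nxt i)) * b (nxt (nxt i)).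
Proof. by rewrite -(sum_nxt (fun j => a j * b j)) (sum_nxt _ ord0). Qed.

Definition cross a b : 'I_3 -> A :=
  fun i => a (nxt i) * b (nxt (nxt i)) - a (nxt (nxt i)) * b (nxt i).

Lemma cross_cross a b c i : cross a (cross b c) i = b i * dot a c - c i * dot a b.
Proof. by rewrite !(dotE _ _ i) /cross !nxt3; ring. Qed.

Lemma dot_crossl a b : dot (cross a b) a = 0.
Proof. by rewrite /dot /cross !nxt3; ring. Qed.

Lemma dot_crossr a b : dot (cross a b) b = 0.
Proof. by rewrite /dot /cross !nxt3; ring. Qed.

(** The coordinates of [x] on [a], [b], [c] are quotients of triple products by the triple product
    of [a], [b], [c]. *)
Lemma cramer a b c x i : dot (cross a b) c * x i =
  dot (cross x b) c * a i + dot (cross a x) c * b i + dot (cross a b) x * c i.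
Proof. by rewrite !(dotE _ _ i) /cross !nxt3; ring. Qed.

End Cross.

Definition parallel n (A : comNzRingType) (a b : 'I_n -> A) : Prop :=
  forall i j, a i * b j = a j * b i.

Lemma parallel_sym n (A : comNzRingType) (a b : 'I_n -> A) : parallel a b -> parallel b a.
Proof. by move=> ab i j; rewrite mulrC -ab mulrC. Qed.

Section Koszul.
Context {A : idomainType} (u v w : A).
Hypothesis u0 : u != 0.
Hypothesis regular_uv : forall k l, v * k = u * l -> fdvd u k.
Hypothesis regular_uvw : forall k l m, w * k = u * l + v * m ->
  exists c d, k = u * c + v * d.
Implicit Types (a b p q r x z : 'I_3 -> A).

Lemma parallel_cross a b : (forall i, cross a b i = 0) -> parallel a b.
Proof.
have H i : cross a b i = 0 -> a (nxt i) * b (nxt (nxt i)) = a (nxt (nxt i)) * b (nxt i).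
  by move/eqP; rewrite subr_eq0 => /eqP.
move=> ab0 i j; have e1 := H _ (ab0 i); have e2 := H _ (ab0 (nxt i)).
have e3 := H _ (ab0 (nxt (nxt i))); rewrite !nxt3 in e2; rewrite !nxt3 in e3.
have : [\/ j = i, j = nxt i | j = nxt (nxt i)].
  case: i {ab0 e1 e2 e3} => [[|[|[|]]]] //= li; case: j => [[|[|[|]]]] //= lj;
    solve [ by apply: Or31; apply: val_inj
          | by apply: Or32; apply: val_inj; rewrite /= /nxt !inordK
          | by apply: Or33; apply: val_inj; rewrite /= /nxt !inordK].
by case=> ->.
Qed.

(** Here u b = (p.b) a and v b = (q.b) a, so v (p.b) = u (q.b); regularity makes [u] divide p.b, and
    the quotient is [k]. *)
Lemma parallel_multiple a b p q : u = dot p a -> v = dot q a -> parallel b a ->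
  exists k, forall i, b i = k * a i.
Proof.
move=> ep eq ba.
have E s i : dot s a * b i = dot s b * a i.
  by rewrite /dot !mulrDl -!mulrA ![a _ * b i]mulrC ![b i * a _]ba.
have [j aj] : exists j, a j != 0.
  apply: contrapT => no; case/eqP: u0; rewrite ep /dot.
  have a0 i : a i = 0 by apply: contrapT => /eqP ai; apply: no; exists i.
  by rewrite !a0 !mulr0 !addr0.
have [|k ek] := @regular_uv (dot p b) (dot q b).
  apply: (mulIf aj); rewrite -!mulrA -!E -ep -eq; ring.
exists k => i; apply: (mulfI u0); rewrite {1}ep E ek; ring.
Qed.

(** By the double cross product, u x = a x (x x p), and similarly with [v], [q] and [w], [r]. It
    remains to correct x x p by a multiple of [a] so that it becomes divisible by [u]; the quotient
    is [z]. *)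
Lemma koszul_exact a p q r x : u = dot p a -> v = dot q a -> w = dot r a ->
  dot a x = 0 -> exists z, forall i, x i = cross a z i.
Proof.
move=> ep eq er ax.
have E s i : cross a (cross x s) i = dot s a * x i.
  by rewrite cross_cross ax mulr0 subr0 mulrC /dot; congr (_ * _); ring.
have K s t : exists k, forall i, dot t a * cross x s i - dot s a * cross x t i = k * a i.
  apply: (parallel_multiple ep eq); apply: parallel_sym; apply: parallel_cross => i.
  have -> : cross a (fun j => dot t a * cross x s j - dot s a * cross x t j) i =
      dot t a * cross a (cross x s) i - dot s a * cross a (cross x t) i.
    by rewrite /cross; ring.
  by rewrite !E; ring.
have [k12 e12] := K p q; have [k13 e13] := K p r; have [k23 e23] := K q r.
rewrite -?ep -?eq -?er in e12 e13 e23.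
have [j aj] : exists j, a j != 0.
  apply: contrapT => no; case/eqP: u0; rewrite ep /dot.
  have a0 i : a i = 0 by apply: contrapT => /eqP ai; apply: no; exists i.
  by rewrite !a0 !mulr0 !addr0.
(* The three relations combine into w k12 = v k13 - u k23; regularity decomposes [k12], and [d] is
   the required correction. *)
have [|c [d ek]] := @regular_uvw k12 (- k23) k13.
  apply: (mulIf aj); rewrite -mulrA -e12 mulrDl mulrN mulNr -!mulrA -e13 -e23; ring.
have /choice[z ez] : forall i, exists zi, cross x p i = d * a i + u * zi.
  move=> i; have [|zi ez] := @regular_uv (cross x p i - d * a i) (cross x q i + c * a i).
    have -> : v * (cross x p i - d * a i) =
      (v * cross x p i - u * cross x q i) + u * cross x q i - v * d * a i by ring.
    by rewrite e12 ek; ring.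
  by exists zi; rewrite -ez; ring.
exists z => i; apply: (mulfI u0); rewrite {1}ep -E /cross.
by rewrite -!/(cross x p _) !ez; ring.
Qed.

Lemma cross_independent a z s t : (exists i, cross a z i != 0) ->
  (forall i, s * a i + t * z i = 0) -> s = 0 /\ t = 0.
Proof.
move=> [i ci] st.
have e : s * a (nxt i) + t * z (nxt i) = 0 by [].
have e' : s * a (nxt (nxt i)) + t * z (nxt (nxt i)) = 0 by [].
split; apply/eqP; have := mulf_eq0.
  move=> /(_ A s (cross a z i)); rewrite (negbTE ci) orbF => <-.
  have -> : s * cross a z i = (s * a (nxt i) + t * z (nxt i)) * z (nxt (nxt i))
    - (s * a (nxt (nxt i)) + t * z (nxt (nxt i))) * z (nxt i) by rewrite /cross; ring.
  by rewrite e e' !mul0r subrr.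
move=> /(_ A t (cross a z i)); rewrite (negbTE ci) orbF => <-.
have -> : t * cross a z i = (s * a (nxt (nxt i)) + t * z (nxt (nxt i))) * a (nxt i)
    - (s * a (nxt i) + t * z (nxt i)) * a (nxt (nxt i)) by rewrite /cross; ring.
by rewrite e e' !mul0r subrr.
Qed.

(* Exactness of the Hilbert-Burch complex of the 2 x 2 minors of (a, z).      *)
Lemma minors_syzygy a z p q x : u = dot (cross a z) p -> v = dot (cross a z) q ->
    dot (cross a z) x = 0 ->
  exists s t, forall i, x i = s * a i + t * z i.
Proof.
move=> ep eq ax.
have nz : exists i, cross a z i != 0.
  apply: contrapT => no; case/eqP: u0; rewrite ep /dot.
  have a0 i : cross a z i = 0 by apply: contrapT => /eqP ai; apply: no; exists i.
  by rewrite !a0 !mul0r !addr0.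
have E y i : dot (cross a z) y * x i = dot (cross x z) y * a i + dot (cross a x) y * z i.
  by rewrite (cramer a z y) ax mul0r addr0.
have [|/eqP + /eqP +] := @cross_independent a z (v * dot (cross x z) p - u * dot (cross x z) q)
    (v * dot (cross a x) p - u * dot (cross a x) q) nz.
  move=> i; have := E p i; have := E q i; rewrite -ep -eq => e1 e2.
  have -> : forall s t s' t' a z : A, (v * s - u * s') * a + (v * t - u * t') * z =
    v * (s * a + t * z) - u * (s' * a + t' * z) by move=> *; ring.
  by rewrite -e1 -e2; ring.
rewrite !subr_eq0 => /eqP/regular_uv[s es] /eqP/regular_uv[t et].
exists s, t => i; apply: (mulfI u0); rewrite {1}ep E es et; ring.
Qed.

(** The resolution is too short for a proper ideal of minors to contain a regular sequence of length
    three. Concretely, regularity gives p = d a + d' z + u y, and pairing with the cross product of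
    [a] and [z] leaves u = u (o.y). *)
Lemma minors_not_primary a z p q r : u = dot (cross a z) p -> v = dot (cross a z) q ->
  w = dot (cross a z) r -> exists y, dot (cross a z) y = 1.
Proof.
move=> ep eq er; set o := cross a z in ep eq er *.
have nz : exists i, cross a z i != 0.
  apply: contrapT => no; case/eqP: u0; rewrite ep /dot.
  have a0 i : o i = 0 by apply: contrapT => /eqP ai; apply: no; exists i.
  by rewrite !a0 !mul0r !addr0.
have S p1 q1 : exists s t, forall i, dot o q1 * p1 i - dot o p1 * q1 i = s * a i + t * z i.
  by apply: (minors_syzygy ep eq); rewrite -/o /dot; ring.
have [s1 [t1 e1]] := S p q; have [s2 [t2 e2]] := S p r; have [s3 [t3 e3]] := S q r.
rewrite -?ep -?eq -?er in e1 e2 e3.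
have [|es et] := @cross_independent a z (w * s1 - v * s2 + u * s3) (w * t1 - v * t2 + u * t3) nz.
  move=> i; have -> : forall x y : A, (w * s1 - v * s2 + u * s3) * x + (w * t1 - v * t2 + u * t3) * y =
     w * (s1 * x + t1 * y) - v * (s2 * x + t2 * y) + u * (s3 * x + t3 * y) by move=> *; ring.
  by rewrite -e1 -e2 -e3; ring.
have [|c [d esd]] := @regular_uvw s1 (- s3) s2.
  by apply/eqP; rewrite -subr_eq0; apply/eqP; rewrite -es; ring.
have [|c' [d' etd]] := @regular_uvw t1 (- t3) t2.
  by apply/eqP; rewrite -subr_eq0; apply/eqP; rewrite -et; ring.
have /choice[y ey] : forall i, exists yi, p i = d * a i + d' * z i + u * yi.
  move=> i; have [|yi ey] := @regular_uv (p i - d * a i - d' * z i) (q i + c * a i + c' * z i).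
    have -> : v * (p i - d * a i - d' * z i) =
      (v * p i - u * q i) + u * q i - v * d * a i - v * d' * z i by ring.
    by rewrite e1 esd etd; ring.
  by exists yi; rewrite -ey; ring.
exists y; apply: (mulfI u0); rewrite mulr1.
have -> : u * dot o y = dot o p - d * dot o a - d' * dot o z.
  by rewrite /dot !ey; ring.
by rewrite dot_crossl dot_crossr !mulr0 !subr0 -ep.
Qed.

End Koszul.

(** * Vector fields tangent to a 1-form *)

Section VectorFields.
Context {n : nat} {K : fieldType}.
Implicit Types (X : 'I_n -> fps n K) (f g h : fps n K) (w : 'I_n -> fps n K).

Lemma pderD i f g : pder i (f + g) = pder i f + pder i g.
Proof. by apply/fpsP => m /=; rewrite mulrnDl. Qed.

Lemma vf_actD X f g : vf_act X (f + g) = vf_act X f + vf_act X g.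
Proof.
by rewrite /vf_act -big_split; apply: eq_bigr => j _; rewrite pderD mulrDr.
Qed.

Lemma vf_actM X f g : vf_act X (f * g) = vf_act X f * g + f * vf_act X g.
Proof.
rewrite /vf_act mulr_suml mulr_sumr -big_split; apply: eq_bigr => j _ /=.
by rewrite pderM; ring.
Qed.

Lemma vf_act0 X : vf_act X 0 = 0.
Proof. by apply: (addrI (vf_act X 0)); rewrite -vf_actD !addr0. Qed.

Lemma vf_actMn X f k : vf_act X (f *+ k) = vf_act X f *+ k.
Proof. by elim: k => [|k IH]; rewrite ?mulr0n ?vf_act0 // !mulrS vf_actD IH. Qed.

Lemma vf_act_sum X (I : Type) (r : seq I) (P : pred I) (E : I -> fps n K) :
  vf_act X (\sum_(i <- r | P i) E i) = \sum_(i <- r | P i) vf_act X (E i).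
Proof. exact: (big_morph _ (vf_actD X) (vf_act0 X)). Qed.

Lemma iter_vf_act_leibniz X f g N : iter N (vf_act X) (f * g) =
  \sum_(l < N.+1) (iter l (vf_act X) f * iter (N - l) (vf_act X) g) *+ 'C(N, l).
Proof.
elim: N => [|N IH]; first by rewrite big_ord1 /= bin0 mulr1n.
rewrite iterS IH vf_act_sum.
have -> : \sum_(l < N.+1) vf_act X ((iter l (vf_act X) f * iter (N - l) (vf_act X) g) *+ 'C(N, l)) =
   \sum_(l < N.+1) (iter l.+1 (vf_act X) f * iter (N - l) (vf_act X) g) *+ 'C(N, l) +
   \sum_(l < N.+1) (iter l (vf_act X) f * iter (N.+1 - l) (vf_act X) g) *+ 'C(N, l).
  rewrite -big_split; apply: eq_bigr => l _ /=.
  by rewrite vf_actMn vf_actM mulrnDl subSn ?iterS // -ltnS.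
rewrite [RHS]big_ord_recl bin0 subn0 /=.
have -> : \sum_(i < N.+1) (iter (bump 0 i) (vf_act X) f * iter (N.+1 - bump 0 i) (vf_act X) g)
     *+ 'C(N.+1, bump 0 i) =
   \sum_(l < N.+1) (iter l.+1 (vf_act X) f * iter (N - l) (vf_act X) g) *+ 'C(N, l) +
   \sum_(l < N.+1) (iter l.+1 (vf_act X) f * iter (N - l) (vf_act X) g) *+ 'C(N, l.+1).
  rewrite -big_split; apply: eq_bigr => l _.
  by rewrite /bump add1n subSS binS mulrnDr; apply: addrC.
rewrite addrCA; congr (_ + _).
rewrite [in LHS]big_ord_recl [in RHS]big_ord_recr /= bin0 ?subn0.
by rewrite (@bin_small N N.+1) // mulr0n addr0.
Qed.

Definition lie_deriv X w : 'I_n -> fps n K :=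
  fun i => vf_act X (w i) + \sum_k w k * pder i (X k).

Definition invariant_core X (P : fps n K -> Prop) : fps n K -> Prop :=
  fun h => forall k, P (iter k (vf_act X) h).

(** Let [a], [b] be the first orders at which the iterates of [f], [g] leave [P]. In the Leibniz
    expansion of order [a + b] a single term is outside [P], and its binomial coefficient is
    invertible in characteristic zero. *)
Lemma invariant_core_prime X P : (forall k, k.+1%:R != 0 :> K) ->
  prime_ideal P -> prime_ideal (invariant_core X P).
Proof.
move=> char0 [idP P1 prim]; have [P0 PD PM] := idP.
have iterD k f g : iter k (vf_act X) (f + g) = iter k (vf_act X) f + iter k (vf_act X) g.
  by elim: k => //= k ->; rewrite vf_actD.
split; first split.
- by move=> k; have -> : iter k (vf_act X) 0 = 0 by elim: k => //= k ->; rewrite vf_act0.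
- by move=> f g Hf Hg k; rewrite iterD; apply: PD.
- move=> f g Hg k; rewrite iter_vf_act_leibniz; apply: ideal_sum => // l _.
  by rewrite -mulrnAl; apply: PM.
- by move=> /(_ 0%N).
move=> f g Hfg; apply: contrapT => /not_orP[/existsNP nf /existsNP ng].
have first_out h : (exists k, ~ P (iter k (vf_act X) h)) -> exists2 k,
    ~ P (iter k (vf_act X) h) & forall j, (j < k)%N -> P (iter j (vf_act X) h).
  move=> [k nk]; have [d] := ubnP k; elim: d k nk => // d IH k nk lt.
  have [[j ltj nj]|no] := pselect (exists2 j, (j < k)%N & ~ P (iter j (vf_act X) h)).
    by apply: (IH j) => //; apply: leq_trans ltj _.
  by exists k => // j ltj; apply: contrapT => nj; apply: no; exists j.
have [a na la] := first_out _ nf; have [b nb lb] := first_out _ ng.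
have lt : (a < (a + b).+1)%N by rewrite ltnS leq_addr.
have := Hfg (a + b)%N; rewrite iter_vf_act_leibniz (bigD1 (Ordinal lt)) //= addKn.
set S := \sum_(i | _) _ => H; have PS : P S.
  apply: ideal_sum => // l ne; have [ltl|gel] := ltnP l a.
    by rewrite -mulrnAr; apply: ideal_mulr => //; apply: la.
  rewrite -mulrnAl; apply: PM; apply: lb.
  have ltal : (a < l)%N by rewrite ltn_neqAle gel andbT eq_sym -val_eqE in ne *.
  by rewrite ltn_subLR ?ltn_add2r // -ltnS ltn_ord.
have : P ((iter a (vf_act X) f * iter b (vf_act X) g) *+ 'C(a + b, a)).
  by rewrite -[X in P X](addrK S); apply: idealB.
have bin0 : ('C(a + b, a))%:R != 0 :> K.
  by have := bin_gt0 (a + b) a; rewrite leq_addr; case: 'C(_, _).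
rewrite -mulr_natl => /(PM (fpsC ('C(a + b, a)%:R)^-1)).
rewrite !mulrA -(rmorph_nat (@fpsC n K)) -(rmorphM (@fpsC n K)) mulVf // rmorph1 mul1r.
by case/prim.
Qed.

End VectorFields.

(** * Removing common factors from a 1-form *)

Section Primitive.
Context {n p : nat} {K : fieldType}.
Local Notation A := (fps p K).
Implicit Types (w e : 'I_n -> A).

Definition primitive e : Prop := forall c : A, c \isn't a GRing.unit ->
  ~ forall i, fdvd c (e i).

Lemma parallel_trans (B : idomainType) (a b c : 'I_n -> B) : (exists i, b i != 0) ->
  parallel a b -> parallel b c -> parallel a c.
Proof.
move=> [k bk] ab bc i j; apply: (mulIf bk).
transitivity (a k * (b i * c j)); first by rewrite mulrA -(ab i k); ring.
by rewrite bc mulrA -(ab j k); ring.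
Qed.

(** Dividing by a common non-unit factor lowers the order of a fixed nonzero coefficient, so the
    process stops. *)
Lemma primitive_exists w : (exists i, w i != 0) ->
  exists e, [/\ parallel e w, exists i, e i != 0 & primitive e].
Proof.
move=> w0; have [i wi] := w0; have [d nd] := ordge_nonzero wi.
have : exists e, parallel e w /\ exists i, ~ ordge d (e i).
  by exists w; split; [move=> k l; rewrite mulrC | exists i].
elim: d {nd} => [|d IH] [e [ew [k nd]]]; first by case: nd.
have ek : e k != 0 by apply/eqP => ek; apply: nd; rewrite ek.
have [[c [cnu /choice[e' ee']]]|no] :=
  pselect (exists c : A, c \isn't a GRing.unit /\ forall i, fdvd c (e i)); last first.
  exists e; split=> //; first by exists k.
  by move=> c cnu H; apply: no; exists c.
have c0 : c != 0 by apply: contraNneq ek => c0; rewrite ee' c0 mul0r.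
apply: IH; exists e'; split.
  by move=> a b; apply: (mulfI c0); rewrite !mulrA -!ee'; apply: ew.
by exists k => H; apply: nd; rewrite ee'; apply: ordge_nonunitM.
Qed.

(** From s w = t e with s nonzero, a prime factor of [s] divides every t e_i, hence divides [t]
    since [e] is primitive; cancelling such primes lowers the order of [s] until it is a unit. *)
Lemma primitive_parallel e w : (exists i, e i != 0) -> primitive e -> parallel w e ->
  exists c, forall i, w i = c * e i.
Proof.
move=> [k ek] prim we; have [d nd] := ordge_nonzero ek.
have : forall i, e k * w i = w k * e i by move=> i; rewrite mulrC we.
move: (w k); move: (e k) ek nd => s; elim: d s => [|d IH] s s0 nd t st.
  by case: nd.
have [su|snu] := boolP (s \is a GRing.unit).
  by exists (s^-1 * t) => i; rewrite -mulrA -st mulKr.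
have [c [s' [es [c0 cnu cprim]]]] := prime_factor (@fps_factorial p K) s0 snu.
have s'0 : s' != 0 by apply: contraNneq s0 => s'0; rewrite es s'0 mulr0.
have [[t' et]|nt] := pselect (fdvd c t).
  apply: (IH s' s'0 _ t') => [H|i]; first by apply: nd; rewrite es; apply: ordge_nonunitM.
  by apply: (mulfI c0); rewrite !mulrA -es -et.
case: (prim c cnu) => i; have : fdvd c (t * e i).
  by rewrite -st es -mulrA; exists (s' * w i).
by case/cprim.
Qed.

End Primitive.

(** Differentiating e /\ w = 0 along [X] gives L_X e /\ w + e /\ L_X w = 0, and the second term
    vanishes. *)
Lemma lie_deriv_parallel n (K : fieldType) (X e w : 'I_n -> fps n K) :
    (exists i, w i != 0) -> parallel e w -> parallel (lie_deriv X w) w ->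
  parallel (lie_deriv X e) w.
Proof.
move=> w0 ew lw i j.
have el : parallel e (lie_deriv X w) by apply: (parallel_trans w0 ew); apply: parallel_sym.
have H1 : lie_deriv X e i * w j - lie_deriv X e j * w i
    + (e i * lie_deriv X w j - e j * lie_deriv X w i) = 0.
  have -> : lie_deriv X e i * w j - lie_deriv X e j * w i
     + (e i * lie_deriv X w j - e j * lie_deriv X w i) =
     (vf_act X (e i * w j) - vf_act X (e j * w i))
     + (\sum_k e k * pder i (X k) * w j - \sum_k e k * pder j (X k) * w i
        + (\sum_k e i * (w k * pder j (X k)) - \sum_k e j * (w k * pder i (X k)))).
    by rewrite -!mulr_suml -!mulr_sumr /lie_deriv !vf_actM; ring.
  rewrite ew subrr add0r -!sumrB -big_split big1 // => k _ /=.
  rewrite -!mulrA ![pder _ _ * w _]mulrC !mulrA ![e k * w _]ew; ring.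
rewrite el subrr addr0 in H1.
by apply/eqP; rewrite -subr_eq0 H1.
Qed.

Section TangentCurve.
Context {K : fieldType}.
Local Notation A := (fps 3 K).
Hypothesis char0 : forall k, k.+1%:R != 0 :> K.

Lemma fpsXm_regular (a b : 'X_{1..3}) (k l : A) : (forall i, a i = 0%N \/ b i = 0%N) ->
  fpsXm b * k = fpsXm a * l -> fdvd (fpsXm a) k.
Proof.
move=> ab e; have [m km|g ->] := @monomial_split 3 K 'I_1 (fun=> a) k; last first.
  by exists (\sum_i g i); rewrite -mulr_suml mulrC.
exists ord0; apply/mnm_lepP => i.
have : fcoef (fpsXm b * k) (m + b)%MM != 0.
  by rewrite mulrC fcoefMXm lem_addl addmK.
rewrite e mulrC fcoefMXm; case: ifP => [/mnm_lepP/(_ i)|]; rewrite ?eqxx //.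
by rewrite mnmDE => le _; case: (ab i) => e0; [rewrite e0 | rewrite e0 addn0 in le].
Qed.

Lemma fpsXm_regular2 (a b c : 'X_{1..3}) (k l m : A) :
    (forall i, a i = 0%N \/ c i = 0%N) -> (forall i, b i = 0%N \/ c i = 0%N) ->
    fpsXm c * k = fpsXm a * l + fpsXm b * m ->
  exists s t, k = fpsXm a * s + fpsXm b * t.
Proof.
move=> ac bc e.
have [x kx|g ->] := @monomial_split 3 K bool (fun i => if i then a else b) k; last first.
  by exists (g true), (g false); rewrite big_bool /=; ring.
have : fcoef (fpsXm c * k) (x + c)%MM != 0.
  by rewrite mulrC fcoefMXm lem_addl addmK.
have le (d : 'X_{1..3}) : (forall i, d i = 0%N \/ c i = 0%N) -> (d <= x + c)%MM -> (d <= x)%MM.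
  move=> dc /mnm_lepP le; apply/mnm_lepP => i; move: (le i); rewrite mnmDE.
  by case: (dc i) => ->; rewrite ?addn0.
rewrite e fcoefD mulrC [fpsXm b * _]mulrC !fcoefMXm.
case: ifP => [/(le _ ac) H _|_]; first by exists true.
case: ifP => [/(le _ bc) H _|_]; first by exists false.
by rewrite addr0 eqxx.
Qed.

(* X is tangent to the foliation w. If X has an isolated zero, then w = X x Z, *)
(* and w vanishes on a curve, by Hilbert-Burch; once common factors have been *)
(* removed from w, its zero locus is invariant by X.                          *)
Theorem tangent_invariant_curve (X w : 'I_3 -> A) : is_singular_vfield X ->
    (exists i, w i != 0) -> \sum_i X i * w i = 0 -> parallel (lie_deriv X w) w ->
  exists P, maximal_noncofinite P /\ forall h, P h -> P (vf_act X h).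
Proof.
move=> singX w0 Xw Lw.
pose IX f := exists c : 'I_3 -> A, f = \sum_i c i * X i.
have idX : ideal IX.
  split.
  - by exists (fun=> 0); rewrite big1 // => i _; rewrite mul0r.
  - move=> f g [c ->] [d ->]; exists (fun i => c i + d i).
    by rewrite -big_split; apply: eq_bigr => i _; rewrite mulrDl.
  - move=> f g [c ->]; exists (fun i => f * c i).
    by rewrite mulr_sumr; apply: eq_bigr => i _; rewrite mulrA.
have [[k Xk]|nX] := pselect (cofinite_ideal IX); last first.
  (* [X] maps every series into [IX], hence into any ideal above it. *)
  have [P [maxP IP]] := maximal_noncofinite_exists idX nX; exists P; split=> // h _.
  have [[idP _ _] _ _] := maxP; rewrite /vf_act; apply: ideal_sum => // j _.
  apply: ideal_mulr => //; apply: IP; exists (fun i => (i == j)%:R).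
  rewrite (bigD1 j) //= eqxx mul1r big1 ?addr0 // => i ne; by rewrite (negbTE ne) mul0r.
have [e [ew e0 prim]] := primitive_exists w0.
have Le : parallel (lie_deriv X e) e.
  apply: (parallel_trans w0); last exact: parallel_sym.
  exact: lie_deriv_parallel.
have [c Lc] := primitive_parallel e0 prim Le.
have [j0 wj0] := w0.
have Xe : dot X e = 0.
  rewrite /dot -(sum_nxt (fun i => X i * e i)); apply: (mulIf wj0).
  rewrite mul0r mulr_suml (eq_bigr (fun i => X i * w i * e j0)).
    by rewrite -mulr_suml Xw mul0r.
  move=> i _; have -> : X i * w i * e j0 = X i * (e j0 * w i) by ring.
  by rewrite -ew mulrA.
pose i0 : 'I_3 := ord0; pose i1 := nxt ord0; pose i2 := nxt (nxt ord0).
(* These monomials belong to [IX] and supply the regular sequence for the Koszul argument. *)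
pose u : A := fpsX i0 ^+ k; pose v : A := fpsX i1 ^+ k; pose t : A := fpsX i2 ^+ k.
have u0 : u != 0.
  rewrite /u -fpsXmMn; apply/eqP => /fpsP/(_ (U_(i0) *+ k)%MM) /=.
  by rewrite eqxx => /eqP; rewrite oner_eq0.
have disj (i j : 'I_3) : i != j -> forall l, (U_(i) *+ k)%MM l = 0%N \/ (U_(j) *+ k)%MM l = 0%N.
  move=> ne l; rewrite !mulmnE !mnm1E.
  by case: (eqVneq i l) => [<-|_]; [right; rewrite eq_sym (negbTE ne)|left].
have n01 : i0 != i1 by rewrite -val_eqE /= /nxt inordK.
have n02 : i0 != i2 by rewrite -val_eqE /= /nxt !inordK.
have n12 : i1 != i2 by rewrite -val_eqE /= /nxt !inordK.
have reg_uv a b : v * a = u * b -> fdvd u a.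
  by rewrite /u /v -!fpsXmMn; apply: fpsXm_regular; apply: disj.
have reg_uvt a b d : t * a = u * b + v * d -> exists x y, a = u * x + v * y.
  by rewrite /u /v /t -!fpsXmMn; apply: fpsXm_regular2; apply: disj.
have IXdot f : IX f -> exists p, f = dot p X.
  by move=> [p ->]; exists p; rewrite (sum_nxt _ ord0).
have [p ep] := IXdot _ (Xk i0); have [q eq] := IXdot _ (Xk i1); have [r er] := IXdot _ (Xk i2).
have [z ez] := koszul_exact u0 reg_uv reg_uvt ep eq er Xe.
pose Ie f := exists y : 'I_3 -> A, f = dot (cross X z) y.
have Iee i : Ie (e i).
  exists (fun j => (j == i)%:R); rewrite (dotE _ _ i) eqxx mulr1 -ez.
  have -> : (nxt i == i) = false by apply/negbTE; case: i => [[|[|[|]]]] //= lt; rewrite -val_eqE /= inordK.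
  have -> : (nxt (nxt i) == i) = false.
    by apply/negbTE; case: i => [[|[|[|]]]] //= lt; rewrite -val_eqE /= /nxt !inordK.
  by rewrite !mulr0 !addr0.
have idIe : ideal Ie.
  split.
  - by exists (fun=> 0); rewrite /dot !mulr0 !addr0.
  - by move=> f g [a ->] [b ->]; exists (fun i => a i + b i); rewrite /dot; ring.
  - by move=> f g [a ->]; exists (fun i => f * a i); rewrite /dot; ring.
(* [Ie] is generated by the [e i], and L_X e = c e expresses each X(e i) through the [e k]. *)
have Ieinv f : Ie f -> Ie (vf_act X f).
  have [IeO IeD IeM] := idIe.
  have Xei i : Ie (vf_act X (e i)).
    have -> : vf_act X (e i) = c * e i - \sum_k e k * pder i (X k).
      by rewrite -Lc /lie_deriv addrK.
    apply: idealB => //; first exact: IeM.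
    by apply: ideal_sum => // j _; apply: ideal_mulr.
  move=> [y ->]; rewrite /dot -!ez !vf_actD !vf_actM.
  by apply: (IeD); [apply: (IeD)|]; apply: (IeD); solve [exact: ideal_mulr | exact: IeM | by apply: ideal_mulr].
have nIe : ~ cofinite_ideal Ie.
  move=> [l Xl].
  have [y] : exists y, dot (cross X z) y = 1.
    have [a ea] := Xl i0; have [b eb] := Xl i1; have [d ed] := Xl i2.
    apply: (@minors_not_primary A (fpsX i0 ^+ l) (fpsX i1 ^+ l) (fpsX i2 ^+ l) _ _ _ X z a b d ea eb ed).
    - rewrite -fpsXmMn; apply/eqP => /fpsP/(_ (U_(i0) *+ l)%MM) /=.
      by rewrite eqxx => /eqP; rewrite oner_eq0.
    - move=> a' b'; rewrite -!fpsXmMn; apply: fpsXm_regular => j; rewrite !mulmnE !mnm1E.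
      by case: (eqVneq i0 j) => [<-|_]; [right; rewrite eq_sym (negbTE n01)|left].
    - move=> a' b' d'; rewrite -!fpsXmMn; apply: fpsXm_regular2 => j; rewrite !mulmnE !mnm1E.
        by case: (eqVneq i0 j) => [<-|_]; [right; rewrite eq_sym (negbTE n02)|left].
      by case: (eqVneq i1 j) => [<-|_]; [right; rewrite eq_sym (negbTE n12)|left].
  move=> /(congr1 (fun f => fcoef f 0%MM)); rewrite /dot !fcoefD !fcoefM0.
  have c0 i : fcoef (cross X z i) 0%MM = 0.
    by rewrite /cross fcoefB !fcoefM0 !singX !mul0r subrr.
  by rewrite !c0 !mul0r !addr0 fcoef1 eqxx => /esym/eqP; rewrite oner_eq0.
have [P [maxP IeP]] := maximal_noncofinite_exists idIe nIe.
have [primeP nP _] := maxP.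
pose Q := invariant_core X P.
have primeQ : prime_ideal Q by apply: invariant_core_prime.
have QP h : Q h -> P h by move=> /(_ 0%N).
have Qe i : Q (e i).
  move=> l; apply: IeP; elim: l => [|l IH] /=; [exact: Iee|exact: Ieinv].
suff PQ h : P h -> Q h by exists P; split=> // h /PQ/(_ 1%N).
move=> Ph; apply: contrapT => nQh.
(* If [Q] were smaller than [P], an irreducible factor in [Q] of a nonzero [e i] would divide every
   [e j], against primitivity. *)
have ch : prime_chain Q P by split=> //; [exists h | apply/prime_noncofinite].
have [i ei] := e0.
have [||f [g [_ irrf Qf]]] := @irreducible_factor 3 K Q (e i) _ _ ei (Qe i).
- by have [_ _] := primeQ.
- by move=> g; apply: prime_ideal_nonunit.
have [_ fnu _] := irrf; apply: (prim f fnu) => j.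
exact: (no_prime_chain3 ch irrf Qf (Qe j)).
Qed.

End TangentCurve.

(** * Formal diffeomorphisms and pullbacks *)

Section ChainRule.
Context {n p : nat} {K : fieldType}.

Lemma pderC i c : pder i (fpsC c : fps n K) = 0.
Proof.
apply/fpsP => m /=; case: eqP => [e|_]; last by rewrite mul0rn.
by have := congr1 (fun t => fun_of_multinom t i) e; rewrite mnmDE mnm1E eqxx mnm0E addn1.
Qed.

Lemma pder0 i : pder i (0 : fps n K) = 0.
Proof. by apply/fpsP => m /=; rewrite mul0rn. Qed.

Lemma pderX i j : pder i (fpsX j : fps n K) = (i == j)%:R.
Proof.
have natE (b : bool) m : fcoef (b%:R : fps n K) m = (b && (m == 0%MM))%:R.
  by case: b; rewrite ?fcoef1.
apply/fpsP => m; rewrite natE /=; have [e|ne] := eqVneq m 0%MM.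
  by rewrite e add0m eq_mnm1 mnm0E andbT.
rewrite andbF; case: eqP => [e|_]; last by rewrite mul0rn.
case/eqP: ne; apply/eqP; rewrite -mdeg_eq0.
by have := congr1 (@mdeg n) e; rewrite mdegD !mdeg1 addn1 => -[->].
Qed.

Lemma pder_ordge i d (f : fps n K) : ordge d.+1 f -> ordge d (pder i f).
Proof. by move=> H m lt /=; rewrite H ?mul0rn // mdegD mdeg1 addn1. Qed.

Lemma pder_sum i (I : Type) (r : seq I) (P : pred I) (E : I -> fps n K) :
  pder i (\sum_(j <- r | P j) E j) = \sum_(j <- r | P j) pder i (E j).
Proof. exact: (big_morph _ (pderD i) (pder0 i)). Qed.

Lemma vf_actX (X : 'I_n -> fps n K) j : vf_act X (fpsX j) = X j.
Proof.
rewrite /vf_act (bigD1 j) //= pderX eqxx mulr1 big1 ?addr0 // => l ne.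
by rewrite pderX (negbTE ne) mulr0.
Qed.

End ChainRule.

(** The defect [phi] of the chain rule is a derivation along the substitution that kills constants
    and variables, hence monomials; differentiation loses one order, whence the shift 1 in the
    continuity argument. *)
Lemma pder_subst n p (K : fieldType) (F : 'I_n -> fps p K) i (h : fps n K) :
    (forall j, in_maximal_ideal (F j)) ->
  pder i (fps_subst h F) = \sum_j fps_subst (pder j h) F * pder i (F j).
Proof.
move=> HF; pose phi h := pder i (fps_subst h F) - \sum_j fps_subst (pder j h) F * pder i (F j).
have phiM f g : phi (f * g) = phi f * fps_subst g F + fps_subst f F * phi g.
  have -> : phi (f * g) = pder i (fps_subst f F) * fps_subst g F + fps_subst f F * pder i (fps_subst g F)
     - (\sum_j fps_subst (pder j f) F * pder i (F j) * fps_subst g F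
        + \sum_j fps_subst f F * (fps_subst (pder j g) F * pder i (F j))).
    rewrite /phi fps_substM // pderM -big_split; congr (_ - _); apply: eq_bigr => j _ /=.
    by rewrite pderM fps_substD !fps_substM //; ring.
  by rewrite -mulr_suml -mulr_sumr /phi; ring.
have phiC x : phi (fpsC x) = 0.
  rewrite /phi fps_substC // pderC big1 ?subrr // => j _.
  by rewrite pderC fps_subst0 mul0r.
have phi1 : phi 1 = 0 by rewrite -(rmorph1 (@fpsC n K)) phiC.
apply/eqP; rewrite -subr_eq0 -/(phi h); apply/eqP; move: h.
apply: (@continuous_eq0 n p K phi 1).
- move=> f g; rewrite /phi fps_substD pderD [RHS]addrACA -opprD -big_split.
  congr (_ - _); apply: eq_bigr => j _ /=.
  by rewrite pderD fps_substD mulrDl.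
- move=> d f Hf; rewrite addn1 in Hf; apply: ordgeD; last apply: ordgeN.
    by apply: pder_ordge; apply: fps_subst_ordge.
  apply: ordge_sum => j _; rewrite mulrC; apply: ordgeMl.
  by apply: fps_subst_ordge => //; apply: pder_ordge.
move=> x a; rewrite phiM phiC mul0r add0r fpsXm_prod.
suff -> : phi (\prod_j fpsX j ^+ a j) = 0 by rewrite mulr0.
apply: (big_ind (fun f => phi f = 0)) => // [f g f0 g0|j _].
  by rewrite phiM f0 g0 mul0r mulr0 addr0.
elim: (a j) => [|k IH]; first by rewrite expr0.
rewrite exprS phiM IH mulr0 addr0; suff -> : phi (fpsX j) = 0 by rewrite mul0r.
have HX l : in_maximal_ideal (fpsX l : fps n K) by rewrite /in_maximal_ideal /= eq_sym mnm1_eq0.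
rewrite /phi fps_substX // (bigD1 j) //= pderX eqxx.
rewrite -(rmorph1 (@fpsC n K)) fps_substC // rmorph1 mul1r big1 ?addr0 ?subrr // => l ne.
by rewrite pderX (negbTE ne) fps_subst0 mul0r.
Qed.

Section Diffeo.
Context {n : nat} {K : fieldType}.
Local Notation A := (fps n K).
Implicit Types (F G : 'I_n -> A) (w : 'I_n -> A).

Definition linear_part F : 'M[K]_n := \matrix_(i, j) fcoef (F i) U_(j)%MM.

Definition jacobian F : 'M[A]_n := \matrix_(i, j) pder i (F j).

Definition constant_term (f : A) : K := fcoef f 0%MM.
HB.instance Definition _ := GRing.isZmodMorphism.Build A K constant_term (fun _ _ => erefl).
Lemma constant_term_is_monoid_morphism : monoid_morphism constant_term.
Proof. by split=> [|f g]; rewrite /constant_term ?fcoef1 ?eqxx // fcoefM0. Qed.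
HB.instance Definition _ :=
  GRing.isMonoidMorphism.Build A K constant_term constant_term_is_monoid_morphism.

Lemma constant_term_pder i f : constant_term (pder i f) = fcoef f U_(i)%MM.
Proof. by rewrite /constant_term /= add0m mnm0E mulr1n. Qed.

Lemma jacobian_det F : is_formal_diffeo F -> \det (jacobian F) != 0.
Proof.
move=> [_ Fu]; apply/eqP => /(congr1 constant_term); rewrite rmorph0 -det_map_mx.
have -> : map_mx constant_term (jacobian F) = (linear_part F)^T.
  by apply/matrixP => i j; rewrite !mxE constant_term_pder.
rewrite det_tr => d0; move: Fu; rewrite unitmxE.
by rewrite -[\matrix_(i, j) _]/(linear_part F) d0 unitr0.
Qed.

Lemma linear_part_comp F G : (forall i, in_maximal_ideal (G i)) ->
  linear_part (fdiff_comp F G) = linear_part F *m linear_part G.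
Proof.
move=> HG; apply/matrixP => i k; rewrite !mxE -constant_term_pder /fdiff_comp.
rewrite -[fsubst _ _]/(fps_subst _ _) pder_subst // /constant_term fcoef_sum.
apply: eq_bigr => j _; rewrite fcoefM0 fps_subst_eqC // -!/(constant_term _).
by rewrite !constant_term_pder !mxE.
Qed.

Lemma formal_diffeo_comp F G : is_formal_diffeo F -> is_formal_diffeo G ->
  is_formal_diffeo (fdiff_comp F G).
Proof.
move=> [HF uF] [HG uG]; split.
  by move=> i; rewrite /in_maximal_ideal fps_subst_eqC //; apply: HF.
by rewrite -[\matrix_(i, j) _]/(linear_part _) linear_part_comp // unitmx_mul uF.
Qed.

Lemma formal_diffeo_id : is_formal_diffeo (@fdiff_id n K).
Proof.
split=> [i|]; first by rewrite /in_maximal_ideal /= eq_sym mnm1_eq0.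
have -> : \matrix_(i, j) fcoef (@fdiff_id n K i) U_(j)%MM = 1%:M.
  by apply/matrixP => i j; rewrite !mxE /= eq_mnm1 eq_sym.
exact: unitmx1.
Qed.

Lemma formal_diffeo_exp F k : is_formal_diffeo F -> is_formal_diffeo (fdiff_exp F k).
Proof.
by move=> dF; elim: k => [|k IH]; [exact: formal_diffeo_id | exact: formal_diffeo_comp].
Qed.

(** Substituting a series tangent to the identity leaves the lowest-order terms of [h] unchanged. *)
Lemma tangent_identity_subst_inj (H : 'I_n -> A) (h : A) : (forall i, in_maximal_ideal (H i)) ->
    (forall i, ordge 2 (H i - fpsX i)) -> fps_subst h H = 0 -> h = 0.
Proof.
move=> HH H2 h0; apply: ordge_eq0; elim=> [|d IH] // m lt.
have diff (b : 'X_{1..n}) :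
    ordge (mdeg b).+1 (\prod_i H i ^+ b i - \prod_i fpsX i ^+ b i).
  pose R d (f g : A) := [/\ ordge d f, ordge d g & ordge d.+1 (f - g)].
  have RM d1 d2 f1 g1 f2 g2 : R d1 f1 g1 -> R d2 f2 g2 -> R (d1 + d2)%N (f1 * f2) (g1 * g2).
    move=> [f1o g1o fg1] [f2o g2o fg2]; split; try exact: ordgeM.
    have -> : f1 * f2 - g1 * g2 = f1 * (f2 - g2) + (f1 - g1) * g2 by ring.
    by apply: ordgeD; [rewrite -addnS; apply: ordgeM | rewrite -addSn; apply: ordgeM].
  have R0 : R 0%N 1 1 by split; rewrite ?subrr.
  suff [_ _] : R (mdeg b) (\prod_i H i ^+ b i) (\prod_i fpsX i ^+ b i) by [].
  rewrite mdegE; elim/big_rec3: _ => // i e f g _ Rgf.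
  apply: (RM) => //; elim: (b i) => [|k IHk]; first by rewrite !expr0.
  rewrite -[k.+1]add1n !exprD !expr1; apply: (RM) => //; split.
  - exact/ordge1P.
  - by apply/ordge1P; rewrite /in_maximal_ideal /= eq_sym mnm1_eq0.
  - exact: H2.
have : fcoef (fps_subst h H - fps_subst h fpsX) m = 0.
  rewrite fcoefB !fcoef_subst -sumrB big1 // => b _; rewrite -mulrBr -fcoefB.
  have [ltb|geb] := ltnP (mdeg b) d; first by rewrite IH ?mul0r.
  by rewrite diff ?mulr0 //; apply: leq_trans lt _.
by rewrite h0 fps_subst_id sub0r fcoefN => /eqP; rewrite oppr_eq0 => /eqP.
Qed.

(** Composition with the inverse [G] of the linear part reduces to the tangent-to-identity case. *)
Lemma formal_diffeo_subst_inj F (h : A) : is_formal_diffeo F -> fps_subst h F = 0 -> h = 0.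
Proof.
move=> [HF uF] h0; pose M := invmx (linear_part F).
pose G : 'I_n -> A := fun i => \sum_j fpsC (M i j) * fpsX j.
have HX i : in_maximal_ideal (fpsX i : A) by rewrite /in_maximal_ideal /= eq_sym mnm1_eq0.
have HG i : in_maximal_ideal (G i).
  rewrite /in_maximal_ideal fcoef_sum big1 // => j _.
  by rewrite fcoefM0 HX mulr0.
have LG : linear_part G = M.
  apply/matrixP => i j; rewrite mxE fcoef_sum.
  under eq_bigr do rewrite fcoefCM [fcoef (fpsX _) _]/= eq_mnm1.
  rewrite (bigD1 j) //= eqxx mulr1 big1 ?addr0 // => l ne.
  by rewrite eq_sym (negbTE ne) mulr0.
have dH : linear_part (fdiff_comp F G) = 1%:M.
  by rewrite linear_part_comp // LG mulmxV.
apply: (@tangent_identity_subst_inj (fdiff_comp F G)).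
- by move=> i; rewrite /in_maximal_ideal fps_subst_eqC //; apply: HF.
- move=> i m; rewrite ltnS leq_eqVlt ltnS leqn0 mdeg_eq0 => /orP[/mdeg1P[j /eqP ->]|/eqP ->].
    have := congr1 (fun M : 'M_n => M i j) dH; rewrite !mxE fcoefB => ->.
    by rewrite /= eq_mnm1 eq_sym subrr.
  by rewrite fcoefB HX subr0 fps_subst_eqC //; apply: HF.
by rewrite -[fdiff_comp F G]/(fun i => fps_subst (F i) G) -fps_subst_comp // h0 fps_subst0.
Qed.

Lemma parallel_lincomb (B : comNzRingType) (M : 'M[B]_n) (a b : 'I_n -> B) :
  parallel a b -> parallel (fun i => \sum_j M i j * a j) (fun i => \sum_j M i j * b j).
Proof.
move=> ab i k; rewrite !mulr_suml.
under eq_bigr do rewrite mulr_sumr; under [RHS]eq_bigr do rewrite mulr_sumr.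
rewrite exchange_big; apply: eq_bigr => j _; apply: eq_bigr => l _ /=.
have -> : M i l * a l * (M k j * b j) = M i l * M k j * (a l * b j) by ring.
by rewrite ab; ring.
Qed.

Lemma pullbackE F w i : pullback F w i = \sum_j jacobian F i j * fps_subst (w j) F.
Proof. by apply: eq_bigr => j _; rewrite mxE mulrC. Qed.

Lemma adj_pullback F w i : \sum_j \adj (jacobian F) i j * pullback F w j =
  \det (jacobian F) * fps_subst (w i) F.
Proof.
pose v : 'cV[A]_n := \col_j fps_subst (w j) F.
transitivity ((\adj (jacobian F) *m (jacobian F *m v)) i 0).
  rewrite mxE; apply: eq_bigr => j _; congr (_ * _); rewrite mxE pullbackE.
  by apply: eq_bigr => l _; rewrite [v _ _]mxE.
by rewrite mulmxA mul_adj_mx mul_scalar_mx !mxE.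
Qed.

Lemma pullback_parallel F w w' : (forall i, in_maximal_ideal (F i)) -> parallel w w' ->
  parallel (pullback F w) (pullback F w').
Proof.
move=> HF ww' i j; rewrite !pullbackE; apply: parallel_lincomb => k l.
by rewrite -!fps_substM // ww'.
Qed.

(** The adjugate of the Jacobian recovers the substituted coefficients up to the nonzero
    determinant; injectivity of substitution then removes [F]. *)
Lemma pullback_parallel_inv F w w' : is_formal_diffeo F ->
  parallel (pullback F w) (pullback F w') -> parallel w w'.
Proof.
move=> dF ww' i j; have [HF _] := dF.
have := @parallel_lincomb _ (\adj (jacobian F)) _ _ ww' i j.
rewrite !adj_pullback => e; apply/eqP; rewrite -subr_eq0; apply/eqP.
apply: (formal_diffeo_subst_inj dF); rewrite fps_substB !fps_substM //.
have d0 := jacobian_det dF; apply: (mulfI d0); apply: (mulfI d0); rewrite !mulr0.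
set D := \det _ in e *.
have -> : forall a b c d : A, D * (D * (a * b - c * d)) = D * a * (D * b) - D * c * (D * d).
  by move=> *; ring.
by rewrite e subrr.
Qed.

Lemma pullback_neq0 F w : is_formal_diffeo F -> (exists i, w i != 0) ->
  exists i, pullback F w i != 0.
Proof.
move=> dF [i wi]; apply: contrapT => no; case/eqP: wi.
apply: (formal_diffeo_subst_inj dF); apply: (mulfI (jacobian_det dF)).
rewrite -adj_pullback mulr0 big1 // => j _.
suff -> : pullback F w j = 0 by rewrite mulr0.
by apply: contrapT => /eqP nj; apply: no; exists j.
Qed.

Lemma pullback_comp F G w : (forall i, in_maximal_ideal (F i)) ->
    (forall i, in_maximal_ideal (G i)) ->
  pullback (fdiff_comp F G) w = pullback G (pullback F w).
Proof.
move=> HF HG; apply/funext => i; rewrite /pullback.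
have subst_sum (E : 'I_n -> A) : fps_subst (\sum_j E j) G = \sum_j fps_subst (E j) G.
  exact: (big_morph (fps_subst^~ G) (fun f g => fps_substD f g G) (fps_subst0 G)).
under [RHS]eq_bigr do rewrite -[fsubst _ _]/(fps_subst _ _) subst_sum mulr_suml.
rewrite exchange_big; apply: eq_bigr => j _ /=.
rewrite /fdiff_comp -[fsubst (F j) G]/(fps_subst _ _) pder_subst // mulr_sumr.
apply: eq_bigr => l _; rewrite fps_substM // mulrA; congr (_ * _ * _).
by rewrite -[RHS]/(fps_subst (fps_subst (w j) F) G) fps_subst_comp.
Qed.

Lemma pullback_id w : pullback (@fdiff_id n K) w = w.
Proof.
apply/funext => i; rewrite /pullback (bigD1 i) //= big1 => [|j ne].
  by rewrite addr0 /fdiff_id pderX eqxx mulr1; apply: fps_subst_id.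
by rewrite /fdiff_id pderX eq_sym (negbTE ne) mulr0.
Qed.

Lemma preserves_foliationP F w : preserves_foliation F w <-> parallel (pullback F w) w.
Proof.
split=> H i j; last by rewrite /wedge11 H subrr.
by apply/eqP; rewrite -subr_eq0; apply/eqP; apply: H.
Qed.

Lemma preserves_foliation_exp F w k : is_formal_diffeo F -> (exists i, w i != 0) ->
  parallel (pullback F w) w -> parallel (pullback (fdiff_exp F k) w) w.
Proof.
move=> dF w0 Fw; elim: k => [|k IH]; first by rewrite pullback_id => i j; rewrite mulrC.
have dk := formal_diffeo_exp k dF; have [HF _] := dF; have [Hk _] := dk.
rewrite -[fdiff_exp F k.+1]/(fdiff_comp F (fdiff_exp F k)) pullback_comp //.
apply: (parallel_trans (pullback_neq0 dk w0)) => //.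
exact: pullback_parallel.
Qed.

Lemma preserves_foliation_cycle F G w : is_formal_diffeo F -> (exists i, w i != 0) ->
  parallel (pullback F w) w -> fdiff_cycle F G -> parallel (pullback G w) w.
Proof.
move=> dF w0 Fw [[HG _] [k [->|GF]]]; first exact: preserves_foliation_exp.
have dk := formal_diffeo_exp k dF; have [Hk _] := dk.
(* Pulling [pullback G w] back by F^k gives [w] itself, which is parallel to the pullback of [w] by
   F^k. *)
apply: (pullback_parallel_inv dk); rewrite -pullback_comp // GF pullback_id.
by apply: parallel_sym; apply: preserves_foliation_exp.
Qed.

Lemma first_integral_exp F (g : A) k : is_formal_diffeo F -> fsubst g F = g ->
  fsubst g (fdiff_exp F k) = g.
Proof.
move=> dF Fg; elim: k => [|k IH]; first exact: fps_subst_id.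
have [Hk _] := formal_diffeo_exp k dF; have [HF _] := dF.
rewrite -[RHS]IH -[in RHS]Fg; apply/esym; exact: fps_subst_comp.
Qed.

Lemma first_integral_cycle F G (g : A) : is_formal_diffeo F -> fsubst g F = g ->
  fdiff_cycle F G -> fsubst g G = g.
Proof.
move=> dF Fg [[HG _] [k [->|GF]]]; first exact: first_integral_exp.
have dk := formal_diffeo_exp k dF; have [Hk _] := dk.
apply/eqP; rewrite -subr_eq0; apply/eqP; apply: (formal_diffeo_subst_inj dk).
rewrite fps_substB -[fsubst g G]/(fps_subst g G) fps_subst_comp //.
rewrite -[fun i => _]/(fdiff_comp G (fdiff_exp F k)) GF fps_subst_id.
by rewrite -[fps_subst g _]/(fsubst _ _) first_integral_exp // subrr.
Qed.

End Diffeo.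

(** * Jets and the Lie algebra of the Zariski closure *)

Lemma fcoef_pder n (K : fieldType) i (f : fps n K) m :
  fcoef (pder i f) m = fcoef f (m + U_(i))%MM *+ (m i).+1.
Proof. by []. Qed.

Section Jets.
Context {n : nat} {K : fieldType} (k : nat).
Local Notation A := (fps n K).
Local Notation N := (@jet_dim n k).

Lemma jet_monom_inj : injective (@jet_monom n k).
Proof. by move=> i j /val_inj/val_inj/enum_val_inj. Qed.

Lemma jet_monom_gt0 (i : 'I_N) : (0 < mdeg (jet_monom i))%N.
Proof. by rewrite /jet_monom; case: (enum_val i). Qed.

Lemma jet_monom_lt (i : 'I_N) : (mdeg (jet_monom i) < k.+1)%N.
Proof. exact: bmdeg. Qed.

Lemma jet_monom_surj (m : 'X_{1..n}) : (0 < mdeg m)%N -> (mdeg m < k.+1)%N ->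
  exists i : 'I_N, jet_monom i = m.
Proof.
move=> gt lt; have gt' : (0 < mdeg (BMultinom lt : 'X_{1..n}))%N by [].
exists (enum_rank (exist _ (BMultinom lt) gt' : @jet_index n k)).
by rewrite /jet_monom enum_rankK.
Qed.

Lemma jet_expansion (h : A) : ordge k.+1 (h - fpsC (fcoef h 0%MM)
  - \sum_(j < N) fpsC (fcoef h (jet_monom j)) * fpsXm (jet_monom j)).
Proof.
move=> m lt; rewrite !fcoefB fcoef_sum.
under eq_bigr do rewrite fcoefCM [fcoef (fpsXm _) _]/=.
have [->|m0] := eqVneq m 0%MM.
  rewrite [fcoef (fpsC _) _]/= eqxx subrr sub0r big1 ?oppr0 // => j _.
  case: eqP => [e|_]; last by rewrite mulr0.
  by have := jet_monom_gt0 j; rewrite -e mdeg0.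
have [|i em] := jet_monom_surj _ lt; first by rewrite lt0n mdeg_eq0.
rewrite [fcoef (fpsC _) _]/= (negbTE m0) subr0 (bigD1 i) //= em eqxx mulr1.
rewrite big1 ?addr0 ?subrr // => j ne; rewrite -em (inj_eq jet_monom_inj) eq_sym.
by rewrite (negbTE ne) mulr0.
Qed.

(** Continuity discards the terms of degree above [k], and the last hypothesis discards the constant
    term; substitutions and derivations are both covered. *)
Lemma jet_mxE (L : A -> A) (h : A) (i : 'I_N) :
    (forall f g, L (f + g) = L f + L g) ->
    (forall x f, L (fpsC x * f) = fpsC x * L f) ->
    (forall d f, ordge d f -> ordge d (L f)) ->
    fcoef (L 1) (jet_monom i) = 0 ->
  fcoef (L h) (jet_monom i) = \sum_j fcoef h (jet_monom j) * jet_mx k L i j.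
Proof.
move=> LD LC Lo L1.
have L0 : L 0 = 0 by apply: (addrI (L 0)); rewrite -LD !addr0.
set S := \sum_(j < N) fpsC (fcoef h (jet_monom j)) * fpsXm (jet_monom j).
have [R [oR eh]] : exists R, ordge k.+1 R /\ h = R + (fpsC (fcoef h 0%MM) * 1 + S).
  by exists (h - fpsC (fcoef h 0%MM) - S); split; [exact: jet_expansion | ring].
rewrite [in LHS]eh !LD LC !fcoefD fcoefCM L1 mulr0 add0r (Lo _ _ oR) ?add0r.
  rewrite (big_morph L LD L0) fcoef_sum; apply: eq_bigr => j _.
  by rewrite LC fcoefCM mxE.
exact: jet_monom_lt.
Qed.

Lemma jet_diffeoE (G : 'I_n -> A) h (i : 'I_N) : (forall j, in_maximal_ideal (G j)) ->
  fcoef (fps_subst h G) (jet_monom i) = \sum_j fcoef h (jet_monom j) * jet_diffeo k G i j.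
Proof.
move=> HG; apply: jet_mxE.
- by move=> f g; apply: fps_substD.
- by move=> x f; rewrite -[fsubst _ _]/(fps_subst _ _) fps_substM // fps_substC.
- by move=> d f; apply: fps_subst_ordge.
rewrite -[fsubst _ _]/(fps_subst _ _) -(rmorph1 (@fpsC n K)) fps_substC // fcoef1.
by have := jet_monom_gt0 i; case: eqP => // ->; rewrite mdeg0.
Qed.

Lemma vf_act_ordge (X : 'I_n -> A) d h : is_singular_vfield X -> ordge d h ->
  ordge d (vf_act X h).
Proof.
move=> singX Hh; apply: ordge_sum => j _; case: d Hh => [|d] Hh //.
rewrite -add1n; apply: ordgeM; first exact/ordge1P.
exact: pder_ordge.
Qed.

Lemma jet_vfieldE (X : 'I_n -> A) h (i : 'I_N) : is_singular_vfield X ->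
  fcoef (vf_act X h) (jet_monom i) = \sum_j fcoef h (jet_monom j) * jet_vfield k X i j.
Proof.
move=> singX.
have vC x : vf_act X (fpsC x) = 0 by rewrite /vf_act big1 // => j _; rewrite pderC mulr0.
apply: jet_mxE.
- exact: vf_actD.
- by move=> x f; rewrite vf_actM vC mul0r add0r.
- by move=> d f; apply: vf_act_ordge.
by rewrite -(rmorph1 (@fpsC n K)) vC.
Qed.

End Jets.

(** The polynomial is existentially hidden, so that sum and product rules apply directly to
    functions of the matrix. *)
Definition derivative_at_one (K : fieldType) N (v : 'M[K]_N) (phi : 'M[K]_N -> K)
    (dphi : K) : Prop :=
  exists P : {mpoly K[N * N]}, (forall M, eval_mx P M = phi M) /\
    \sum_(l < N * N) eval_mx P^`M(l) 1%:M * mxvec v 0 l = dphi.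

Section DerivativeAtOne.
Context {K : fieldType} {N : nat} (v : 'M[K]_N).
Local Notation D := (derivative_at_one v).

Lemma derivative_cst c : D (fun=> c) 0.
Proof.
exists c%:MP; split=> [M|]; first by rewrite /eval_mx mevalC.
by rewrite big1 // => l _; rewrite mderivC /eval_mx meval0 mul0r.
Qed.

Lemma derivative_entry i j : D (fun M => M i j) (v i j).
Proof.
exists 'X_(mxvec_index i j); split=> [M|]; first by rewrite /eval_mx mevalXU mxvecE.
rewrite (bigD1 (mxvec_index i j)) //= big1 => [|l ne].
  rewrite mderivX mnm1E eqxx scale1r (_ : (U_(_) - U_(_))%MM = 0%MM) ?mpolyX0.
    by rewrite /eval_mx meval1 mul1r addr0 mxvecE.
  by apply/mnmP => l; rewrite mnmBE subnn mnm0E.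
by rewrite mderivX mnm1E eq_sym (negbTE ne) scale0r /eval_mx meval0 mul0r.
Qed.

Lemma derivativeD phi psi a b : D phi a -> D psi b -> D (fun M => phi M + psi M) (a + b).
Proof.
move=> [P [eP <-]] [Q [eQ <-]]; exists (P + Q); split=> [M|].
  by rewrite -eP -eQ /eval_mx mevalD.
by rewrite -big_split; apply: eq_bigr => l _ /=; rewrite mderivD /eval_mx mevalD mulrDl.
Qed.

Lemma derivativeM phi psi a b : D phi a -> D psi b ->
  D (fun M => phi M * psi M) (a * psi 1%:M + phi 1%:M * b).
Proof.
move=> [P [eP <-]] [Q [eQ <-]]; exists (P * Q); split=> [M|].
  by rewrite -eP -eQ /eval_mx mevalM.
rewrite mulr_suml mulr_sumr -big_split; apply: eq_bigr => l _ /=.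
by rewrite mderivM /eval_mx mevalD !mevalM -eP -eQ /eval_mx; ring.
Qed.

Lemma derivativeMl c phi a : D phi a -> D (fun M => c * phi M) (c * a).
Proof.
by move=> H; have := derivativeM (derivative_cst c) H; rewrite mul0r add0r.
Qed.

Lemma derivative_sum (I : Type) (r : seq I) (Q : pred I) (phi : I -> 'M[K]_N -> K) a :
  (forall i, Q i -> D (phi i) (a i)) ->
  D (fun M => \sum_(i <- r | Q i) phi i M) (\sum_(i <- r | Q i) a i).
Proof.
move=> H; elim: r => [|i r IH].
  by rewrite big_nil (_ : (fun=> _) = fun=> 0); [exact: derivative_cst | apply/funext => M; rewrite big_nil].
rewrite big_cons (_ : (fun M => _) = fun M => if Q i then phi i M + \sum_(j <- r | Q j) phi j M
  else \sum_(j <- r | Q j) phi j M); last by apply/funext => M; rewrite big_cons.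
by case: ifP => // Qi; apply: derivativeD => //; apply: H.
Qed.

(** A polynomial vanishing on [S] vanishes on its Zariski closure, hence is one of the equations
    that tangent vectors satisfy. *)
Lemma lie_algebra_derivative (S : set 'M[K]_N) phi a :
    lie_algebra (zariski_closure S) v -> D phi a -> (forall M, S M -> phi M = 0) ->
  a = 0.
Proof.
move=> Lv [P [eP <-]] phi0; apply: Lv => M [_]; apply=> M' SM'.
by rewrite eP phi0.
Qed.

End DerivativeAtOne.

Section JetFamilies.
Context {n : nat} {K : fieldType} (k : nat).
Local Notation A := (fps n K).
Local Notation N := (@jet_dim n k).
Variable v : 'M[K]_N.

(* To first order at the identity in the direction v, the family s of series  *)
(* is s1 + ds, modulo terms of degree at least d.                             *)
Definition family_derivative (d : nat) (s : 'M[K]_N -> A) (s1 ds : A) : Prop :=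
  forall m, (mdeg m < d)%N ->
    derivative_at_one v (fun M => fcoef (s M) m) (fcoef ds m)
    /\ fcoef (s 1%:M) m = fcoef s1 m.

Lemma family_derivative_cst d s : family_derivative d (fun=> s) s 0.
Proof. by move=> m _; split=> //; apply: derivative_cst. Qed.

Lemma family_derivativeD d s t s1 t1 ds dt :
    family_derivative d s s1 ds -> family_derivative d t t1 dt ->
  family_derivative d (fun M => s M + t M) (s1 + t1) (ds + dt).
Proof.
move=> Hs Ht m lt; have [Ds es] := Hs m lt; have [Dt et] := Ht m lt.
by rewrite !fcoefD es et; split=> //; apply: derivativeD.
Qed.

Lemma family_derivativeM d s t s1 t1 ds dt :
    family_derivative d s s1 ds -> family_derivative d t t1 dt ->
  family_derivative d (fun M => s M * t M) (s1 * t1) (ds * t1 + s1 * dt).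
Proof.
move=> Hs Ht m lt.
have le (b : 'X_{1..n}) : (b <= m)%MM -> (mdeg b < d)%N /\ (mdeg (m - b) < d)%N.
  move=> bm; split; last by apply: leq_ltn_trans (mdegB _ _) lt.
  by apply: leq_ltn_trans (lemc_mdeg (lem_leo bm)) lt.
split; last first.
  rewrite !fcoefM_sub; apply: eq_bigr => b /le[lb lmb].
  by rewrite (Hs _ lb).2 (Ht _ lmb).2.
rewrite fcoefD !fcoefM_sub -big_split.
rewrite (_ : (fun M => _) = fun M => \sum_(b : 'X_{1..n < (mdeg m).+1} | (b <= m)%MM)
    fcoef (s M) b * fcoef (t M) (m - b)%MM); last first.
  by apply/funext => M; rewrite fcoefM_sub.
apply: derivative_sum => b /le[lb lmb] /=.
rewrite -(Hs _ lb).2 -(Ht _ lmb).2.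
by apply: derivativeM; [case: (Hs _ lb) | case: (Ht _ lmb)].
Qed.

Lemma family_derivative_sum d (I : Type) (r : seq I) (s : I -> 'M[K]_N -> A) s1 ds :
    (forall i, family_derivative d (s i) (s1 i) (ds i)) ->
  family_derivative d (fun M => \sum_(i <- r) s i M) (\sum_(i <- r) s1 i) (\sum_(i <- r) ds i).
Proof.
move=> H; elim: r => [|i r IH].
  rewrite !big_nil (_ : (fun=> _) = fun=> 0); first exact: family_derivative_cst.
  by apply/funext => M; rewrite big_nil.
rewrite !big_cons (_ : (fun M => _) = fun M => s i M + \sum_(j <- r) s j M).
  exact: family_derivativeD.
by apply/funext => M; rewrite big_cons.
Qed.

Lemma family_derivative_pder d i s s1 ds : family_derivative d.+1 s s1 ds ->
  family_derivative d (fun M => pder i (s M)) (pder i s1) (pder i ds).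
Proof.
move=> H m lt; have [|D1 e1] := H (m + U_(i))%MM; first by rewrite mdegD mdeg1 addn1.
split; last by rewrite /= e1.
have -> : (fun M => fcoef (pder i (s M)) m) =
  (fun M => (m i).+1%:R * fcoef (s M) (m + U_(i))%MM).
  by apply/funext => M /=; rewrite mulr_natl.
have -> : fcoef (pder i ds) m = (m i).+1%:R * fcoef ds (m + U_(i))%MM by rewrite /= mulr_natl.
exact: derivativeMl.
Qed.

(** Extends w o G, modulo degree above [k], from jets of diffeomorphisms to all matrices, with
    entries linear in [M]. The constant term is copied from [w], as substitution fixes it; the terms
    of degree above [k] are immaterial. *)
Definition jet_image (w : A) (M : 'M[K]_N) : A := Fps (fun m =>
  if [pick i : 'I_N | jet_monom i == m] is Some i
  then \sum_j fcoef w (jet_monom j) * M i j else fcoef w m).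

Lemma jet_image_monom w M (i : 'I_N) :
  fcoef (jet_image w M) (jet_monom i) = \sum_j fcoef w (jet_monom j) * M i j.
Proof.
rewrite /=; case: pickP => [l /eqP/jet_monom_inj -> //|no].
by have := no i; rewrite eqxx.
Qed.

Lemma jet_image0 w M : fcoef (jet_image w M) 0%MM = fcoef w 0%MM.
Proof.
rewrite /=; case: pickP => // i /eqP e.
by have := jet_monom_gt0 i; rewrite e mdeg0.
Qed.

Lemma jet_index_case (m : 'X_{1..n}) : (mdeg m < k.+1)%N ->
  m = 0%MM \/ exists i : 'I_N, jet_monom i = m.
Proof.
move=> lt; have [->|m0] := eqVneq m 0%MM; [by left | right].
by apply: jet_monom_surj => //; rewrite lt0n mdeg_eq0.
Qed.

Lemma jet_image_diffeo (G : 'I_n -> A) w : (forall i, in_maximal_ideal (G i)) ->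
  forall m, (mdeg m < k.+1)%N ->
    fcoef (jet_image w (jet_diffeo k G)) m = fcoef (fps_subst w G) m.
Proof.
move=> HG m /jet_index_case[->|[i <-]].
  by rewrite jet_image0 fps_subst_eqC.
by rewrite jet_image_monom jet_diffeoE.
Qed.

End JetFamilies.

Lemma jet_image_derivative n (K : fieldType) k (X : 'I_n -> fps n K) (w : fps n K) :
    is_singular_vfield X ->
  family_derivative (jet_vfield k X) k.+1 (jet_image w) w (vf_act X w).
Proof.
move=> singX m /jet_index_case[->|[i <-]]; split.
- rewrite (_ : (fun M => _) = fun=> fcoef w 0%MM); last by apply/funext => M; rewrite jet_image0.
  have -> : fcoef (vf_act X w) 0%MM = 0; last exact: derivative_cst.
  by rewrite /vf_act fcoef_sum big1 // => j _; rewrite fcoefM0 singX mul0r.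
- exact: jet_image0.
- rewrite (_ : (fun M => _) = fun M : 'M[K]_(@jet_dim n k) => \sum_j fcoef w (jet_monom j) * M i j); last first.
    by apply/funext => M; rewrite jet_image_monom.
  rewrite jet_vfieldE //; apply: derivative_sum => j _; apply: derivativeMl.
  exact: derivative_entry.
rewrite jet_image_monom (bigD1 i) //= mxE eqxx mulr1 big1 ?addr0 // => j ne.
by rewrite mxE eq_sym (negbTE ne) mulr0.
Qed.

Section LieAlgebraClosure.
Context {n : nat} {R : realType}.
Local Notation A := (fps n R[i]).
Variables (F X : 'I_n -> A).
Hypotheses (dF : is_formal_diffeo F) (LX : lie_algebra_closure (fdiff_cycle F) X).

(** Each coefficient of g o G - g is a polynomial in the jet of G that vanishes on the group; its
    derivative at the identity is the coefficient of X(g). *)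
Lemma lie_algebra_first_integral (g : A) : fsubst g F = g -> vf_act X g = 0.
Proof.
move=> Fg; have [singX LXk] := LX; apply/fpsP => m.
have lt : (mdeg m < (mdeg m).+2)%N by [].
have [D1 _] := @jet_image_derivative n _ (mdeg m).+1 X g singX m lt.
have D2 := derivativeD D1 (derivative_cst (jet_vfield (mdeg m).+1 X) (- fcoef g m)).
rewrite addr0 in D2; apply: (lie_algebra_derivative (LXk (mdeg m).+1 isT) D2).
move=> _ [G cG <-]; have [[HG _] _] := cG.
rewrite jet_image_diffeo // -[fps_subst g G]/(fsubst g G).
by rewrite (first_integral_cycle dF Fg cG) subrr.
Qed.

(** [PB] extends the pullback of [w] polynomially to matrices, and its derivative at the identity is
    L_X w; differentiating the vanishing of G^*w /\ w gives the claim. *)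
Lemma lie_algebra_foliation (w : 'I_n -> A) : (exists i, w i != 0) ->
  parallel (pullback F w) w -> parallel (lie_deriv X w) w.
Proof.
move=> w0 Fw i j; have [singX LXk] := LX; apply/fpsP => m.
(* The pullback differentiates once, so jets of one order more than the degree of [m] are
   required. *)
pose k := (mdeg m).+1; pose V := jet_vfield k X.
pose PB (l : 'I_n) (M : 'M[R[i]]_(@jet_dim n k)) : A := \sum_q jet_image (w q) M * pder l (jet_image (fpsX q) M).
have DW q : family_derivative V k (jet_image (w q)) (w q) (vf_act X (w q)).
  by move=> m' lt; apply: (jet_image_derivative _ singX); apply: ltnW.
have DPB (l : 'I_n) : family_derivative V k (PB l) (w l) (lie_deriv X w l).
  have := @family_derivative_sum n _ k V k _ (index_enum 'I_n)
    (fun q M => jet_image (w q) M * pder l (jet_image (fpsX q) M))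
    (fun q => w q * pder l (fpsX q))
    (fun q => vf_act X (w q) * pder l (fpsX q) + w q * pder l (X q)).
  have -> : \sum_q w q * pder l (fpsX q) = w l.
    rewrite (bigD1 l) //= pderX eqxx mulr1 big1 ?addr0 // => q ne.
    by rewrite pderX eq_sym (negbTE ne) mulr0.
  have -> : \sum_q (vf_act X (w q) * pder l (fpsX q) + w q * pder l (X q)) = lie_deriv X w l.
    rewrite big_split /= /lie_deriv; congr (_ + _).
    rewrite (bigD1 l) //= pderX eqxx mulr1 big1 ?addr0 // => q ne.
    by rewrite pderX eq_sym (negbTE ne) mulr0.
  apply=> q; apply: family_derivativeM; first exact: DW.
  have := family_derivative_pder l (@jet_image_derivative n _ k X (fpsX q) singX).
  by rewrite vf_actX.
have Dij := family_derivativeD (family_derivativeM (DPB i) (@family_derivative_cst n _ k V k (w j)))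
  (family_derivativeM (DPB j) (@family_derivative_cst n _ k V k (- w i))).
have [D1 _] := Dij m (ltnSn _).
have : fcoef (lie_deriv X w i * w j + w i * 0 + (lie_deriv X w j * - w i + w j * 0)) m = 0.
  apply: (lie_algebra_derivative (LXk k isT) D1) => _ [G cG <-].
  have [[HG _] _] := cG.
  have PBE (l : 'I_n) (m' : 'X_{1..n}) : (mdeg m' < k)%N -> fcoef (PB l (jet_diffeo k G)) m' = fcoef (pullback G w l) m'.
    move=> lt; rewrite /PB /pullback !fcoef_sum; apply: eq_bigr => q _.
    rewrite !fcoefM_sub; apply: eq_bigr => b bm.
    have lb : (mdeg b < k)%N.
      by apply: leq_ltn_trans (lemc_mdeg (lem_leo bm)) lt.
    have lmb : (mdeg (m' - b) < k)%N by apply: leq_ltn_trans (mdegB _ _) lt.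
    rewrite jet_image_diffeo //; last exact: ltnW.
    congr (_ * _); rewrite !fcoef_pder jet_image_diffeo ?fps_substX //.
    by rewrite mdegD mdeg1 addn1.
  transitivity (fcoef (pullback G w i * w j + pullback G w j * - w i) m).
    rewrite !fcoefD !fcoefM_sub; congr (_ + _); apply: eq_bigr => b bm; rewrite PBE //;
      by rewrite ltnS -ltnS bmdeg.
  by rewrite (preserves_foliation_cycle dF w0 Fw cG) mulrN subrr.
rewrite !mulr0 !addr0 mulrN fcoefB => /eqP; rewrite subr_eq0 => /eqP ->.
by rewrite mulrC.
Qed.

End LieAlgebraClosure.

(** * Integrating factors and the exponential *)

(* Cartan's formula: contracting w /\ dw = 0 with X gives                     *)
(* w(X) dw = w /\ i_X dw, and L_X w = i_X dw + d(w(X)) is a multiple of w, so *)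
(* w / w(X) is closed.                                                        *)
Lemma foliation_tangent n (K : fieldType) (X w : 'I_n -> fps n K) :
    defines_foliation w -> ~ has_formal_integrating_factor w ->
    parallel (lie_deriv X w) w ->
  \sum_i X i * w i = 0.
Proof.
move=> [_ integ] nofact Lw; set f := \sum_i X i * w i.
apply: contrapT => /eqP f0; apply: nofact; exists (FracField.tofrac f).
split=> [|i j]; first by rewrite tofrac_eq0.
rewrite /dform1 !fracder_frac // -mulrBl -rmorphB /=.
suff -> : pder i (w j) * f - w j * pder i f - (pder j (w i) * f - w i * pder j f) = 0.
  by rewrite rmorph0 mul0r.
have df l : pder l f = lie_deriv X w l + \sum_k X k * (pder l (w k) - pder k (w l)).
  rewrite /f pder_sum /lie_deriv /vf_act -!big_split /=; apply: eq_bigr => k _.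
  by rewrite pderM; ring.
have contr : \sum_k X k * wedge12 w (dform1 pder w) i j k = 0.
  by rewrite big1 // => k _; rewrite integ mulr0.
have expand : \sum_k X k * wedge12 w (dform1 pder w) i j k =
    w i * (\sum_k X k * (pder j (w k) - pder k (w j)))
    - w j * (\sum_k X k * (pder i (w k) - pder k (w i)))
    + f * (pder i (w j) - pder j (w i)).
  rewrite /f !mulr_sumr mulr_suml -sumrB -big_split; apply: eq_bigr => k _ /=.
  by rewrite /wedge12 /dform1; ring.
rewrite expand in contr.
have -> : pder i (w j) * f - w j * pder i f - (pder j (w i) * f - w i * pder j f) =
   f * (pder i (w j) - pder j (w i)) + w i * pder j f - w j * pder i f by ring.
rewrite !df; set Sj := \sum_k _ in contr *; set Si := \sum_k _ in contr *.
have -> : f * (pder i (w j) - pder j (w i)) + w i * (lie_deriv X w j + Sj)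
    - w j * (lie_deriv X w i + Si) =
    (w i * Sj - w j * Si + f * (pder i (w j) - pder j (w i)))
    + (lie_deriv X w j * w i - lie_deriv X w i * w j) by ring.
by rewrite contr add0r Lw subrr.
Qed.

Lemma differential_neq0 n (K : fieldType) (g : fps n K) :
    (forall k, k.+1%:R != 0 :> K) -> (forall c, g <> fpsC c) ->
  exists i, pder i g != 0.
Proof.
move=> char0 gnc; apply: contrapT => no; apply: (gnc (fcoef g 0%MM)); apply/fpsP => m /=.
case: eqP => [->//|/eqP m0].
have [i mi] : exists i, m i != 0%N.
  apply: contrapT => no'; case/eqP: m0; apply/mnmP => i; rewrite mnm0E.
  by apply: contrapT => /eqP mi; apply: no'; exists i.
have di : pder i g = 0.
  by apply: contrapT => /eqP di; apply: no; exists i.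
have le : (U_(i) <= m)%MM by rewrite lep1mP.
have : fcoef (pder i g) (m - U_(i))%MM = 0 by rewrite di.
rewrite fcoef_pder submK // -mulr_natl => /eqP; rewrite mulf_eq0 => /orP[|/eqP //].
by rewrite (negbTE (char0 _)).
Qed.

Lemma lie_deriv_differential n (K : fieldType) (X : 'I_n -> fps n K) (g : fps n K) i :
  lie_deriv X (fun j => pder j g) i = pder i (vf_act X g).
Proof.
have pderC (a b : 'I_n) : pder a (pder b g) = pder b (pder a g).
  apply/fpsP => m /=; rewrite -!mulrnA -addmA [(U_(a) + _)%MM]addmC addmA.
  congr (_ *+ _); have [->//|ne] := eqVneq a b.
  by rewrite !mnmDE !mnm1E (negbTE ne) eq_sym (negbTE ne) !addn0 mulnC.
rewrite /lie_deriv /vf_act pder_sum -big_split; apply: eq_bigr => k _ /=.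
by rewrite pderM pderC; ring.
Qed.

(** * Jets of an ideal and invariance under the exponential *)

Section Exponential.
Local Open Scope classical_set_scope.
Context {n : nat} {R : realType}.
Local Notation C := R[i].
Local Notation A := (fps n C).

Local Notation T d := ('X_{1..n < d} : finType).
Definition jet_row (d : nat) (f : A) : 'rV[C]_#|T d| := \row_j fcoef f (enum_val j : T d).

Lemma jet_row_eq d (f g : A) : jet_row d f = jet_row d g -> ordge d (f - g).
Proof.
move=> e m lt; rewrite fcoefB.
have := congr1 (fun M : 'rV_#|T d| => M 0 (enum_rank (BMultinom lt : T d))) e.
by rewrite !mxE enum_rankK /= => ->; rewrite subrr.
Qed.

(** Choose a matrix of maximal rank among those whose rows are jets of elements of [P]: appending a
    further such jet cannot raise the rank. *)
Lemma jet_row_span d (P : A -> Prop) : ideal P ->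
  exists r (M : 'M[C]_(r, #|T d|)),
    (forall i, exists2 g, P g & row i M = jet_row d g)
    /\ (forall g, P g -> (jet_row d g <= M)%MS).
Proof.
move=> [P0 _ _].
pose good r (M : 'M[C]_(r, #|T d|)) := forall i, exists2 g, P g & row i M = jet_row d g.
pose ranks k := `[< exists r (M : 'M[C]_(r, #|T d|)), good r M /\ \rank M = k >].
have ex : exists k, ranks k.
  exists (\rank (0 : 'M[C]_(0, #|T d|))); apply/asboolP; exists 0%N, 0.
  by split=> // -[].
have ub k : ranks k -> (k <= #|T d|)%N.
  by move=> /asboolP[r [M [_ <-]]]; apply: rank_leq_col.
case: (ex_maxnP ex ub) => k /asboolP[r [M [gM rM]]] maxk.
exists r, M; split=> // g Pg.
have gM' : good _ (col_mx M (jet_row d g)).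
  move=> i; case: (split_ordP i) => j ->.
    by rewrite rowKu.
  by exists g => //; rewrite rowKd; apply/rowP => l; rewrite !mxE.
have sub : (M <= col_mx M (jet_row d g))%MS.
  by have := submx_refl (col_mx M (jet_row d g)); rewrite col_mx_sub => /andP[].
have le : (\rank (col_mx M (jet_row d g)) <= \rank M)%N.
  by rewrite rM; apply: maxk; apply/asboolP; exists _, (col_mx M (jet_row d g)).
have : (col_mx M (jet_row d g) <= M)%MS.
  by rewrite -(mxrank_leqif_sup sub) eqn_leq le mxrankS.
by rewrite col_mx_sub => /andP[].
Qed.

(** The partial sums lie in [P] and converge only coefficientwise; in each jet space their limit
    stays in the subspace of jets of [P], and m-adic closedness of [P] concludes. *)
Lemma Exp_preserves (P : A -> Prop) (X F : 'I_n -> A) : maximal_noncofinite P ->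
    (forall h, P h -> P (vf_act X h)) -> is_Exp X F ->
  forall h, P h -> P (fsubst h F).
Proof.
move=> maxP XP ExpX h Ph; have [[idP _ _] _ _] := maxP; have [P0 PD PM] := idP.
apply: (maximal_noncofinite_closed maxP) => d.
have [r [M [rowM spanM]]] := jet_row_span d idP.
pose s N : A := \sum_(j < N) fpsC (j`!%:R)^-1 * iter j (vf_act X) h.
have Ps N : P (s N).
  by apply: ideal_sum => // j _; apply: PM; elim: (j : nat) => //= k; apply: XP.
have subM : (jet_row d (fsubst h F) <= M)%MS.
  (* The row space of [M] is cut out by the columns of its cokernel matrix: finitely many linear
     equations, which pass to the limit. *)
  rewrite submxE; apply/eqP/rowP => i; rewrite [RHS]mxE.
  have cvg_s : (\sum_j (jet_row d (s N) 0 j * cokermx M j i : C^o)) @[N --> \oo] -->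
      (\sum_j (jet_row d (fsubst h F) 0 j * cokermx M j i : C^o)).
    apply: cvg_big => [|j _]; first exact: add_continuous.
    apply: cvgMr_tmp; rewrite mxE.
    have -> : (fun N => jet_row d (s N) 0 j : C^o) =
        series (fun k => fcoef (iter k (vf_act X) h) (enum_val j : T d) / k`!%:R : C^o).
      apply/funext => N; rewrite seriesEord /= mxE fcoef_sum; apply: eq_bigr => k _.
      by rewrite fcoefCM mulrC.
    exact: ExpX.
  have s0 : (fun N => \sum_j (jet_row d (s N) 0 j * cokermx M j i : C^o)) = fun=> 0.
    apply/funext => N; have := spanM _ (Ps N); rewrite submxE => /eqP/rowP/(_ i).
    by rewrite !mxE.
  rewrite s0 in cvg_s; rewrite mxE.
  exact: (cvg_unique (@norm_hausdorff _ C^o) cvg_s (cvg_cst (0 : C^o))).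
have /submxP[D eD] := subM.
have /choice[g gE] : forall i, exists g, P g /\ row i M = jet_row d g.
  by move=> i; have [g] := rowM i; exists g.
exists (\sum_i fpsC (D 0 i) * g i).
  by apply: ideal_sum => // i _; apply: PM; case: (gE i).
apply: jet_row_eq; rewrite eD; apply/rowP => j; rewrite !mxE fcoef_sum.
apply: eq_bigr => i _; rewrite fcoefCM; congr (_ * _).
by have := congr1 (fun v : 'rV_#|T d| => v 0 j) (gE i).2; rewrite !mxE.
Qed.

End Exponential.

Theorem proposition4p23 (R : realType) (F : 'I_3 -> fps 3 R[i]) (m : nat)
    (F_germ : is_biholomorphism_germ F) (m_index : embeddability_index F m)
    (F_integral :
       (exists w : 'I_3 -> fps 3 R[i],
          [/\ defines_foliation w, ~ has_formal_integrating_factor w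
            & preserves_foliation F w]) \/
       (exists g : fps 3 R[i], (forall c : R[i], g <> fpsC c) /\ fsubst g F = g)) :
  exists Gamma : prime_idealr (fps 3 R[i]),
    formal_curve Gamma /\ curve_invariant Gamma (fdiff_exp F m).
Proof.
have [dF _] := F_germ; have [_ [X [ExpX LX]] _] := m_index.
have dFm := formal_diffeo_exp m dF; have [singX _] := LX.
have char0 k : k.+1%:R != 0 :> R[i] by rewrite pnatr_eq0.
have [w [w0 Xw Lw]] : exists w : 'I_3 -> fps 3 R[i],
    [/\ exists i, w i != 0, \sum_i X i * w i = 0 & parallel (lie_deriv X w) w].
  case: F_integral => [[w [fol nofact /preserves_foliationP Fw]]|[g [gnc Fg]]].
    have w0 : exists i, w i != 0 by case: fol.
    have Lw : parallel (lie_deriv X w) w.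
      exact: (lie_algebra_foliation dFm LX w0 (preserves_foliation_exp m dF w0 Fw)).
    by exists w; split=> //; apply: foliation_tangent.
  have Xg : vf_act X g = 0.
    exact: (lie_algebra_first_integral dFm LX (first_integral_exp m dF Fg)).
  exists (fun i => pder i g); split=> //; first exact: differential_neq0.
  by move=> i j; rewrite !lie_deriv_differential Xg !pder0 !mul0r.
have [P [maxP XP]] := tangent_invariant_curve char0 singX w0 Xw Lw.
have [primeP _ _] := maxP; have [Gamma GammaE] := prime_idealr_of primeP.
exists Gamma; split; first exact: (maximal_noncofinite_curve maxP GammaE).
by move=> h /GammaE Ph; apply/GammaE; apply: (Exp_preserves maxP XP ExpX).
Qed.
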